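(* Let $\mathcal{S}$ be a set of $n$ records and $\mathbf{p}:\mathcal{S}\to[0,1]$, with $\mu_{\mathcal{S}}=\sum_{v\in\mathcal{S}}\mathbf{p}(v)$. In the External Memory model with memory size $M$ and block size $B$, there is a (static) data structure for the subset sampling problem on $\langle\mathcal{S},\mathbf{p}\rangle$ occupying $\mathcal{O}(n/B)$ space that answers a subset sampling query in $\mathcal{O}\left(\frac{\log^*_B n}{B}+\frac{\mu_{\mathcal{S}}}{B}\log_{M/B}(n/B)\right)$ amortized expected I/Os.
   Context: Subset sampling query: return a random subset $X\subseteq\mathcal{S}$ in which each $v\in\mathcal{S}$ is included independently with probability $\mathbf{p}(v)$, i.e. $\Pr[X=T]=\prod_{v\in T}\mathbf{p}(v)\prod_{v\in\mathcal{S}\setminus T}(1-\mathbf{p}(v))$, independently of previous queries. External Memory model: a machine has $M$ words of memory and an unbounded disk divided into blocks of $B$ words, $M\ge 2B$; an I/O reads one block into memory or writes $B$ words to a block; cost is the number of I/Os (computation is free), space is the number of blocks used. $\log^*_B n$ denotes the smallest $t$ such that applying $\log_2$ to $n$ $t$ times yields a value at most $B$. *)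

(* Defs.v *)
From HB Require Import structures.
From mathcomp Require Import all_boot all_order all_algebra.
From mathcomp Require Import all_classical all_reals all_analysis.
From mathcomp Require Import lra.
Set Implicit Arguments.
Unset Strict Implicit.
Unset Printing Implicit Defensive.
Import Order.TTheory GRing.Theory Num.Theory.
Local Open Scope ring_scope.

Definition log2 {R : realType} (x : R) : R := ln x / ln 2.

Lemma log2_le {R : realType} (x : R) :
  0 < x -> log2 x <= x - (1 - ln 2) / ln 2.
Proof.
move=> x0.
have l2 : 0 < ln 2 :> R by rewrite ln_gt0 // ltr1n.
have hlf : (1 : R) / 2 <= ln 2.
  have := @le_ln1Dx R (- (1 / 2)) ltac:(lra).
  have -> : 1 + - (1 / 2) = 2^-1 :> R by lra.
  by rewrite lnV ?posrE ?ltr0n //; lra.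
have hx : ln x <= x / 2 - 1 + ln 2.
  have := @le_ln1Dx R (x / 2 - 1) ltac:(lra).
  have -> : 1 + (x / 2 - 1) = x / 2 by lra.
  by rewrite ln_div ?posrE ?ltr0n //; lra.
rewrite /log2 ler_pdivrMr // mulrBl divfK ?gt_eqF //.
have : 0 <= x * (ln 2 - 1 / 2) by apply: mulr_ge0; [exact: ltW | rewrite subr_ge0].
lra.
Qed.

Lemma log_star_ex (R : realType) (B n : nat) :
  exists t, iter t log2 (n%:R : R) <= B%:R.
Proof.
set d : R := (1 - ln 2) / ln 2.
have l2 : 0 < ln 2 :> R by rewrite ln_gt0 // ltr1n.
have d0 : 0 < d.
  rewrite divr_gt0 // subr_gt0 -ltr_expR lnK ?posrE ?ltr0n //.
  by have := @expR_gt1Dx R 1 (oner_neq0 _); lra.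
have [//|nE] := pselect (exists t, iter t log2 (n%:R : R) <= B%:R).
have H t : iter t log2 (n%:R : R) <= n%:R - t%:R * d.
  elim: t => [|t IH]; first by rewrite /= mul0r subr0.
  have pos : 0 < iter t log2 (n%:R : R).
    rewrite ltNge; apply/negP => le0; apply: nE; exists t.
    exact: le_trans le0 (ler0n _ _).
  by rewrite iterS (le_trans (log2_le pos)) // -/d -natr1 mulrDl; lra.
exists (Num.truncn (n%:R / d)).+1.
apply: le_trans (H _) (le_trans _ (ler0n _ _)).
by rewrite subr_le0 -ler_pdivrMr // ltW // truncnS_gt.
Qed.

Definition log_star (R : realType) (B n : nat) : nat :=
  ex_minn (log_star_ex R B n).

Definition ceil_div (n B : nat) : nat := (n + B.-1) %/ B.

Definition is_distribution {R : realType} {T : finType} (d : T -> R) : Prop :=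
  (forall x, 0 <= d x) /\ \sum_x d x = 1.

(* M words of memory, K disk blocks of B words each, integers below W. *)
Section Machine.
Variables (R : realType) (M B K W : nat).

(* The B memory cells taking part in a transfer are freely chosen. *)
Inductive io :=
  | Halt
  | Read of 'I_K & {ffun 'I_B -> 'I_M}
  | Write of 'I_K & {ffun 'I_B -> 'I_M}.

Definition io_enc (i : io) : option (bool * 'I_K * {ffun 'I_B -> 'I_M}) :=
  match i with
  | Halt => None
  | Read a f => Some (true, a, f)
  | Write a f => Some (false, a, f)
  end.

Definition io_dec (o : option (bool * 'I_K * {ffun 'I_B -> 'I_M})) : io :=
  match o with
  | None => Halt
  | Some (b, a, f) => if b then Read a f else Write a f
  end.

Lemma io_encK : cancel io_enc io_dec. Proof. by case. Qed.

HB.instance Definition _ := Finite.copy io (can_type io_encK).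

(* One round of free computation followed by an I/O or by the end of the
   query: the cells whose records are reported, the new value of each cell
   (a copy of an old cell or an integer), and the I/O. Records are therefore
   atomic: they can be moved, copied and reported, but neither created nor
   packed together into one word. *)
Definition action : Type :=
  ({set 'I_M} * {ffun 'I_M -> 'I_M + 'I_W} * io)%type.

(* What free computation can depend on: the integers in memory and the
   probabilities of the records in memory. *)
Definition view : Type := {ffun 'I_M -> R + 'I_W}.

Definition program : Type := view -> action -> R.

Definition randomized_program (prog : program) : Prop :=
  forall u, is_distribution (prog u).

Section Execution.
Variables (S : finType) (p : S -> R) (prog : program).

Definition word : Type := (S + 'I_W)%type.
Definition memory : Type := {ffun 'I_M -> word}.
Definition disk : Type := {ffun 'I_K -> {ffun 'I_B -> word}}.
Definition config : Type := (memory * disk)%type.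

Definition view_of (m : memory) : view :=
  [ffun i => match m i with inl v => inl (p v) | inr k => inr k end].

Definition reported (a : action) (m : memory) : {set S} :=
  [set v | [exists i in a.1.1, m i == inl v]].

Definition compute (a : action) (m : memory) : memory :=
  [ffun i => match a.1.2 i with inl j => m j | inr k => inr k end].

Definition do_io (i : io) (c : config) : config :=
  match i with
  | Halt => c
  | Read b f =>
      ([ffun x => if [pick j | f j == x] is Some j then c.2 b j else c.1 x],
       c.2)
  | Write b f =>
      (c.1, [ffun y => if y == b then [ffun j => c.1 (f j)] else c.2 y])
  end.

Definition next_config (a : action) (c : config) : config :=
  do_io a.2 (compute a c.1, c.2).

(* Probability that a query which has reached configuration c and reported A
   so far ends after exactly k further I/Os, in configuration c' and with
   answer X. *)
Fixpoint query_prob (k : nat) (c : config) (A X : {set S}) (c' : config) : R :=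
  \sum_(a : action) prog (view_of c.1) a *
    (let A' := A :|: reported a c.1 in
     match k with
     | 0%N =>
         if a.2 is Halt then ((A' == X) && (next_config a c == c'))%:R else 0
     | k'.+1 =>
         if a.2 is Halt then 0 else query_prob k' (next_config a c) A' X c'
     end).

(* Probability that successive queries started in c have the answers Xs and
   take exactly k I/Os altogether. *)
Fixpoint queries_prob (Xs : seq {set S}) (c : config) (k : nat) : R :=
  match Xs with
  | [::] => (k == 0%N)%:R
  | X :: Xs' =>
      \sum_(i < k.+1) \sum_(c' : config)
        query_prob i c finset.set0 X c' * queries_prob Xs' c' (k - i)
  end.

Definition run_prob (init : config -> R) (Xs : seq {set S}) (k : nat) : R :=
  \sum_(c : config) init c * queries_prob Xs c k.

Definition answers_prob (init : config -> R) (Xs : seq {set S}) : \bar R :=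
  (\sum_(0 <= k <oo) (run_prob init Xs k)%:E)%E.

(* Expectation of the total number of I/Os of the first q queries. It ignores
   non-terminating runs, which have probability 0 whenever answers_prob sums
   to 1 over all sequences of q answers. *)
Definition expected_cost (init : config -> R) (q : nat) : \bar R :=
  (\sum_(0 <= k <oo)
     (k%:R * \sum_(Xs : q.-tuple {set S}) run_prob init Xs k)%:E)%E.

End Execution.
End Machine.

Definition mu {R : realType} {S : finType} (p : S -> R) : R := \sum_v p v.

Definition subset_prob {R : realType} {S : finType} (p : S -> R)
    (T : {set S}) : R :=
  (\prod_(v in T) p v) * \prod_(v in ~: T) (1 - p v).

Definition answers_subset_sampling (R : realType) (M B K W : nat)
    (prog : program R M B K W) (S : finType) (p : S -> R)
    (init : config M B K W S -> R) : Prop :=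
  forall Xs : seq {set S},
    answers_prob p prog init Xs = (\prod_(X <- Xs) subset_prob p X)%:E.

(* log_(M/B) (n/B) is negative when n < B, where it is read as 0. *)
Definition query_bound {R : realType} (M B n : nat) (mu : R) : R :=
  (log_star R B n)%:R / B%:R +
  mu / B%:R * Num.max 0 (ln (n%:R / B%:R) / ln (M%:R / B%:R)).

Definition amortized_expected_cost (R : realType) (M B K W : nat)
    (prog : program R M B K W) (S : finType) (p : S -> R)
    (init : config M B K W S -> R) (bound : R) : Prop :=
  forall q : nat, (expected_cost p prog init q <= (q%:R * bound)%:E)%E.

(* Main.v *)
Require Import Defs.
From mathcomp Require Import all_boot all_order all_algebra.
From mathcomp Require Import all_classical all_reals all_analysis.
From mathcomp Require Import ring lra zify.
Set Implicit Arguments.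
Unset Strict Implicit.
Unset Printing Implicit Defensive.
Import Order.TTheory GRing.Theory Num.Theory.
Local Open Scope ring_scope.
Import numFieldNormedType.Exports.

(** Write [lam v = - ln (1 - p v)]. A light record ([p v <= 1/2]) is in the sample
    iff a Poisson process of rate [lam v] has a point. All light records are laid
    out in a table of [O(n)] slots of equal rate [th], a record occupying
    [nslot] slots, so that a query is: draw a Poisson number [N] of uniform
    table slots, and accept the record of each slot with a probability that
    turns the total rate of [v] into exactly [lam v]. Heavy records, of which
    there are at most [2 mu], are scanned one by one.

    Uniform slots are delivered in batches by a tree of fan-out [M / B] over the
    table, as in a buffer tree turned upside down: a node stores a buffer of
    samples of the slots below it and is refilled by drawing a random child label
    for each position and then replacing the labels of one child after another by
    the next samples of that child, refilling the child recursively when it is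
    exhausted. Each sample thus pays [O(1 / B)] I/Os per level, amortized through
    a potential counting the consumed part of the buffers.

    The program only knows finitely many probabilities exactly, so Poisson
    numbers above [J] are lumped into one event, handled by a scan of the whole
    table that realises the conditional law slot by slot; its probability is
    polynomially small. The answers are tested against the functions
    [\prod_Y P(X is contained in Y)], which determine their law, and the number
    of I/Os is carried by a polynomial variable whose derivative at [1] is the
    expected cost. *)

(** * Finitely supported distributions as weighted lists *)

(** The program is fixed before the instance, and its free computation sees only the memory. So what
    it must know about the instance, namely the number [hb] of heavy blocks and the rate quantised
    as [kq * dl], sits with the control state in the integer of cell 0; the acceptance probabilities
    then undo the rounding exactly. The delicate point is independence between queries, since a
    buffer filled during one query is consumed by later ones. Each configuration is therefore given
    the law of the stream of slots that it still has to deliver, as a functional on lists of test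
    functions. Every round preserves the expectation of the value built from this functional, so a
    whole run has the value of its start, where the buffers hold independent samples and the stream
    is i.i.d. Full buffers have potential 0, so [q] queries cost at most [q] times the bound for
    one, with no start-up term. Heavy blocks are arranged to cost [O(mu / B)] without an additive
    constant. What remains is an additive [O(1 / B)], paid by the [log_star] term, which is at least
    [1] as soon as [n > B]. *)

Lemma In_mem (T : eqType) (x : T) s : List.In x s -> x \in s.
Proof.
by elim: s => //= y s IH [->|/IH]; rewrite inE ?eqxx // => ->; rewrite orbT.
Qed.

Lemma In_map T U (g : T -> U) s y :
  List.In y (map g s) -> exists x, g x = y /\ List.In x s.
Proof.
elim: s => //= x s IH [<-|/IH[z [<- zs]]]; first by exists x; split; [|left].
by exists z; split; [|right].
Qed.

Lemma In_cat T (s t : seq T) y :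
  List.In y (s ++ t) -> List.In y s \/ List.In y t.
Proof. by elim: s => [|x s IH] /=; [right | case=> [|/IH[]]; tauto]. Qed.

Lemma In_flatten T (ss : seq (seq T)) y :
  List.In y (flatten ss) -> exists s, List.In s ss /\ List.In y s.
Proof.
elim: ss => //= s ss IH yss; case: (In_cat yss) => [ys|/IH[s' [s's ys']]].
  by exists s; split; [left|].
by exists s'; split; [right|].
Qed.

Section WeightedLists.
Variable R : realType.
Implicit Types T U : Type.

(** Lists rather than functions on a finite type, because outcomes include families of buffers
    [nat -> nat -> seq T], without decidable equality. Outcomes may repeat or have weight 0, and
    [on_support] speaks about all listed ones. *)
Definition fd T := seq (R * T).

Definition E T (d : fd T) (F : T -> R) : R := \sum_(x <- d) x.1 * F x.2.

Definition on_support T (d : fd T) (P : T -> Prop) : Prop :=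
  forall x, List.In x d -> P x.2.

Definition fd_valid T (d : fd T) : Prop :=
  (forall x, List.In x d -> 0 <= x.1) /\ \sum_(x <- d) x.1 = 1.

Definition ret T (x : T) : fd T := [:: (1, x)].

Definition fmap T U (g : T -> U) (d : fd T) : fd U :=
  [seq (x.1, g x.2) | x <- d].

Definition bind T U (d : fd T) (k : T -> fd U) : fd U :=
  flatten [seq [seq (x.1 * y.1, y.2) | y <- k x.2] | x <- d].

Lemma E_ret T (x : T) F : E (ret x) F = F x.
Proof. by rewrite /E big_seq1 mul1r. Qed.

Lemma E_fmap T U (g : T -> U) d F : E (fmap g d) F = E d (F \o g).
Proof. by rewrite /E /fmap big_map. Qed.

Lemma E_bind T U (d : fd T) (k : T -> fd U) F :
  E (bind d k) F = E d (fun x => E (k x) F).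
Proof.
rewrite /E /bind big_flatten /= big_map; apply: eq_bigr => x _.
by rewrite big_map big_distrr /=; apply: eq_bigr => y _; rewrite mulrA.
Qed.

Lemma eq_E_on T (d : fd T) F G :
  on_support d (fun x => F x = G x) -> E d F = E d G.
Proof.
rewrite /E /on_support; elim: d => [|x d IH] H; first by rewrite !big_nil.
rewrite !big_cons H /=; last by left.
by rewrite IH // => y yd; apply: H; right.
Qed.

Lemma eq_E T (d : fd T) F G : F =1 G -> E d F = E d G.
Proof. by move=> FG; apply: eq_E_on => x _; apply: FG. Qed.

Lemma le_E_on T (d : fd T) F G :
  fd_valid d -> on_support d (fun x => F x <= G x) -> E d F <= E d G.
Proof.
move=> [+ _]; rewrite /E /on_support; elim: d => [|x d IH] H K.
  by rewrite !big_nil.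
rewrite !big_cons lerD // ?ler_wpM2l ?(H x) ?(K x) //=; try by left.
by apply: IH => y yd; [apply: H | apply: K]; right.
Qed.

Lemma E_cst T (d : fd T) (a : R) : fd_valid d -> E d (fun=> a) = a.
Proof. by case=> _ s1; rewrite /E -big_distrl /= s1 mul1r. Qed.

Lemma E_scalel T (d : fd T) a F : E d (fun x => a * F x) = a * E d F.
Proof. by rewrite /E big_distrr /=; apply: eq_bigr => x _; rewrite mulrCA. Qed.

Lemma E_scaler T (d : fd T) a F : E d (fun x => F x * a) = E d F * a.
Proof. by rewrite /E big_distrl /=; apply: eq_bigr => x _; rewrite mulrA. Qed.

Lemma E_add T (d : fd T) F G : E d (fun x => F x + G x) = E d F + E d G.
Proof.
by rewrite /E -big_split /=; apply: eq_bigr => x _; rewrite mulrDr.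
Qed.

Lemma E_sum T (d : fd T) (I : Type) (r : seq I) (F : I -> T -> R) :
  E d (fun x => \sum_(i <- r) F i x) = \sum_(i <- r) E d (F i).
Proof.
rewrite /E exchange_big /=; apply: eq_bigr => x _.
by rewrite big_distrr.
Qed.

Lemma valid_ret T (x : T) : fd_valid (ret x).
Proof. by split; [move=> y [<-|[]] /=|rewrite big_seq1]. Qed.

Lemma valid_fmap T U (g : T -> U) d : fd_valid d -> fd_valid (fmap g d).
Proof.
rewrite /fmap; case=> d0 d1; split; last by rewrite big_map.
by move=> x xd; have [y [<- /d0]] := In_map xd.
Qed.

Lemma valid_bind_on T U (d : fd T) (k : T -> fd U) :
  fd_valid d -> on_support d (fun x => fd_valid (k x)) -> fd_valid (bind d k).
Proof.
rewrite /bind; move=> [d0 d1] kv; split.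
  move=> x xf; have [s [xs]] := In_flatten xf.
  have [y [<- yd]] := In_map xs => xm; have [z [<- zk]] := In_map xm => /=.
  by rewrite mulr_ge0 ?d0 //; case: (kv _ yd) => + _; apply.
rewrite -/(bind d k); suff : E (bind d k) (fun=> 1) = 1.
  by rewrite /E => <-; apply: eq_bigr => x _; rewrite mulr1.
rewrite E_bind (@eq_E_on _ _ _ (fun=> 1)); first exact: E_cst.
by move=> x xd; apply: E_cst; apply: kv.
Qed.

Lemma valid_bind T U (d : fd T) (k : T -> fd U) :
  fd_valid d -> (forall x, fd_valid (k x)) -> fd_valid (bind d k).
Proof. by move=> dv kv; apply: valid_bind_on => // x _. Qed.

Lemma support_ret T (x : T) P : on_support (ret x) P <-> P x.
Proof. by split => [H|Px y [<-|[]] //]; apply: (H (1, x)); left. Qed.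

Lemma support_fmap T U (g : T -> U) d P :
  on_support d (P \o g) -> on_support (fmap g d) P.
Proof. by rewrite /fmap; move=> H x xd; have [y [<- /H]] := In_map xd. Qed.

Lemma support_bind T U (d : fd T) (k : T -> fd U) P :
  on_support d (fun x => on_support (k x) P) -> on_support (bind d k) P.
Proof.
rewrite /bind; move=> H x xf; have [s [xs]] := In_flatten xf.
have [y [<- yd]] := In_map xs => xm; have [z [<- zk]] := In_map xm => /=.
by apply: (H _ yd _ zk).
Qed.

Lemma support_all T (d : fd T) (P : T -> Prop) :
  (forall x, P x) -> on_support d P.
Proof. by move=> H x _. Qed.

(** A program has to be a distribution in every memory state, also in those that no run reaches;
    with [kq = 0], for instance, the weights of [scan_dist] need not sum to 1. The fallback makes
    validity unconditional. *)
Definition checked T (x0 : T) (d : fd T) : fd T :=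
  if `[< fd_valid d >] then d else ret x0.

Lemma valid_checked T (x0 : T) d : fd_valid (checked x0 d).
Proof. by rewrite /checked; case: asboolP => // _; apply: valid_ret. Qed.

Lemma checkedE T (x0 : T) d : fd_valid d -> checked x0 d = d.
Proof. by move=> dv; rewrite /checked; case: asboolP. Qed.

(** [n.-1.+1] keeps this a distribution for [n = 0]. *)
Definition unif (n : nat) : fd nat :=
  [seq (n.-1.+1%:R^-1, i) | i <- iota 0 n.-1.+1].

Lemma E_unif n F : (0 < n)%N -> E (unif n) F = n%:R^-1 * \sum_(i < n) F i.
Proof.
move=> n0; rewrite /E /unif prednK // big_map big_distrr /=.
by rewrite -[n in iota 0 n]subn0 -/(index_iota 0 n) big_mkord.
Qed.

Lemma valid_unif n : fd_valid (unif n).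
Proof.
rewrite /unif; split.
  by move=> x xd; have [y [<- _]] := In_map xd; rewrite /= invr_ge0.
rewrite big_map big_const_seq count_predT size_iota iter_addr addr0.
by rewrite -[LHS]mulr_natr mulVf // pnatr_eq0.
Qed.

Lemma support_unif n : (0 < n)%N -> on_support (unif n) (fun i => i < n)%N.
Proof.
rewrite /unif => n0 x xd; have [y [<- yd]] := In_map xd.
move: (In_mem yd).
by rewrite mem_iota prednK.
Qed.

Fixpoint iid T (k : nat) (d : fd T) : fd (seq T) :=
  if k is k'.+1 then bind d (fun x => fmap (cons x) (iid k' d)) else ret [::].

Lemma valid_iid T k (d : fd T) : fd_valid d -> fd_valid (iid k d).
Proof.
move=> dv; elim: k => [|k IH] /=; first exact: valid_ret.
by apply: valid_bind => // x; apply: valid_fmap.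
Qed.

Lemma support_iid (T : eqType) k (d : fd T) (a : pred T) :
  on_support d a -> on_support (iid k d) (fun s => (size s = k) /\ all a s).
Proof.
move=> da; elim: k => [|k IH] /=; first by apply/support_ret.
apply: support_bind => x xd; apply: support_fmap => s sd /=.
by have [-> ->] := IH s sd; rewrite (da x).
Qed.

Fixpoint subs (l : seq (R * nat)) : fd (seq nat) :=
  if l is x :: l' then
    bind (subs l') (fun s => [:: (x.1, x.2 :: s); (1 - x.1, s)])
  else ret [::].

Lemma valid_subs l : (forall x, List.In x l -> 0 <= x.1 <= 1) ->
  fd_valid (subs l).
Proof.
elim: l => [|x l IH] H /=; first exact: valid_ret.
apply: valid_bind => [|s]; first by apply: IH => y yl; apply: H; right.
have /andP[x0 x1] : 0 <= x.1 <= 1 by apply: H; left.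
split; first by move=> y [<-|[<-|[]]] //=; rewrite subr_ge0.
by rewrite !big_cons big_nil /= addr0 addrC subrK.
Qed.

Lemma E_subs l (h : nat -> R) :
  E (subs l) (fun s => \prod_(a <- s) h a) =
  \prod_(x <- l) (1 - x.1 * (1 - h x.2)).
Proof.
elim: l => [|x l IH] /=; first by rewrite E_ret !big_nil.
rewrite E_bind big_cons -IH -E_scalel; apply: eq_E => s.
by rewrite /E !big_cons big_nil /= addr0; ring.
Qed.

End WeightedLists.

(** * Generating polynomials of I/O counts *)

Section Semantics.
Variables (R : realType) (M B K W : nat) (S : finType) (p : S -> R).
Variable pd : view R M W -> fd R (action M B K W).

Notation cfg := (config M B K W S).

Definition prog_of : program R M B K W :=
  fun u a => \sum_(x <- pd u) x.1 * (x.2 == a)%:R.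

Definition is_halt (i : io M B K) : bool := if i is Halt then true else false.

Lemma sum_prog_of u (F : action M B K W -> R) :
  \sum_a prog_of u a * F a = E (pd u) F.
Proof.
rewrite /prog_of /E.
under eq_bigr do rewrite big_distrl /=.
rewrite exchange_big /=; apply: eq_bigr => x _.
rewrite (bigD1 x.2) //= eqxx mulr1 big1 ?addr0 // => a /negPf na.
by rewrite eq_sym na mulr0 mul0r.
Qed.

Lemma prog_of_randomized :
  (forall u, fd_valid (pd u)) -> randomized_program prog_of.
Proof.
move=> pv u; have [p0 p1] := pv u; split.
  move=> a; rewrite /prog_of; elim: (pd u) p0 => [|x d IH] H.
    by rewrite big_nil.
  rewrite big_cons addr_ge0 ?mulr_ge0 ?H ?ler0n //; first by left.
  by apply: IH => y yd; apply: H; right.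
have := sum_prog_of u (fun=> 1).
under eq_bigr do rewrite mulr1.
by move->; apply: E_cst.
Qed.

Notation nxt := (@next_config M B K W S).
Notation qp := (query_prob p prog_of).
Notation d_ c := (pd (view_of p c.1)).

Lemma query_prob0E (c : cfg) A X c' :
  qp 0 c A X c' =
  E (d_ c) (fun a => (is_halt a.2)%:R *
     ((A :|: reported a c.1 == X) && (nxt a c == c'))%:R).
Proof.
rewrite -sum_prog_of; apply: eq_bigr => a _; congr (_ * _).
by case: a => -[r g] [] * /=; rewrite ?mul1r ?mul0r.
Qed.

Lemma query_probSE k (c : cfg) A X c' :
  qp k.+1 c A X c' =
  E (d_ c) (fun a => (~~ is_halt a.2)%:R *
     qp k (nxt a c) (A :|: reported a c.1) X c').
Proof.
rewrite -sum_prog_of; apply: eq_bigr => a _; congr (_ * _).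
by case: a => -[r g] [] *; rewrite ?mul1r ?mul0r.
Qed.

Lemma query_prob_sub k (c : cfg) (A X : {set S}) c' :
  ~~ (A \subset X) -> qp k c A X c' = 0.
Proof.
elim: k c A => [|k IH] c A nAX.
  rewrite query_prob0E (@eq_E _ _ _ _ (fun=> 0)).
    by rewrite /E big1 // => x _; rewrite mulr0.
  move=> a; case: eqP => [AX|_]; last by rewrite mulr0.
  by rewrite -AX finset.subsetUl in nAX.
rewrite query_probSE (@eq_E _ _ _ _ (fun=> 0)).
  by rewrite /E big1 // => x _; rewrite mulr0.
move=> a; rewrite IH ?mulr0 //; apply: contra nAX.
by apply: fintype.subset_trans; apply: finset.subsetUl.
Qed.

(** Generating polynomial, in the number of I/Os, of the runs of one query that report only elements
    of [Y] and end within [k] rounds; [phi] accounts for the later queries. Containment is tested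
    instead of equality because it factorises over rounds: a union lies in [Y] iff each part does,
    so no accumulated answer has to be carried along. *)
Fixpoint PV (k : nat) (c : cfg) (Y : {set S}) (phi : cfg -> {poly R}) :
    {poly R} :=
  if k is k'.+1 then
    \sum_(x <- d_ c) (x.1 * (reported x.2 c.1 \subset Y)%:R) *:
      (if is_halt x.2.2 then phi (nxt x.2 c)
       else 'X * PV k' (nxt x.2 c) Y phi)
  else 0.

Lemma E_scale_poly T (d : fd R T) F (P : {poly R}) :
  E d F *: P = \sum_(x <- d) x.1 *: (F x.2 *: P).
Proof.
by rewrite /E scaler_suml; apply: eq_bigr => x _; rewrite scalerA.
Qed.

(** Given [A \subset Y], the test on [A :|: reported a] reduces to the one on [reported a]; this is
    why [PV] does not depend on [A]. *)
Lemma PV_query k (c : cfg) (A Y : {set S}) phi : A \subset Y ->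
  PV k c Y phi =
  \sum_(i < k) \sum_(X : {set S} | X \subset Y) \sum_c'
     qp i c A X c' *: ('X^i * phi c').
Proof.
elim: k c A => [|k IH] c A AY; first by rewrite big_ord0.
rewrite big_ord_recl.
under eq_bigr => X _ do under eq_bigr => c' _ do
  rewrite query_prob0E E_scale_poly.
under [X in _ = _ + X]eq_bigr => i _ do under eq_bigr => X _ do
  under eq_bigr => c' _ do rewrite lift0 query_probSE E_scale_poly.
under eq_bigr => X _ do rewrite exchange_big.
rewrite exchange_big /=.
under [X in _ = _ + X]eq_bigr => i _ do under eq_bigr => X _ do
  rewrite exchange_big.
under [X in _ = _ + X]eq_bigr => i _ do rewrite exchange_big.
rewrite [X in _ = _ + X]exchange_big -big_split /=; apply: eq_bigr => x _.
rewrite -scalerA.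
under eq_bigr => X _ do rewrite -scaler_sumr.
under [X in _ = _ + X]eq_bigr => i _ do
  (under eq_bigr => X _ do rewrite -scaler_sumr; rewrite -scaler_sumr).
rewrite -!scaler_sumr -scalerDr; congr (_ *: _).
set A' := A :|: reported x.2 c.1.
have A'Y : (reported x.2 c.1 \subset Y) = (A' \subset Y).
  by rewrite /A' finset.subUset AY.
case hE : (is_halt x.2.2) => /=.
  rewrite [X in _ = _ + X]big1 ?addr0; last first.
    by move=> i _; rewrite big1 // => X _; rewrite big1 // => c' _;
       rewrite mul0r scale0r.
  rewrite A'Y; case: (boolP (A' \subset Y)) => nA'Y.
    rewrite (bigD1 A') //= (bigD1 (nxt x.2 c)) //= !eqxx mul1r expr0 mul1r.
    rewrite big1 ?addr0; last first.
      by move=> c' /negPf nc; rewrite [_ == c']eq_sym nc andbF mulr0 scale0r.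
    rewrite big1 ?addr0 // => X /andP[_ /negPf nX].
    by rewrite big1 // => c' _; rewrite [_ == X]eq_sym nX mulr0 scale0r.
  rewrite scale0r big1 // => X XY; rewrite big1 // => c' _.
  case: eqP => [AX|_]; last by rewrite mulr0 scale0r.
  by rewrite AX XY in nA'Y.
rewrite big1 ?add0r; last first.
  by move=> X _; rewrite big1 // => c' _; rewrite mul0r scale0r.
rewrite A'Y; case: (boolP (A' \subset Y)) => nA'Y; last first.
  rewrite scale0r big1 // => i _; rewrite big1 // => X XY.
  rewrite big1 // => c' _; rewrite query_prob_sub ?mulr0 ?scale0r //.
  by apply: contra nA'Y => AX; apply: fintype.subset_trans AX XY.
rewrite scale1r (IH _ A') // mulr_sumr; apply: eq_bigr => i _.
rewrite mulr_sumr; apply: eq_bigr => X _.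
rewrite mulr_sumr; apply: eq_bigr => c' _.
by rewrite mul1r -scalerAr mulrA exprS.
Qed.

Lemma PV_value k (c : cfg) Y phi :
  (PV k.+1 c Y phi).[1] =
  E (d_ c) (fun a => (reported a c.1 \subset Y)%:R *
    (if is_halt a.2 then (phi (nxt a c)).[1] else (PV k (nxt a c) Y phi).[1])).
Proof.
rewrite /= horner_sum; apply: eq_bigr => x _.
by rewrite hornerZ mulrA; case: is_halt; rewrite ?hornerM ?hornerX ?mul1r.
Qed.

Lemma PV_deriv k (c : cfg) phi :
  (PV k.+1 c [set: S] phi)^`().[1] =
  E (d_ c) (fun a => if is_halt a.2 then (phi (nxt a c))^`().[1] else
     (PV k (nxt a c) [set: S] phi).[1] + (PV k (nxt a c) [set: S] phi)^`().[1]).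
Proof.
rewrite /= linear_sum horner_sum; apply: eq_bigr => x _.
rewrite /= finset.subsetT mulr1 derivZ hornerZ; congr (_ * _).
by case: is_halt; rewrite // derivM derivX hornerD !hornerM hornerX !hornerC !mul1r.
Qed.

Fixpoint stops_within (k : nat) (c : cfg) : Prop :=
  if k is k'.+1 then
    on_support (d_ c) (fun a => is_halt a.2 \/ stops_within k' (nxt a c))
  else False.

Lemma query_prob_stop k i (c : cfg) A X c' :
  stops_within k c -> (k <= i)%N -> qp i c A X c' = 0.
Proof.
elim: k i c A => [|k IH] [|i] c A //= bk ki.
rewrite -/(query_prob p prog_of i.+1 c A X c') query_probSE.
rewrite (@eq_E_on _ _ _ _ (fun=> 0)).
  by rewrite /E big1 // => x _; rewrite mulr0.
move=> x xd; case: (bk x xd) => [->|bn]; first by rewrite mul0r.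
by rewrite (IH _ _ _ bn) ?mulr0.
Qed.

(** [Rd] is meant to hold between queries, [Inv] throughout a query, and [Kq] bounds the rounds of
    one query on every branch. *)
Variables (Inv Rd : cfg -> Prop) (Kq : nat).
Hypothesis pd_valid : forall u, fd_valid (pd u).
Hypothesis Rd_Inv : forall c, Rd c -> Inv c.
Hypothesis Inv_step : forall c, Inv c ->
  on_support (d_ c)
    (fun a => if is_halt a.2 then Rd (nxt a c) else Inv (nxt a c)).
Hypothesis Rd_stops : forall c, Rd c -> stops_within Kq c.

(** A query can only end in a ready configuration, so the induction over queries may restrict the
    intermediate configurations to [Rd]. *)
Lemma query_prob_Rd i (c : cfg) A X c' :
  Inv c -> ~ Rd c' -> qp i c A X c' = 0.
Proof.
move=> + nR; elim: i c A => [|i IH] c A Ic.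
  rewrite query_prob0E (@eq_E_on _ _ _ _ (fun=> 0)).
    by rewrite /E big1 // => x _; rewrite mulr0.
  move=> x xd; have := Inv_step Ic xd.
  case: is_halt => [Rn|_]; last by rewrite mul0r.
  case: (nxt x.2 c =P c') => [E|]; first by rewrite E in Rn.
  by rewrite andbF mulr0.
rewrite query_probSE (@eq_E_on _ _ _ _ (fun=> 0)).
  by rewrite /E big1 // => x _; rewrite mulr0.
move=> x xd; have := Inv_step Ic xd.
by case: is_halt => [_|/IH->]; rewrite ?mul0r ?mulr0.
Qed.

Fixpoint PQ (Ys : seq {set S}) (c : cfg) : {poly R} :=
  if Ys is Y :: Ys' then PV Kq c Y (PQ Ys') else 1.

(** Zeta transform of the subset lattice, taken in all queries at once. *)
Fixpoint SS (Ys : seq {set S}) (h : seq {set S} -> R) : R :=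
  if Ys is Y :: Ys' then
    \sum_(X : {set S} | X \subset Y) SS Ys' (fun Xs => h (X :: Xs))
  else h [::].

Lemma eq_SS Ys h h' :
  (forall Xs, size Xs = size Ys -> h Xs = h' Xs) -> SS Ys h = SS Ys h'.
Proof.
elim: Ys h h' => [|Y Ys IH] h h' H /=; first exact: H.
by apply: eq_bigr => X _; apply: IH => Xs sX; apply: H; rewrite /= sX.
Qed.

Lemma SS_sum (I : Type) (r : seq I) Ys (h : I -> seq {set S} -> R) :
  SS Ys (fun Xs => \sum_(i <- r) h i Xs) = \sum_(i <- r) SS Ys (h i).
Proof.
elim: Ys h => [|Y Ys IH] h //=.
by rewrite exchange_big /=; apply: eq_bigr => X _; rewrite IH.
Qed.

Lemma SS_scale Ys a h : SS Ys (fun Xs => a * h Xs) = a * SS Ys h.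
Proof.
elim: Ys h => [|Y Ys IH] h //=; rewrite big_distrr /=.
by apply: eq_bigr => X _; rewrite IH.
Qed.

(** The zeta transform is unitriangular for inclusion: induction on the size of [X] cancels the
    proper subsets. *)
Lemma SS_inj h h' :
  (forall Ys, SS Ys h = SS Ys h') -> forall Xs, h Xs = h' Xs.
Proof.
move=> H Xs; elim: Xs h h' H => [|X Xs IH] h h' H; first exact: (H [::]).
apply: (IH (fun Xs => h (X :: Xs)) (fun Xs => h' (X :: Xs))) => Ys.
have [n] := ubnP #|X|; elim: n => // n IHn in X *; rewrite ltnS => Xn.
have := H (X :: Ys); rewrite /= (bigD1 X) //= [in RHS](bigD1 X) //=.
rewrite (eq_bigr (fun X => SS Ys (fun Xs => h' (X :: Xs)))) => [/addIr//|].
move=> Z /andP[ZX nZ]; apply: IHn; apply: leq_trans Xn.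
by apply: fintype.proper_card; rewrite finset.properEneq nZ ZX.
Qed.

Lemma sum_ord_ext (V : nmodType) (F : nat -> V) a b : (a <= b)%N ->
  (forall i, (a <= i)%N -> F i = 0) -> \sum_(i < a) F i = \sum_(i < b) F i.
Proof.
move=> ab F0; rewrite (big_ord_widen _ _ ab) big_mkcond /=.
by apply: eq_bigr => i _; case: ltnP => // /F0.
Qed.

Lemma PQ_coef Ys (c : cfg) k : Rd c ->
  (PQ Ys c)`_k = SS Ys (fun Xs => queries_prob p prog_of Xs c k).
Proof.
elim: Ys c k => [|Y Ys IH] c k Rc; first by rewrite /= coef1.
rewrite /= (PV_query _ _ _ (finset.sub0set Y)) coef_sum.
pose F i := \sum_(X : {set S} | X \subset Y) \sum_c'
  (qp i c finset.set0 X c' * (if (k < i)%N then 0 else (PQ Ys c')`_(k - i))).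
rewrite (eq_bigr (fun i : 'I_Kq => F i)); last first.
  move=> i _; rewrite coef_sum; apply: eq_bigr => X _; rewrite coef_sum.
  by apply: eq_bigr => c' _; rewrite coefZ coefXnM.
(* Terms with [i >= Kq] vanish because every branch stops, those with [i > k] because of the factor
   ['X^i]; the common range [Kq + k.+1] avoids comparing [Kq] with [k]. *)
rewrite (@sum_ord_ext _ F Kq (Kq + k.+1)) ?leq_addr //; last first.
  move=> i Ki; rewrite /F big1 // => X _; rewrite big1 // => c' _.
  by rewrite (query_prob_stop _ _ _ (Rd_stops Rc) Ki) mul0r.
rewrite -(@sum_ord_ext _ F k.+1) ?leq_addl //; last first.
  by move=> i ki; rewrite /F big1 // => X _; rewrite big1 // => c' _; rewrite ki mulr0.
rewrite /F exchange_big /=; apply: eq_bigr => X _.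
rewrite SS_sum; apply: eq_bigr => i _; rewrite SS_sum; apply: eq_bigr => c' _.
rewrite SS_scale ltnNge -ltnS ltn_ord /=.
have [Rc'|nRc'] := pselect (Rd c'); first by rewrite IH.
by rewrite (query_prob_Rd _ _ _ (Rd_Inv Rc) nRc') !mul0r.
Qed.

Lemma queries_prob_stop Xs (c : cfg) k : Rd c -> (size Xs * Kq < k)%N ->
  queries_prob p prog_of Xs c k = 0.
Proof.
elim: Xs c k => [|X Xs IH] c k Rc /=; first by rewrite mul0n; case: k.
rewrite mulSn => hk; rewrite big1 // => i _; rewrite big1 // => c' _.
have [Ki|iK] := leqP Kq i.
  by rewrite (query_prob_stop _ _ _ (Rd_stops Rc) Ki) mul0r.
have [Rc'|nRc'] := pselect (Rd c'); last first.
  by rewrite (query_prob_Rd _ _ _ (Rd_Inv Rc) nRc') mul0r.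
by rewrite IH ?mulr0 //; have := ltn_ord i; lia.
Qed.

Lemma size_PQ Ys (c : cfg) : Rd c -> (size (PQ Ys c) <= (size Ys * Kq).+1)%N.
Proof.
move=> Rc; apply/leq_sizeP => k hk; rewrite PQ_coef //.
rewrite (@eq_SS _ _ (fun=> 0 * 0)) ?SS_scale ?mul0r // => Xs sX.
by rewrite queries_prob_stop ?mulr0 // sX.
Qed.

Lemma eseries_finite (u : nat -> R) N : (forall k, (N <= k)%N -> u k = 0) ->
  (\sum_(0 <= k <oo) (u k)%:E)%E = (\sum_(k < N) u k)%:E.
Proof.
move=> u0; apply: cvg_lim => //; apply: cvg_near_cst.
exists N => // n /= Nn.
rewrite big_mkord -sumEFin -(@sum_ord_ext _ (fun k => (u k)%:E) N n) //.
by move=> i Ni; rewrite u0.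
Qed.

Variable init : cfg -> R.
Hypothesis init_Rd : forall c, init c != 0 -> Rd c.

Lemma run_prob_stop Xs k : (size Xs * Kq < k)%N ->
  run_prob p prog_of init Xs k = 0.
Proof.
move=> hk; rewrite /run_prob big1 // => c _.
have [->|nc] := eqVneq (init c) 0; first by rewrite mul0r.
by rewrite queries_prob_stop ?mulr0 //; apply: init_Rd.
Qed.

(** An independent subset avoids the complement of [Y] with probability
    [\prod_(v in ~: Y) (1 - p v)]. The proof expands [\prod_v ((v \in Y)%:R * p v + (1 - p v))] over
    all subsets, where those not inside [Y] vanish. *)
Lemma SS_subset_prob Ys :
  SS Ys (fun Xs => \prod_(X <- Xs) subset_prob p X) =
  \prod_(Y <- Ys) \prod_(v in ~: Y) (1 - p v).
Proof.
elim: Ys => [|Y Ys IH] /=; first by rewrite !big_nil.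
rewrite big_cons -IH.
under eq_bigr => X _ do under eq_SS => Xs _ do rewrite big_cons.
under eq_bigr => X _ do rewrite SS_scale.
rewrite -big_distrl /=; congr (_ * _).
transitivity (\prod_v ((v \in Y)%:R * p v + (1 - p v))).
  rewrite bigA_distr [RHS](bigID (fun X : {set S} => X \subset Y)) /=.
  rewrite [X in _ = _ + X]big1 ?addr0; last first.
    move=> X /fintype.subsetPn[v vX nvY]; rewrite (bigD1 v) //= vX (negPf nvY).
    by rewrite !mul0r.
  apply: eq_bigr => X /fintype.subsetP XY; rewrite /subset_prob.
  rewrite [RHS](bigID (mem X)) /=; congr (_ * _).
    by apply: eq_bigr => v vX; rewrite vX XY // mul1r.
  by apply: eq_big => [v|v]; rewrite finset.in_setC // => /negPf ->.
rewrite (bigID (mem Y)) /= big1 ?mul1r.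
  by apply: eq_big => [v|v]; rewrite ?finset.in_setC // => /negPf ->;
     rewrite mul0r add0r.
by move=> v ->; rewrite mul1r addrC subrK.
Qed.

Theorem answers_of_value :
  (forall Ys, \sum_c init c * (PQ Ys c).[1] =
     \prod_(Y <- Ys) \prod_(v in ~: Y) (1 - p v)) ->
  answers_subset_sampling prog_of p init.
Proof.
move=> H Xs; rewrite /answers_prob.
rewrite (@eseries_finite _ (size Xs * Kq).+1); last first.
  by move=> k hk; apply: run_prob_stop.
congr (_%:E); move: Xs; apply: SS_inj => Ys.
rewrite SS_subset_prob -H.
rewrite (@eq_SS _ _ (fun Xs => \sum_(k < (size Ys * Kq).+1)
  run_prob p prog_of init Xs k)); last by move=> Xs ->.
rewrite SS_sum /run_prob.
under eq_bigr do (rewrite SS_sum; under eq_bigr do rewrite SS_scale).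
rewrite exchange_big /=; apply: eq_bigr => c _; rewrite -big_distrr /=.
have [->|/init_Rd Rc] := eqVneq (init c) 0; first by rewrite !mul0r.
rewrite (horner_coef_wide _ (size_PQ Ys Rc)); congr (_ * _).
by apply: eq_bigr => k _; rewrite expr1n mulr1 PQ_coef.
Qed.

Lemma SS_tuple q h : SS (nseq q [set: S]) h = \sum_(Xs : q.-tuple {set S}) h Xs.
Proof.
elim: q h => [|q IH] h /=.
  rewrite (bigD1 [tuple]) //= big1 ?addr0 // => t.
  by case/eqP; apply: tuple0.
rewrite (eq_bigl xpredT) => [|X]; last by rewrite finset.subsetT.
under eq_bigr => X _ do rewrite IH.
rewrite pair_big /=.
rewrite [RHS](reindex (fun x : {set S} * q.-tuple {set S} =>
   [tuple of x.1 :: x.2])) /=; first exact: eq_bigr.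
exists (fun t : q.+1.-tuple {set S} => (thead t, [tuple of behead t])).
  by move=> [X t] _ /=; rewrite theadE; congr (_, _); apply: val_inj.
by move=> t _ /=; rewrite -tuple_eta.
Qed.

(** Testing with [[set: S]] imposes no condition, and [\sum_k k * a_k] is the derivative at 1 of the
    polynomial with coefficients [a_k]; stopping makes the series a finite sum. *)
Theorem cost_of_deriv (bound : R) :
  (forall q, \sum_c init c * (PQ (nseq q [set: S]) c)^`().[1] <= q%:R * bound) ->
  amortized_expected_cost prog_of p init bound.
Proof.
move=> H q; rewrite /expected_cost.
set N := (q * Kq).+1.
rewrite (@eseries_finite _ N); last first.
  move=> k hk; rewrite big1 ?mulr0 // => Xs _.
  by rewrite run_prob_stop // size_tuple.
rewrite lee_fin; apply: le_trans (H q); rewrite le_eqVlt; apply/orP; left; apply/eqP.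
under eq_bigr => k _ do
  rewrite -(SS_tuple q (fun Xs => run_prob p prog_of init Xs k)) /run_prob SS_sum.
under eq_bigr do under eq_bigr do rewrite SS_scale.
under eq_bigr do rewrite big_distrr /=.
rewrite exchange_big /=; apply: eq_bigr => c _.
have [->|/init_Rd Rc] := eqVneq (init c) 0.
  by rewrite mul0r big1 // => k _; rewrite mul0r mulr0.
under eq_bigr => k _ do rewrite mulrCA -PQ_coef //.
rewrite -big_distrr /=; congr (_ * _).
have sz := size_PQ (nseq q [set: S]) Rc; rewrite size_nseq in sz.
rewrite (@horner_coef_wide _ (q * Kq)); last first.
  by apply: leq_trans (size_poly _ _) _; rewrite -subn1 leq_subLR add1n.
rewrite /N big_ord_recl mul0r add0r; apply: eq_bigr => k _.
by rewrite expr1n mulr1 coef_deriv mulr_natl.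
Qed.

Lemma PV_mass k (c : cfg) phi : Inv c -> stops_within k c ->
  (forall c', Rd c' -> (phi c').[1] = 1) -> (PV k c [set: S] phi).[1] = 1.
Proof.
move=> + + phi1; elim: k c => // k IH c Ic bc.
rewrite PV_value (@eq_E_on _ _ _ _ (fun=> 1)); first exact: E_cst.
move=> x xd; rewrite finset.subsetT mul1r; have := Inv_step Ic xd.
by case: (bc x xd) => [->/phi1//|bn]; case: is_halt => [/phi1//|In]; apply: IH.
Qed.

Lemma PQ_mass q (c : cfg) : Rd c -> (PQ (nseq q [set: S]) c).[1] = 1.
Proof.
elim: q c => [|q IH] c Rc /=; first by rewrite hornerC.
by apply: PV_mass => //; [apply: Rd_Inv | apply: Rd_stops].
Qed.

(** The value at 1 of the continuation in [PV_deriv] is its total mass, which is 1 by termination: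
    it counts the I/O just made. *)
Lemma PV_cost k (c : cfg) q : Inv c -> stops_within k.+1 c ->
  (PV k.+1 c [set: S] (PQ (nseq q [set: S])))^`().[1] =
  E (d_ c) (fun a => if is_halt a.2
     then (PQ (nseq q [set: S]) (nxt a c))^`().[1] else
     1 + (PV k (nxt a c) [set: S] (PQ (nseq q [set: S])))^`().[1]).
Proof.
move=> Ic bc; rewrite PV_deriv; apply: eq_E_on => x xd.
have := Inv_step Ic xd; have := bc x xd.
case: is_halt => // -[//|bn] In; congr (_ + _).
by apply: PV_mass => // c'; apply: PQ_mass.
Qed.

End Semantics.

(** * Poisson weights *)

Section Poisson.
Variable R : realType.
Implicit Types (x y : R) (t c : nat).

Definition pois x c : R := expR (- x) * (x ^+ c / c`!%:R).

Definition tail t x : R := 1 - \sum_(c < t) pois x c.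

Lemma pois_ge0 x c : 0 <= x -> 0 <= pois x c.
Proof. by move=> x0; rewrite !mulr_ge0 ?expR_ge0 ?exprn_ge0 ?invr_ge0. Qed.

Lemma sum_pois_exp t x :
  \sum_(c < t) pois x c = expR (- x) * series (exp_coeff x) t.
Proof.
by rewrite /pois -big_distrr /= /series /= big_mkord.
Qed.

Lemma series_exp_le x t : 0 <= x -> series (exp_coeff x) t <= expR x.
Proof.
move=> x0; rewrite /expR; apply: nondecreasing_cvgn_le.
  by apply: nondecreasing_series => i _ _; exact: exp_coeff_ge0.
exact: is_cvg_series_exp_coeff.
Qed.

Lemma tail_ge0 t x : 0 <= x -> 0 <= tail t x.
Proof.
move=> x0; rewrite subr_ge0 sum_pois_exp expRN mulrC ler_pdivrMr ?expR_gt0 //.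
by rewrite mul1r series_exp_le.
Qed.

Lemma tail0 x : tail 0 x = 1.
Proof. by rewrite /tail big_ord0 subr0. Qed.

Lemma tailS t x : tail t.+1 x = tail t x - pois x t.
Proof. by rewrite /tail big_ord_recr /= opprD addrA. Qed.

Lemma tail_gt0 t x : 0 < x -> 0 < tail t x.
Proof.
move=> x0; have := tail_ge0 t.+1 (ltW x0); rewrite tailS subr_ge0.
by apply: lt_le_trans; rewrite !mulr_gt0 ?expR_gt0 ?exprn_gt0 ?invr_gt0 ?ltr0n ?fact_gt0.
Qed.

Lemma tail_0 t : tail t.+1 0 = 0.
Proof.
rewrite /tail big_ord_recl /pois oppr0 expR0 expr0 fact0 divr1 mul1r.
by rewrite big1 ?addr0 ?subrr // => i _; rewrite lift0 expr0n mul0r mulr0.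
Qed.

Lemma pois_conv t x y :
  pois (x + y) t = \sum_(c < t.+1) pois x c * pois y (t - c).
Proof.
rewrite /pois addrC exprDn opprD expRD big_distrl big_distrr /=.
apply: eq_bigr => c _; have ct : (c <= t)%N by rewrite -ltnS.
have cn0 k : k`!%:R != 0 :> R by rewrite pnatr_eq0 -lt0n fact_gt0.
rewrite -(bin_fact ct) !natrM -[_ *+ 'C(_, _)]mulr_natr.
have bn0 : 'C(t, c)%:R != 0 :> R by rewrite pnatr_eq0 -lt0n bin_gt0.
by field; rewrite !cn0 bn0.
Qed.

(** At least [t] points in two independent Poisson processes: the first has [c < t] points and the
    second at least [t - c], or the first alone has at least [t]. *)
Lemma tail_conv t x y :
  \sum_(c < t) pois x c * tail (t - c) y + tail t x = tail t (x + y).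
Proof.
elim: t => [|t IH]; first by rewrite big_ord0 add0r !tail0.
rewrite !tailS -IH pois_conv big_ord_recr /= subSnn.
rewrite [X in _ = _ - X]big_ord_recr /= subnn tailS tail0.
have -> : \sum_(c < t) pois x c * tail (t.+1 - c) y =
  \sum_(c < t) pois x c * tail (t - c) y - \sum_(c < t) pois x c * pois y (t - c).
  rewrite -sumrB; apply: eq_bigr => c _.
  by rewrite subSn ?tailS ?mulrBr // ltnW.
by ring.
Qed.

Lemma pois_mulS x c : pois x c.+1 * c.+1%:R = x * pois x c.
Proof.
rewrite /pois factS natrM exprS.
have c0 : c`!%:R != 0 :> R by rewrite pnatr_eq0 -lt0n fact_gt0.
by field; rewrite c0 addrC natr1 pnatr_eq0.
Qed.

Lemma pois_mean_le t x : 0 <= x -> \sum_(c < t) pois x c * c%:R <= x.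
Proof.
move=> x0; case: t => [|t]; first by rewrite big_ord0.
rewrite big_ord_recl mulr0 add0r.
under eq_bigr => c _ do rewrite lift0 pois_mulS.
rewrite -big_distrr /= -[leRHS]mulr1 ler_wpM2l //.
by have := tail_ge0 t x0; rewrite subr_ge0.
Qed.

(** Markov's inequality for a Poisson variable of mean [x]. It is proved for partial sums up to [n],
    where everything is finite, and then [n] tends to infinity. *)
Lemma tail_markov t x : 0 <= x -> t%:R * tail t x <= x.
Proof.
move=> x0; suff H n : t%:R * (\sum_(c < n) pois x c - \sum_(c < t) pois x c) <= x.
  have cv : ((fun n => t%:R * (\sum_(c < n) pois x c - \sum_(c < t) pois x c))
      @ \oo --> t%:R * tail t x)%classic.
    apply: cvgM; first exact: cvg_cst.
    apply: cvgB; last exact: cvg_cst.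
    rewrite (_ : (fun n => _) = fun n => expR (- x) * series (exp_coeff x) n);
      last by apply/funext => n; rewrite sum_pois_exp.
    rewrite -(expR0 R) -(subrr x) [x - x]addrC expRD.
    apply: cvgM; first exact: cvg_cst.
    exact: is_cvg_series_exp_coeff.
  rewrite -(cvg_lim _ cv) //; apply: limr_le; first by apply/cvg_ex; eexists; exact: cv.
  by apply: nearW => n; apply: H.
have [nt|tn] := leqP n t.
  apply: (le_trans _ x0); rewrite mulr_ge0_le0 // subr_le0.
  rewrite (big_ord_widen _ _ nt) big_mkcond /=.
  by apply: ler_sum => c _; case: ifP => _; rewrite ?lexx ?pois_ge0.
rewrite (big_ord_widen _ _ (ltnW tn)) [X in _ - X]big_mkcond -sumrB big_distrr /=.
apply: le_trans (pois_mean_le n x0); apply: ler_sum => c _.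
case: ltnP => ct; first by rewrite subrr mulr0 mulr_ge0 ?pois_ge0.
by rewrite subr0 mulrC ler_wpM2l ?pois_ge0 ?ler_nat.
Qed.

(* The number of draws: [N <= J] with its Poisson weight, and [J.+1] for all
   larger values together. *)
Definition count_dist (J : nat) x : fd R nat :=
  rcons [seq (pois x c, c) | c <- iota 0 J.+1] (tail J.+1 x, J.+1).

Lemma E_count_dist J x F : E (count_dist J x) F =
  \sum_(c < J.+1) pois x c * F c + tail J.+1 x * F J.+1.
Proof.
rewrite /E /count_dist -cats1 big_cat big_seq1; congr (_ + _).
by rewrite big_map -[iota 0 J.+1]/(index_iota 0 J.+1) big_mkord.
Qed.

Lemma valid_count_dist J x : 0 <= x -> fd_valid (count_dist J x).
Proof.
move=> x0; split; last first.
  have := E_count_dist J x (fun=> 1); rewrite /E.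
  under eq_bigr do rewrite mulr1.
  by move->; under eq_bigr do rewrite mulr1; rewrite mulr1 addrC subrK.
rewrite /count_dist => z; rewrite -cats1 => zc; case: (In_cat zc) => [zi|[<-|[]]] /=.
  by have [c [<- _]] := In_map zi; apply: pois_ge0.
exact: tail_ge0.
Qed.

Lemma support_count_dist J x : on_support (count_dist J x) (fun N => N <= J.+1)%N.
Proof.
rewrite /count_dist => z; rewrite -cats1 => zc; case: (In_cat zc) => [zi|[<-|[]]] //=.
have [c [<- ci]] := In_map zi; move: (In_mem ci).
by rewrite mem_iota /= add0n => /leqW.
Qed.

(* One slot of rate [th] of a scan that still needs [t] hits and has rate [rho]
   left after this slot; a hit is reported with probability [al]. The outcome
   tells whether the slot is reported, and the number of hits still needed. *)
Section ScanStep.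
Variables (th rho : R) (t : nat) (al : R).

(** Conditioned on at least [t] points in the remaining rate [rho + th], the probability that this
    slot has [c] points, none of them accepted when each is accepted with probability [be]; [c = t]
    stands for [t] or more. With [be = 0] there is no restriction, so the differences in [scan_dist]
    are the weights of at least one accepted point. *)
Definition scan_weight (be : R) (c : nat) : R :=
  (if (c < t)%N then expR (- (th * be)) * pois (th * (1 - be)) c * tail (t - c) rho
   else expR (- (th * be)) * tail t (th * (1 - be))) / tail t (rho + th).

Definition scan_dist : fd R (bool * nat) :=
  [seq (scan_weight al c, (false, t - c)%N) | c <- iota 0 t.+1] ++
  [seq (scan_weight 0 c - scan_weight al c, (true, t - c)%N) | c <- iota 0 t.+1].

Lemma E_scan_dist F : E scan_dist F =
  \sum_(c < t.+1) (scan_weight al c * F (false, t - c)%N +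
    (scan_weight 0 c - scan_weight al c) * F (true, t - c)%N).
Proof.
rewrite /E /scan_dist big_cat !big_map [RHS]big_split.
by rewrite -[iota 0 t.+1]/(index_iota 0 t.+1) !big_mkord.
Qed.

(** In a process of rate [mu] whose safe points have rate [sg]: the probability that no point is
    unsafe, given at least [s] points in all. *)
Definition scan_value (s : nat) (mu sg : R) : R :=
  expR (- (mu - sg)) * tail s sg / tail s mu.

Hypotheses (th0 : 0 < th) (rho0 : 0 <= rho).

Lemma rate_gt0 : 0 < rho + th. Proof. by rewrite ltr_wpDl. Qed.

(** This is [tail_conv] for the unaccepted points of this slot and the safe points of the later
    ones; the conditioning factor [tail (t - c) rho] of the later slots cancels. *)
Lemma sum_scan_weight (be sg : R) : 0 <= be <= 1 -> 0 <= sg <= rho ->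
  \sum_(c < t.+1) scan_weight be c * scan_value (t - c) rho sg =
  scan_value t (rho + th) (sg + th * (1 - be)).
Proof.
move=> /andP[b0 b1] /andP[s0 sr]; rewrite big_ord_recr /= subnn.
rewrite {2}/scan_weight ltnn /scan_value !tail0 mulr1 invr1 mulr1.
rewrite [sg + _]addrC -[tail t (th * (1 - be) + sg)]tail_conv.
have -> : expR (- (rho + th - (th * (1 - be) + sg))) =
   expR (- (th * be)) * expR (- (rho - sg)).
  by rewrite -expRD; congr expR; ring.
rewrite [X in _ = X / _]mulrDr [RHS]mulrDl; congr (_ + _); last by ring.
rewrite mulr_sumr mulr_suml; apply: eq_bigr => c _.
rewrite /scan_weight ltn_ord.
(* For [rho = 0] that factor is 0 when [c < t] and cannot be cancelled, but then both sides
   vanish. *)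
have [r0|rn0] := eqVneq rho 0.
  have sg0 : sg = 0 by apply/eqP; rewrite eq_le s0 -r0 sr.
  rewrite r0 sg0; case: (t - c)%N (subn_gt0 c t) => [|k _]; last by rewrite tail_0; ring.
  by rewrite ltn_ord.
have tn : tail (t - c) rho != 0 by rewrite gt_eqF // tail_gt0 // lt_def rn0.
rewrite [in LHS]mulrA [X in X / tail (t - c) rho]mulrC.
set u := expR (- (rho - sg)); set v := expR (- (th * be)).
have an : tail t (rho + th) != 0 by rewrite gt_eqF // tail_gt0 // rate_gt0.
by field; rewrite tn an.
Qed.

Lemma scan_weight_ge0 (be : R) c : 0 <= be <= 1 -> 0 <= scan_weight be c.
Proof.
move=> /andP[b0 b1]; rewrite /scan_weight.
apply: divr_ge0; last by rewrite tail_ge0 // ltW // rate_gt0.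
have x0 : 0 <= th * (1 - be) by rewrite mulr_ge0 ?subr_ge0 // ltW.
case: ifP => _; last first.
  by apply: mulr_ge0; [exact: expR_ge0 | exact: tail_ge0].
apply: mulr_ge0; last exact: tail_ge0.
by apply: mulr_ge0; [exact: expR_ge0 | exact: pois_ge0].
Qed.

(** Forbidding accepted points only lowers the probability. For [c < t] both weights carry
    [expR (- th)] and it remains to compare [th * (1 - be)] with [th]; for the lumped [c = t] it is
    monotonicity of [tail t] in the rate, read off from [tail_conv]. *)
Lemma scan_weight_le (be : R) c : 0 <= be <= 1 -> scan_weight be c <= scan_weight 0 c.
Proof.
move=> /andP[b0 b1]; rewrite /scan_weight ler_wpM2r //.
  by rewrite invr_ge0 tail_ge0 // ltW // rate_gt0.
rewrite mulr0 subr0 mulr1 oppr0 expR0 !mul1r.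
have x0 : 0 <= th * (1 - be) by rewrite mulr_ge0 ?subr_ge0 // ltW.
have y0 : 0 <= th * be by rewrite mulr_ge0 // ltW.
case: ifP => _.
  rewrite ler_wpM2r ?tail_ge0 // /pois mulrA -expRD.
  rewrite (_ : - (th * be) + - (th * (1 - be)) = - th); last by ring.
  rewrite ler_wpM2l ?expR_ge0 // ler_wpM2r ?invr_ge0 // lerXn2r ?nnegrE ?(ltW th0) //.
  by rewrite ger_pMr // lerBlDr lerDl.
have := tail_conv t (th * (1 - be)) (th * be).
rewrite (_ : th * (1 - be) + th * be = th); last by ring.
move=> <-; apply: (@le_trans _ _ (tail t (th * (1 - be)))).
  rewrite -[leRHS]mul1r ler_wpM2r ?tail_ge0 // -expR0 ler_expR oppr_le0 //.
rewrite lerDr sumr_ge0 // => c' _.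
by rewrite mulr_ge0 ?pois_ge0 ?tail_ge0.
Qed.

Lemma E_scan_value (safe : bool) (sg : R) : 0 <= al <= 1 -> 0 <= sg <= rho ->
  E scan_dist (fun z => (z.1 ==> safe)%:R * scan_value z.2 rho sg) =
  scan_value t (rho + th) (sg + th * (1 - al * (1 - safe%:R))).
Proof.
move=> al01 sg01; rewrite E_scan_dist.
rewrite -sum_scan_weight //; last by case: safe; rewrite ?subrr ?subr0 ?mulr0 ?mulr1 ?lexx ?ler01.
apply: eq_bigr => c _ /=.
by case: safe => /=; rewrite ?subrr ?subr0 ?mulr0 ?mulr1; ring.
Qed.

(** With no rate left, every outcome that still needs a hit has weight 0, so the factor for the
    later slots is 1. *)
Lemma E_scan_last (safe : bool) : 0 <= al <= 1 -> rho = 0 ->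
  E scan_dist (fun z => (z.1 ==> safe)%:R) =
  scan_value t th (th * (1 - al * (1 - safe%:R))).
Proof.
move=> al01 r0; rewrite -[th in scan_value t th]add0r -{1}r0.
rewrite -[X in scan_value t _ X]add0r -E_scan_value ?r0 ?lexx //.
rewrite !E_scan_dist; apply: eq_bigr => c _ /=.
have K : (t - c)%N = 0%N \/ (forall be, scan_weight be c = 0).
  have [ct|tc] := ltnP c t; last by left; apply/eqP; rewrite subn_eq0.
  right=> be; rewrite /scan_weight ct r0; move: ct; rewrite -subn_gt0.
  by case: (t - c)%N => // k _; rewrite tail_0 mulr0 mul0r.
case: K => [->|K]; last by rewrite !K subrr !mul0r.
have -> : scan_value 0 0 0 = 1.
  by rewrite /scan_value !tail0 subrr oppr0 expR0 mulr1 divr1.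
by rewrite !mulr1.
Qed.

Lemma valid_scan_dist : 0 <= al <= 1 -> fd_valid scan_dist.
Proof.
move=> al01; split.
  rewrite /scan_dist => z zc; case: (In_cat zc) => zi.
    by have [c [<- _]] := In_map zi; apply: scan_weight_ge0.
  by have [c [<- _]] := In_map zi; rewrite /= subr_ge0; apply: scan_weight_le.
have := E_scan_dist (fun=> 1); rewrite /E.
under eq_bigr do rewrite mulr1.
move->.
under eq_bigr do rewrite !mulr1 addrC subrK.
rewrite big_ord_recr /= {2}/scan_weight ltnn mulr0 subr0 oppr0 expR0 mulr1 mul1r.
have an : tail t (rho + th) != 0 by rewrite gt_eqF // tail_gt0 // rate_gt0.
under eq_bigr => c _ do
  rewrite /scan_weight ltn_ord mulr0 subr0 oppr0 expR0 mulr1 mul1r.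
by rewrite -mulr_suml -mulrDl tail_conv [th + rho]addrC divff.
Qed.

Lemma support_scan_dist : on_support scan_dist (fun z => z.2 <= t)%N.
Proof.
rewrite /scan_dist => z zc; case: (In_cat zc) => zi;
 by have [c [<- _]] := In_map zi; rewrite /= leq_subr.
Qed.

End ScanStep.
End Poisson.

(** * The law of a stream merged from child streams *)

(* [merge_law] computes the expectation of [\prod_i g_i (s_i)], where the
   stream [s] first follows [cs], a label [d] standing for the next element of
   the [d]-th child stream, and then repeats uniformly random labels; [acc d]
   collects the functions applied to the successive elements of child [d]. *)

Section MergeLaw.
Variables (R : realType) (T : Type) (lab : T -> option nat) (f fa : nat).

Definition push (A : Type) (acc : nat -> seq A) d g :=
  fun e => if e == d then rcons (acc e) g else acc e.

Section Def.
Variable Ds : nat -> seq (T -> R) -> R.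

Fixpoint merge_law (gs : seq (T -> R)) (cs : seq T)
    (acc : nat -> seq (T -> R)) : R :=
  match gs, cs with
  | [::], _ => \prod_(d < f) Ds d (acc d)
  | g :: gs', [::] =>
      fa%:R^-1 * \sum_(d < fa) merge_law gs' [::] (push acc d g)
  | g :: gs', w :: cs' =>
      if lab w is Some d then merge_law gs' cs' (push acc d g)
      else g w * merge_law gs' cs' acc
  end.

End Def.

Lemma eq_merge_law Ds Ds' gs cs acc acc' :
  (forall d gs, (d < f)%N -> Ds d gs = Ds' d gs) -> acc =1 acc' ->
  merge_law Ds gs cs acc = merge_law Ds' gs cs acc'.
Proof.
move=> H; elim: gs cs acc acc' => [|g gs IH] cs acc acc' Ha /=.
  by apply: eq_bigr => d _; rewrite Ha H.
have Hp d : push acc d g =1 push acc' d g by move=> e; rewrite /push Ha.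
case: cs => [|w cs]; first by congr (_ * _); apply: eq_bigr => d _; apply: IH.
by case: lab => [d|]; [apply: IH | rewrite (IH _ _ _ Ha)].
Qed.

(* Only the law of one child varies, and the expression is affine in it. *)
Lemma E_merge_law Om (om : fd R Om) d0 (DD : Om -> nat -> seq (T -> R) -> R)
    Ds gs cs acc :
  (d0 < f)%N ->
  (forall w d gs, (d < f)%N -> d != d0 -> DD w d gs = Ds d gs) ->
  (forall gs, E om (fun w => DD w d0 gs) = Ds d0 gs) ->
  E om (fun w => merge_law (DD w) gs cs acc) = merge_law Ds gs cs acc.
Proof.
move=> d0f Hd H0; elim: gs cs acc => [|g gs IH] cs acc /=.
  rewrite [RHS](bigD1 (Ordinal d0f)) //= -H0 -E_scaler; apply: eq_E => w.
  rewrite (bigD1 (Ordinal d0f)) //=; congr (_ * _).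
  by apply: eq_bigr => d dn; apply: Hd.
case: cs => [|w cs].
  by rewrite E_scalel E_sum; congr (_ * _); apply: eq_bigr => d _; apply: IH.
case: lab => [d|]; first exact: IH.
by rewrite E_scalel IH.
Qed.

(** Labels drawn ahead of time are as random as labels drawn when their position is reached, which
    is what [merge_law] does past the end of [cs]. *)
Lemma merge_law_labels Ds (mk : nat -> T) k gs acc :
  (0 < fa)%N -> (forall d, (d < fa)%N -> lab (mk d) = Some d) ->
  E (iid k (unif R fa)) (fun ds => merge_law Ds gs (map mk ds) acc) =
  merge_law Ds gs [::] acc.
Proof.
move=> fa0 Hm; elim: k gs acc => [|k IH] gs acc /=; first by rewrite E_ret.
case: gs => [|g gs].
  by rewrite E_cst //; apply: valid_bind => [|x]; [exact: valid_unif |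
     apply: valid_fmap; apply: valid_iid; exact: valid_unif].
rewrite E_bind E_unif //=; congr (_ * _); apply: eq_bigr => d _.
by rewrite E_fmap -IH; apply: eq_E => ds /=; rewrite Hm.
Qed.

Lemma merge_law_scale Ds gs cs acc acc' d a :
  (d < f)%N -> (forall e, e != d -> acc' e = acc e) ->
  (forall l, Ds d (acc' d ++ l) = a * Ds d (acc d ++ l)) ->
  merge_law Ds gs cs acc' = a * merge_law Ds gs cs acc.
Proof.
move=> df; elim: gs cs acc acc' => [|g gs IH] cs acc acc' Ha Hd /=.
  rewrite (bigD1 (Ordinal df)) //= [in RHS](bigD1 (Ordinal df)) //= mulrA.
  have := Hd [::]; rewrite !cats0 => ->; congr (_ * _).
  by apply: eq_bigr => e ed; rewrite Ha.
have P d' : merge_law Ds gs [::] (push acc' d' g) =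
    a * merge_law Ds gs [::] (push acc d' g) /\
    forall cs, merge_law Ds gs cs (push acc' d' g) =
    a * merge_law Ds gs cs (push acc d' g).
  suff H cs' : merge_law Ds gs cs' (push acc' d' g) =
    a * merge_law Ds gs cs' (push acc d' g) by [].
  apply: IH => [e ed|l]; first by rewrite /push Ha.
  by rewrite /push; case: ifP => _; rewrite ?cat_rcons Hd.
case: cs => [|w cs].
  by rewrite mulrCA; congr (_ * _); rewrite mulr_sumr; apply: eq_bigr => e _;
     case: (P e).
by case: lab => [e|]; [case: (P e) | rewrite (IH _ _ _ Ha Hd) mulrCA].
Qed.

Fixpoint fillm (A : Type) (mask : seq bool) (ys xs : seq A) : seq A :=
  match mask, xs with
  | b :: mask', x :: xs' =>
      if b then
        if ys is y :: ys' then y :: fillm mask' ys' xs' else x :: xs'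
      else x :: fillm mask' ys xs'
  | _, _ => xs
  end.

Definition lmask d (cs : seq T) := [seq lab w == Some d | w <- cs].

(* A child whose elements are independent with common mean [avg]. *)
Lemma merge_law_pick Ds d (avg : (T -> R) -> R) Om (om : fd R Om)
    (pk : Om -> T) k gs cs acc :
  (d < f)%N -> fd_valid om -> (forall w, lab (pk w) = None) ->
  (forall g, E om (g \o pk) = avg g) ->
  (forall l, Ds d l = \prod_(g <- l) avg g) ->
  (count id (lmask d cs) <= k)%N ->
  E (iid k om) (fun ys => merge_law Ds gs
       (fillm (lmask d cs) (map pk ys) cs) acc) = merge_law Ds gs cs acc.
Proof.
move=> df vom pkl pka Dm; elim: gs k cs acc => [|g gs IH] k cs acc ck.
  by rewrite E_cst //; apply: valid_iid.
case: cs ck => [|w cs] ck.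
  by rewrite (@eq_E _ _ _ _ (fun=> merge_law Ds (g :: gs) [::] acc)) ?E_cst //;
     apply: valid_iid.
rewrite /= in ck *.
case: (lab w =P Some d) ck => [lw|nw] ck /=; last first.
  rewrite /= in ck.
  case lw : (lab w) => [e|]; first by rewrite IH.
  by rewrite E_scalel IH.
case: k ck => // k ck; rewrite lw /= E_bind.
rewrite (@merge_law_scale Ds gs cs acc (push acc d g) d (avg g)) //.
- rewrite -pka -E_scaler; apply: eq_E => x.
  rewrite E_fmap -(IH k cs acc); last by rewrite -ltnS.
  by rewrite -E_scalel; apply: eq_E => ys /=; rewrite pkl.
- by move=> e /negPf ed; rewrite /push ed.
by move=> l; rewrite /push eqxx cat_rcons !Dm !big_cat big_cons /= mulrCA.
Qed.

(** Materialises one element: the first label [d] becomes the next sample [y] of child [d], whose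
    law passes from [Ds d] to [Ds' d]. Nothing has been taken from that child before this label,
    whence [acc d = [::]]. *)
Lemma merge_law_take1 Ds Ds' d y gs cs acc :
  (d < f)%N -> lab y = None ->
  (forall e l, (e < f)%N -> e != d -> Ds e l = Ds' e l) ->
  Ds d [::] = Ds' d [::] ->
  (forall g l, Ds d (g :: l) = g y * Ds' d l) -> acc d = [::] ->
  (0 < count id (lmask d cs))%N ->
  merge_law Ds' gs (fillm (lmask d cs) [:: y] cs) acc =
  merge_law Ds gs cs acc.
Proof.
move=> df ly He H0 H1; elim: gs cs acc => [|g gs IH] cs acc a0 cc.
  by apply: eq_bigr => e _; have [->|ed] := eqVneq (e : nat) d;
     rewrite ?a0 ?H0 ?He.
case: cs cc => // w cs /=; case: (lab w =P Some d) => [lw|nw] /= cc; last first.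
  rewrite add0n in cc.
  case lw : (lab w) => [e|]; last by rewrite IH.
  apply: IH => //; rewrite /push; case: eqP => // de.
  by case: nw; rewrite lw de.
rewrite ly lw.
have -> : forall A (m : seq bool) (s : seq A), fillm m [::] s = s.
  by move=> A; elim=> [|[] m IHm] [|x s] //=; rewrite IHm.
(* From here on [g] heads the list of child [d] on one side, while the other side has already split
   off [g y]; all later functions are treated alike. *)
have G acc1 acc2 : (forall e, e != d -> acc1 e = acc2 e) ->
    acc1 d = g :: acc2 d ->
    merge_law Ds gs cs acc1 = g y * merge_law Ds' gs cs acc2.
  clear IH a0 cc.
  elim: gs cs acc1 acc2 => [|h gs IH] cs' acc1 acc2 Ha Hd /=.
    rewrite (bigD1 (Ordinal df)) //= [in RHS](bigD1 (Ordinal df)) //= mulrA.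
    rewrite Hd H1; congr (_ * _); apply: eq_bigr => e ed.
    by rewrite He // Ha.
  have P d' cs'' : merge_law Ds gs cs'' (push acc1 d' h) =
      g y * merge_law Ds' gs cs'' (push acc2 d' h).
    apply: IH => [e ed|]; first by rewrite /push Ha.
    by rewrite /push; case: ifP => _; rewrite Hd.
  case: cs' => [|w' cs'].
    by rewrite mulrCA; congr (_ * _); rewrite mulr_sumr; apply: eq_bigr.
  by case: lab => [e|]; [exact: P | rewrite (IH _ _ _ Ha Hd) mulrCA].
symmetry; apply: G => [e /negPf ed|]; rewrite /push ?ed // eqxx a0 //.
Qed.

Lemma merge_law_mean Ds (avg : nat -> (T -> R) -> R) gs acc :
  (fa <= f)%N ->
  (forall d l, (d < f)%N -> Ds d l = \prod_(g <- l) avg d g) ->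
  merge_law Ds gs [::] acc =
  \prod_(d < f) \prod_(g <- acc d) avg d g *
  \prod_(g <- gs) (fa%:R^-1 * \sum_(d < fa) avg d g).
Proof.
move=> faf Hd; elim: gs acc => [|g gs IH] acc /=.
  by rewrite big_nil mulr1; apply: eq_bigr => d _; rewrite Hd.
rewrite big_cons; set P := \prod_(d < f) _; set Q := \prod_(h <- gs) _.
transitivity (fa%:R^-1 * \sum_(d < fa) (P * Q * avg d g)); last first.
  by rewrite -mulr_sumr; ring.
congr (_ * _); apply: eq_bigr => d _; rewrite IH mulrAC; congr (_ * _).
have df : (d < f)%N := leq_trans (ltn_ord d) faf.
rewrite /P (bigD1 (Ordinal df)) //= [in RHS](bigD1 (Ordinal df)) //=.
rewrite {1}/push eqxx -cats1 big_cat big_seq1 /=.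
rewrite (eq_bigr (fun e : 'I_f => \prod_(h <- acc e) avg e h)); first by ring.
by move=> e /negPf ed; rewrite /push (_ : (e == d :> nat) = false).
Qed.

Lemma merge_law_fill Ds (avg : nat -> (T -> R) -> R) Om (om : fd R Om)
    (pk : Om -> T) k gs acc :
  (fa <= f)%N -> fd_valid om -> (forall w, lab (pk w) = None) ->
  (forall d l, (d < f)%N -> Ds d l = \prod_(g <- l) avg d g) ->
  (forall g, E om (g \o pk) = fa%:R^-1 * \sum_(d < fa) avg d g) ->
  E (iid k om) (fun ys => merge_law Ds gs (map pk ys) acc) =
  merge_law Ds gs [::] acc.
Proof.
move=> faf vom pkl Hd Hm; elim: k gs acc => [|k IH] gs acc; first by rewrite E_ret.
case: gs => [|g gs]; first by rewrite E_cst //; apply: valid_iid.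
rewrite /iid -/iid E_bind [RHS](merge_law_mean _ _ faf Hd) big_cons.
rewrite (@eq_E _ _ _ _ (fun x => g (pk x) * merge_law Ds gs [::] acc)); last first.
  by move=> x; rewrite E_fmap -IH -E_scalel; apply: eq_E => ys /=; rewrite pkl.
by rewrite E_scaler Hm (merge_law_mean _ _ faf Hd); ring.
Qed.

End MergeLaw.

(** * The law of the output of the tree *)

Definition upd2 (A : Type) (F : nat -> nat -> A) l i a :=
  fun l' i' => if (l' == l) && (i' == i) then a else F l' i'.

Lemma upd2_same A (F : nat -> nat -> A) l i a : upd2 F l i a l i = a.
Proof. by rewrite /upd2 !eqxx. Qed.

Lemma upd2_other A (F : nat -> nat -> A) l i a l' i' :
  ~~ ((l' == l) && (i' == i)) -> upd2 F l i a l' i' = F l' i'.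
Proof. by rewrite /upd2 => /negPf ->. Qed.

Section FillMask.
Variables (T : Type) (lab : T -> option nat).

Lemma fillm_nil A (m : seq bool) (s : seq A) : fillm m [::] s = s.
Proof. by elim: m s => [|[] m IHm] [|x s] //=; rewrite IHm. Qed.

Lemma map_fillm A A' (h : A -> A') m ys xs :
  map h (fillm m ys xs) = fillm m (map h ys) (map h xs).
Proof.
elim: m ys xs => [|b m IH] ys [|x xs] //=.
by case: b; [case: ys => [|y ys] //=|]; rewrite /= IH.
Qed.

Lemma size_fillm A m (ys xs : seq A) : size (fillm m ys xs) = size xs.
Proof.
elim: m ys xs => [|b m IH] ys [|x xs] //=.
by case: b; [case: ys => [|y ys] //=|]; rewrite /= IH.
Qed.

Lemma fillm_cons d y ys cs : lab y = None ->
  fillm (lmask lab d cs) (y :: ys) cs =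
  fillm (lmask lab d (fillm (lmask lab d cs) [:: y] cs)) ys
    (fillm (lmask lab d cs) [:: y] cs).
Proof.
move=> ly; elim: cs => //= w cs IH.
case lw: (lab w == Some d) => /=; last by rewrite lw IH.
by rewrite fillm_nil ly.
Qed.

Lemma count_fillm d e ys cs : (forall y, List.In y ys -> lab y = None) ->
  count id (lmask lab e (fillm (lmask lab d cs) ys cs)) =
  (count id (lmask lab e cs) -
    (if e == d then minn (size ys) (count id (lmask lab d cs)) else 0))%N.
Proof.
elim: cs ys => [|w cs IH] ys H /=; first by rewrite minn0 if_same.
case lw: (lab w == Some d) => /=; last first.
  rewrite IH // add0n; case: (e =P d) => [->|_]; last by rewrite !subn0.
  by rewrite lw.
case: ys H => [|y ys] H /=; first by rewrite min0n if_same subn0.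
rewrite IH; last by move=> z zy; apply: H; right.
rewrite H; last by left.
case: (e =P d) => [->|ne]; first by rewrite lw add0n add1n minnSS subSS.
rewrite !subn0 (eqP lw) (_ : (Some d == Some e) = false) //.
by apply/eqP => -[] /esym.
Qed.

End FillMask.

Section Tree.
Variables (R : realType) (T : Type) (f f0 L b : nat).
Variables (lab : nat -> T -> option nat) (Tw : nat -> T).
Hypotheses (f_gt0 : (0 < f)%N) (f0_gt0 : (0 < f0)%N) (f0_le : (f0 <= f)%N)
  (b_gt0 : (0 < b)%N).

Definition fan (l : nat) : nat := if l == L then f0 else f.

Lemma fan_gt0 l : (0 < fan l)%N. Proof. by rewrite /fan; case: eqP. Qed.
Lemma fan_le l : (fan l <= f)%N. Proof. by rewrite /fan; case: eqP. Qed.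

Definition block_mean (i : nat) (g : T -> R) : R :=
  b%:R^-1 * \sum_(t < b) g (Tw (i * b + t)).

Fixpoint tree_law (cells : nat -> nat -> seq T) (l i : nat)
    (gs : seq (T -> R)) : R :=
  match l with
  | 0%N => \prod_(g <- gs) block_mean i g
  | l'.+1 => merge_law (lab (fan l)) f (fan l)
      (fun d => tree_law cells l' (i * f + d)) gs (cells l i) (fun=> [::])
  end.

Lemma tree_law_nil cells l i : tree_law cells l i [::] = 1.
Proof.
by elim: l i => [|l IH] i /=; [rewrite big_nil | rewrite big1].
Qed.

Lemma eq_tree_law cells cells' l i gs :
  (forall l i, cells l i = cells' l i) ->
  tree_law cells l i gs = tree_law cells' l i gs.
Proof.
move=> H; elim: l i gs => [|l IH] i gs //=.
by rewrite H; apply: eq_merge_law.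
Qed.

Definition below lv iv l i := (l <= lv)%N && (i %/ f ^ (lv - l) == iv)%N.

Definition related lv iv l i :=
  if (l <= lv)%N then (i %/ f ^ (lv - l) == iv)%N
  else (iv %/ f ^ (l - lv) == i)%N.

Lemma tree_law_out cells cells' lv iv l i gs :
  (forall l i, ~~ below lv iv l i -> cells l i = cells' l i) ->
  ~~ related lv iv l i -> tree_law cells l i gs = tree_law cells' l i gs.
Proof.
move=> H; elim: l i gs => [|l IH] i gs //= nr.
rewrite -H; last by move: nr; rewrite /related /below; case: leqP.
apply: eq_merge_law => // d gs' df; apply: IH; move: nr; rewrite /related.
have cf : ((i * f + d) %/ f = i)%N by rewrite divnMDl // divn_small ?addn0.
case: (ltngtP l lv) => [llv|lvl|lE].
- by rewrite -(subnSK llv) expnS divnMA cf.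
- rewrite subSn ?(ltnW lvl) // expnSr divnMA; apply: contra => /eqP->.
  by rewrite cf.
rewrite lE subnn expn0 divn1 subSnn expn1; apply: contra => /eqP<-.
by rewrite cf.
Qed.

(** A random change inside the subtree of [(lv, iv)] that keeps the expected law of that node keeps
    it at each ancestor: only one child of the ancestor is affected, and [merge_law] is affine in
    the law of one child. All operations on buffers are thereby reduced to local statements. *)
Lemma E_tree_law Om (om : fd R Om) (cw : Om -> nat -> nat -> seq T) cells lv iv :
  (forall w l i, ~~ below lv iv l i -> cw w l i = cells l i) ->
  (forall gs, E om (fun w => tree_law (cw w) lv iv gs) = tree_law cells lv iv gs) ->
  forall k gs, E om (fun w => tree_law (cw w) (k + lv) (iv %/ f ^ k) gs) =
    tree_law cells (k + lv) (iv %/ f ^ k) gs.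
Proof.
move=> H H0; elim=> [|k IH] gs; first by rewrite expn0 divn1.
rewrite addSn /=.
set d0 := ((iv %/ f ^ k) %% f)%N.
have Ed0 : ((iv %/ f ^ k.+1) * f + d0 = iv %/ f ^ k)%N.
  by rewrite expnSr divnMA /d0 -divn_eq.
have d0f : (d0 < f)%N by rewrite ltn_mod.
under eq_E => w.
  rewrite H; last by rewrite /below leqNgt ltnS leq_addl.
  over.
apply: (@E_merge_law _ _ _ _ _ _ _ d0) => //.
  move=> w d gs' df ne; apply: (@tree_law_out _ _ lv iv).
    by move=> l i; apply: H.
  rewrite /related; case: leqP => [kl|_].
    have k0 : k = 0%N by lia.
    subst k; rewrite add0n subnn expn0 divn1; apply: contra ne => /eqP E.
    by rewrite -(eqn_add2l (iv %/ f ^ 1 * f)) E Ed0 expn0 divn1.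
  rewrite addnK; apply: contra ne => /eqP E.
  by rewrite -(eqn_add2l (iv %/ f ^ k.+1 * f)) -E Ed0.
by move=> gs'; rewrite Ed0.
Qed.

Lemma E_root_law Om (om : fd R Om) (cw : Om -> nat -> nat -> seq T) cells lv iv :
  (forall w l i, ~~ below lv iv l i -> cw w l i = cells l i) ->
  (forall gs, E om (fun w => tree_law (cw w) lv iv gs) = tree_law cells lv iv gs) ->
  (lv <= L)%N -> (iv < f ^ (L - lv))%N ->
  forall gs, E om (fun w => tree_law (cw w) L 0 gs) = tree_law cells L 0 gs.
Proof.
move=> H H0 lL iL gs; have := E_tree_law H H0 (L - lv) gs.
by rewrite subnK // divn_small.
Qed.

Lemma tree_law_upd cells l i s l' i' gs : (l' < l)%N ->
  tree_law (upd2 cells l i s) l' i' gs = tree_law cells l' i' gs.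
Proof.
elim: l' i' gs => [|l' IH] i' gs l'l //=.
rewrite upd2_other ?(ltn_eqF l'l) //.
by apply: eq_merge_law => // d gs' _; apply: IH; apply: ltnW.
Qed.

Lemma tree_law_labels (mk : nat -> T) cells l i k gs :
  (0 < l)%N -> (l <= L)%N -> (i < f ^ (L - l))%N ->
  (forall d, (d < fan l)%N -> lab (fan l) (mk d) = Some d) ->
  E (iid k (unif R (fan l)))
    (fun ds => tree_law (upd2 cells l i (map mk ds)) L 0 gs) =
  tree_law (upd2 cells l i [::]) L 0 gs.
Proof.
move=> l0 lL iL Hmk.
apply: (@E_root_law _ _ _ _ l i) => // [w l' i' nb|gs'].
  rewrite !upd2_other //; apply: contra nb => /andP[/eqP-> /eqP->];
  by rewrite /below leqnn subnn expn0 divn1 eqxx.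
case: l l0 lL iL Hmk => // l _ lL iL Hmk /=; rewrite upd2_same.
rewrite -(@merge_law_labels _ _ _ _ _ _ mk k) ?fan_gt0 //.
apply: eq_E => ds; rewrite upd2_same; apply: eq_merge_law => // d gs2 _.
by rewrite !tree_law_upd.
Qed.

Lemma tree_law_pick cells i d k gs :
  (0 < L)%N -> (i < f ^ (L - 1))%N -> (d < f)%N ->
  (forall s, lab (fan 1) (Tw s) = None) ->
  (count id (lmask (lab (fan 1)) d (cells 1%N i)) <= k)%N ->
  E (iid k (unif R b)) (fun ts => tree_law (upd2 cells 1 i
     (fillm (lmask (lab (fan 1)) d (cells 1%N i))
        [seq Tw ((i * f + d) * b + t) | t <- ts] (cells 1%N i))) L 0 gs) =
  tree_law cells L 0 gs.
Proof.
move=> L0 iL df TwN ck.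
apply: (@E_root_law _ _ _ _ 1%N i) => // [w l' i' nb|gs'].
  rewrite !upd2_other //; apply: contra nb => /andP[/eqP-> /eqP->];
  by rewrite /below leqnn subnn expn0 divn1 eqxx.
rewrite -[RHS](@merge_law_pick _ _ _ _ _ _ d (block_mean (i * f + d)) _ (unif R b)
  (fun t => Tw ((i * f + d) * b + t)) k) //.
- by apply: eq_E => ts /=; rewrite upd2_same.
- exact: valid_unif.
by move=> g; rewrite E_unif.
Qed.

Lemma merge_law_take lb fa (Ds : nat -> seq (T -> R) -> R)
    (Dd : seq T -> seq (T -> R) -> R) d rest gs ys cs :
  (d < f)%N -> (forall c, Dd c [::] = 1) ->
  (forall y c g l, List.In y ys -> Dd (y :: c) (g :: l) = g y * Dd c l) ->
  (forall y, List.In y ys -> lb y = None) ->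
  (size ys <= count id (lmask lb d cs))%N ->
  merge_law lb f fa (fun e => if e == d then Dd rest else Ds e) gs
    (fillm (lmask lb d cs) ys cs) (fun=> [::]) =
  merge_law lb f fa (fun e => if e == d then Dd (ys ++ rest) else Ds e) gs
    cs (fun=> [::]).
Proof.
move=> df D1; elim: ys cs => [|y ys IH] cs HD Hl sz; first by rewrite fillm_nil.
have ly : lb y = None by apply: Hl; left.
rewrite fillm_cons // IH.
- apply: merge_law_take1 => //=.
  + by move=> e l _ /negPf->.
  + by rewrite eqxx !D1.
  + by move=> g l; rewrite eqxx HD //; left.
  + exact: leq_ltn_trans sz.
- by move=> z c g l zy; apply: HD; right.
- by move=> z zy; apply: Hl; right.
rewrite count_fillm; last by move=> z [<-|[]].
rewrite eqxx (minn_idPl _) /=; last exact: leq_ltn_trans sz.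
by rewrite leq_subRL ?add1n // (leq_ltn_trans _ sz).
Qed.

Lemma tree_law_take cells l i d ys rest gs :
  (0 < l)%N -> (l < L)%N -> (i < f ^ (L - l.+1))%N -> (d < f)%N ->
  cells l (i * f + d)%N = ys ++ rest ->
  (forall y, List.In y ys -> lab (fan l.+1) y = None /\ lab (fan l) y = None) ->
  (size ys <= count id (lmask (lab (fan l.+1)) d (cells l.+1 i)))%N ->
  tree_law (upd2 (upd2 cells l.+1 i
     (fillm (lmask (lab (fan l.+1)) d (cells l.+1 i)) ys (cells l.+1 i)))
     l (i * f + d) rest) L 0 gs = tree_law cells L 0 gs.
Proof.
move=> l0 lL iL df Hc Hy sz.
set c' := upd2 _ _ _ rest.
(* A deterministic change is a random one with a single outcome, so [E_root_law] applies. *)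
transitivity (E (ret R tt) (fun=> tree_law c' L 0 gs)); first by rewrite E_ret.
apply: (@E_root_law unit (ret R tt) (fun=> c') cells l.+1 i) => // [_ l' i' nb|gs'].
  rewrite /c' !upd2_other //; apply: contra nb => /andP[/eqP-> /eqP->].
    by rewrite /below leqnn subnn expn0 divn1 eqxx.
  by rewrite /below leqnSn subSnn expn1 divnMDl // divn_small ?addn0 ?eqxx.
rewrite E_ret /= (_ : c' l.+1 i = fillm (lmask (lab (fan l.+1)) d (cells l.+1 i))
  ys (cells l.+1 i)); last by rewrite /c' upd2_other ?upd2_same // eqn_leq ltnn.
case: l l0 lL iL Hc Hy sz @c' => // l _ lL iL Hc Hy sz c' /=.
pose Dd s gs := merge_law (lab (fan l.+1)) f (fan l.+1)
  (fun e => tree_law cells l ((i * f + d) * f + e)) gs s (fun=> [::]).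
have C s e gs2 : (e < f)%N ->
    tree_law (upd2 (upd2 cells l.+2 i s) l.+1 (i * f + d) rest) l.+1 (i * f + e) gs2 =
    (if e == d then Dd rest gs2 else tree_law cells l.+1 (i * f + e) gs2).
  move=> ef; case: eqP => [->|ne].
    rewrite /= upd2_same; apply: eq_merge_law => // e' gs3 _.
    by rewrite !tree_law_upd.
  rewrite /= !upd2_other.
  - by apply: eq_merge_law => // e' gs3 _; rewrite !tree_law_upd.
  - by rewrite ltn_eqF.
  by rewrite eqxx eqn_add2l; apply/eqP.
rewrite (@eq_merge_law _ _ _ _ _ _ (fun e => if e == d then Dd rest else
   tree_law cells l.+1 (i * f + e)) _ _ _ (fun=> [::])) //; last first.
  by move=> e gs2 ef; rewrite -[LHS]/(tree_law c' l.+1 _ gs2) C //; case: ifP.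
rewrite merge_law_take //.
- apply: eq_merge_law => // e gs2 ef; case: eqP => // ->.
  by rewrite /= Hc.
- by move=> c; rewrite /Dd /= big1 // => e _; rewrite tree_law_nil.
- by move=> y c g l2 /Hy[_ ly]; rewrite /Dd /= ly.
by move=> y /Hy[].
Qed.

Fixpoint node_mean (l i : nat) (g : T -> R) : R :=
  if l is l'.+1 then (fan l)%:R^-1 * \sum_(d < fan l) node_mean l' (i * f + d) g
  else block_mean i g.

Fixpoint leaf_dist (l i : nat) : fd R nat :=
  if l is l'.+1 then bind (unif R (fan l)) (fun d => leaf_dist l' (i * f + d))
  else fmap (fun t => i * b + t)%N (unif R b).

Lemma valid_leaf_dist l i : fd_valid (leaf_dist l i).
Proof.
elim: l i => [|l IH] i; first by apply: valid_fmap; exact: valid_unif.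
by apply: valid_bind => [|d]; [exact: valid_unif | exact: IH].
Qed.

Lemma E_leaf_dist l i g : E (leaf_dist l i) (g \o Tw) = node_mean l i g.
Proof.
elim: l i => [|l IH] i; first by rewrite E_fmap E_unif.
by rewrite [leaf_dist _ _]/= E_bind E_unif ?fan_gt0 //; congr (_ * _); apply: eq_bigr.
Qed.

Lemma tree_law_empty cells l i gs :
  (forall l' i', (l' <= l)%N -> cells l' i' = [::]) ->
  tree_law cells l i gs = \prod_(g <- gs) node_mean l i g.
Proof.
elim: l i gs => [|l IH] i gs H //=; rewrite H //.
rewrite (@merge_law_mean _ _ _ _ _ _ (fun d g => node_mean l (i * f + d) g)) ?fan_le //.
  by rewrite big1 ?mul1r // => d _; rewrite big_nil.
by move=> d gs' _; apply: IH => l' i' l'l; apply: H; apply: leqW.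
Qed.

Fixpoint fills (ns : seq (nat * nat)) (ct : nat -> nat -> seq T) :
    fd R (nat -> nat -> seq T) :=
  if ns is n :: ns' then
    bind (iid (fan n.1 * b) (leaf_dist n.1 n.2))
      (fun ys => fills ns' (upd2 ct n.1 n.2 (map Tw ys)))
  else ret R ct.

Lemma valid_fills ns ct : fd_valid (fills ns ct).
Proof.
elim: ns ct => [|n ns IH] ct; first exact: valid_ret.
apply: valid_bind => [|ys]; last exact: IH.
by apply: valid_iid; exact: valid_leaf_dist.
Qed.

(* Filling top down, every subtree below the filled node is still empty. *)
Lemma E_fills ns ct gs :
  uniq ns -> sorted (fun n n' => n'.1 <= n.1)%N ns ->
  (forall n, n \in ns -> [/\ (0 < n.1)%N, (n.1 <= L)%N & (n.2 < f ^ (L - n.1))%N]) ->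
  (forall n l' i', n \in ns -> (l' < n.1)%N -> ct l' i' = [::]) ->
  (forall n, n \in ns -> ct n.1 n.2 = [::]) ->
  (forall l s, lab (fan l) (Tw s) = None) ->
  E (fills ns ct) (fun ct' => tree_law ct' L 0 gs) = tree_law ct L 0 gs.
Proof.
move=> + + + + + TwN; elim: ns ct => [|[l i] ns IH] ct /=.
  by rewrite E_ret.
move=> /andP[nns un] srt Hv Hlow Hemp; rewrite E_bind.
have tr : transitive (fun n n' : nat * nat => (n'.1 <= n.1)%N).
  by move=> ? ? ? h1 h2; apply: leq_trans h2 h1.
have all_le := order_path_min tr srt.
rewrite (@eq_E _ _ _ _ (fun ys => tree_law (upd2 ct l i (map Tw ys)) L 0 gs)); last first.
  move=> ys; apply: IH => //; first exact: path_sorted srt.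
  - by move=> n nn; apply: Hv; rewrite inE nn orbT.
  - move=> n l' i' nn l'n; rewrite upd2_other.
      by apply: (Hlow n); rewrite // inE nn orbT.
    have /= nl := allP all_le _ nn.
    by rewrite (ltn_eqF (leq_trans l'n nl)).
  move=> n nn; rewrite upd2_other; first by apply: Hemp; rewrite inE nn orbT.
  by apply: contra nns => /andP[/eqP<- /eqP<-]; rewrite -surjective_pairing.
have [/= l0 lL iL] := Hv (l, i) (mem_head _ _).
have Hl l' i' : (l' < l)%N -> ct l' i' = [::].
  by move=> l'l; apply: (Hlow (l, i)) => //; rewrite mem_head.
have Hn : ct l i = [::] by apply: (Hemp (l, i)); rewrite mem_head.
apply: (@E_root_law _ _ _ _ l i) => // [w l' i' nb|gs'].
  rewrite !upd2_other //; apply: contra nb => /andP[/eqP-> /eqP->];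
  by rewrite /below leqnn subnn expn0 divn1 eqxx.
case: l l0 lL iL Hl Hn {Hv Hlow Hemp nns all_le srt} => // l _ lL iL Hl Hn /=.
rewrite Hn -(@merge_law_fill _ _ _ _ _ _ (fun d => node_mean l (i * f + d)) _
  (leaf_dist l.+1 i) Tw (fan l.+1 * b)) ?fan_le //.
- apply: eq_E => ys; rewrite upd2_same; apply: eq_merge_law => // d gs2 _.
  by rewrite tree_law_upd.
- exact: valid_leaf_dist.
- by move=> d gs2 _; apply: tree_law_empty => l' i' l'l; apply: Hl.
by move=> g; rewrite E_leaf_dist.
Qed.

Lemma sum_ord_mul (F : nat -> R) m k :
  \sum_(s < m * k) F s = \sum_(d < m) \sum_(t < k) F (d * k + t)%N.
Proof.
elim: m => [|m IH]; first by rewrite mul0n !big_ord0.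
rewrite big_ord_recr /= -IH mulSn addnC big_split_ord /=.
by congr (_ + _); apply: eq_bigr => t _; rewrite /= addnC.
Qed.

(** Child [d] of node [i] has number [i * f + d], so the slots below a node form an interval of the
    table and uniform choices on the way down give a uniform slot in it. *)
Lemma node_meanE l i g : (l < L)%N ->
  node_mean l i g = (f ^ l * b)%:R^-1 *
    \sum_(s < f ^ l * b) g (Tw (i * (f ^ l * b) + s)).
Proof.
elim: l i => [|l IH] i lL /=; first by rewrite expn0 mul1n.
have -> : fan l.+1 = f by rewrite /fan ltn_eqF.
under eq_bigr => d _ do rewrite IH ?(ltnW lL) //.
rewrite -mulr_sumr mulrA -invfM -natrM mulnA -expnS; congr (_ * _).
rewrite expnS -mulnA (sum_ord_mul (fun s => g (Tw (i * (f * (f ^ l * b)) + s)))).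
apply: eq_bigr => d _; apply: eq_bigr => t _; congr (g (Tw _)).
by rewrite mulnDl addnA -mulnA.
Qed.

Lemma root_meanE g : (0 < L)%N ->
  node_mean L 0 g = (f0 * (f ^ L.-1 * b))%:R^-1 *
    \sum_(s < f0 * (f ^ L.-1 * b)) g (Tw s).
Proof.
move=> L0; rewrite -{1}(prednK L0) /= /fan prednK // eqxx.
under eq_bigr => d _ do rewrite node_meanE ?prednK //.
rewrite -mulr_sumr mulrA -invfM -natrM; congr (_ * _).
rewrite (sum_ord_mul (fun s => g (Tw s))).
by apply: eq_bigr => d _; apply: eq_bigr => t _.
Qed.

End Tree.

(** * The program *)

Fixpoint enc (Q : nat) (s : seq nat) : nat :=
  if s is x :: s' then (x + Q * enc Q s')%N else 0%N.

Definition dec (Q k v : nat) : nat := ((v %/ Q ^ k) %% Q)%N.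

Lemma dec_enc Q s k : all (fun x => x < Q)%N s -> (k < size s)%N ->
  dec Q k (enc Q s) = nth 0%N s k.
Proof.
elim: s k => [|x s IH] // k /= /andP[xQ sQ] ks.
have Q0 : (0 < Q)%N by apply: leq_trans xQ.
case: k ks => [|k] ks; rewrite /dec.
  by rewrite expn0 divn1 addnC mulnC modnMDl modn_small.
by rewrite expnS divnMA addnC mulnC divnMDl // (divn_small xQ) addn0 [RHS]/= -IH.
Qed.

Lemma enc_lt Q s : all (fun x => x < Q)%N s -> (enc Q s < Q ^ size s)%N.
Proof.
elim: s => [|x s IH] //= /andP[xQ /IH]; rewrite expnS => h.
by apply: leq_trans (_ : Q * (enc Q s).+1 <= _)%N; [rewrite mulnS ltn_add2r | rewrite leq_mul2l h orbT].
Qed.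

(* [Direct]: a table slot has just been read; [HScan]: heavy records;
   [FScan]: table slots; the other states refill the node [(l, i)] of the tree
   for a query that still needs [N] samples. *)
Inductive st :=
  | Idle of nat
  | Direct of nat & nat
  | HScan of nat & nat
  | FScan of nat & nat & nat
  | Label of nat & nat & nat
  | Gather of nat & nat & nat
  | Take of nat & nat & nat & nat
  | SaveD of nat & nat & nat & nat & nat
  | SaveU of nat & nat & nat & nat
  | RestD of nat & nat & nat & nat
  | RestU of nat & nat & nat & nat.

Definition st_seq (s : st) : seq nat :=
  match s with
  | Idle x => [:: 0; x; 0; 0; 0; 0]
  | Direct s N => [:: 1; s; N; 0; 0; 0]
  | HScan j x => [:: 2; j; x; 0; 0; 0]
  | FScan s t x => [:: 3; s; t; x; 0; 0]
  | Label l i N => [:: 4; l; i; N; 0; 0]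
  | Gather l i N => [:: 5; l; i; N; 0; 0]
  | Take l i d N => [:: 6; l; i; d; N; 0]
  | SaveD l i d j N => [:: 7; l; i; d; j; N]
  | SaveU l i j N => [:: 8; l; i; j; N; 0]
  | RestD l i j N => [:: 9; l; i; j; N; 0]
  | RestU l i j N => [:: 10; l; i; j; N; 0]
  end%N.

Definition seq_st (g : nat -> nat) : st :=
  match g 0%N with
  | 0 => Idle (g 1)
  | 1 => Direct (g 1) (g 2)
  | 2 => HScan (g 1) (g 2)
  | 3 => FScan (g 1) (g 2) (g 3)
  | 4 => Label (g 1) (g 2) (g 3)
  | 5 => Gather (g 1) (g 2) (g 3)
  | 6 => Take (g 1) (g 2) (g 3) (g 4)
  | 7 => SaveD (g 1) (g 2) (g 3) (g 4) (g 5)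
  | 8 => SaveU (g 1) (g 2) (g 3) (g 4)
  | 9 => RestD (g 1) (g 2) (g 3) (g 4)
  | _ => RestU (g 1) (g 2) (g 3) (g 4)
  end%N.

(** Only integers below the fan-out are labels; records and the padding word, a large integer, count
    as ordinary samples. *)
Definition lab_of (W : nat) (A : Type) (fa : nat) (w : A + 'I_W) : option nat :=
  if w is inr k then if (k < fa)%N then Some (k : nat) else None else None.

Definition first_label (W : nat) (A : Type) fa (ws : seq (A + 'I_W)) :
    option nat :=
  ohead (pmap (lab_of fa) ws).

Section Rates.
Variable R : realType.

Definition clamp (x : R) : R := Num.max 0 (Num.min 1 x).

Lemma clamp01 x : 0 <= clamp x <= 1.
Proof. by rewrite le_max lexx /= ge_max ler01 ge_min lexx. Qed.

Lemma clampE x : 0 <= x <= 1 -> clamp x = x.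
Proof. by move=> /andP[x0 x1]; rewrite /clamp (min_idPr x1) (max_idPr x0). Qed.

Definition lam (x : R) : R := - ln (1 - x).

(* A record of probability [x] occupies more than [lam x / th] table slots of
   rate [th] each, and is accepted with the probability that makes up for it. *)
Definition nslot (th x : R) : nat := (Num.truncn (lam x / th)).+1.

Definition accept (th x : R) : R := lam x / (th * (nslot th x)%:R).

End Rates.

Section Program.
Variables (R : realType) (M' B' K' W' : nat).
Variables (Q J : nat) (dl : R) (b zt hm f f0 L tb hmax : nat).

Notation M := M'.+1.
Notation B := B'.+1.
Notation K := K'.+1.
Notation W := W'.+1.
Notation act := (action M B K W).
Notation fan := (fan f f0 L).

(* Memory: cell 0 holds the encoded control state; cells [1, ..., 1 + zt] (the Z
   zone) receive the blocks being scanned; [hbase] starts [hm] heavy records;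
   [pb] starts the P zone, the buffer of the current node; [cb] starts the read
   positions of its children. Disk: [tb] table blocks, [hmax] blocks of heavy
   records, and then, level by level, the node buffers, one block per child with
   the read position of that child in its word [b]. *)
Definition slots : nat := (tb * b)%N.
Definition cnt (l : nat) : nat := if l == L then 1%N else (f0 * f ^ (L.-1 - l))%N.
Definition off (l : nat) : nat := (\sum_(k < l) cnt k)%N.
Definition hbase : nat := zt.+2.
Definition pb : nat := (hbase + hm)%N.
Definition cb : nat := (pb + f * b)%N.
Definition addrA (l i : nat) : nat := (tb + hmax + off l + i)%N.

Definition cl (a : nat) : 'I_M := inord a.
Definition bk (a : nat) : 'I_K := inord a.
Definition wd (a : nat) : 'I_W := inord a.

(** Not injective: all words from [zt] on share the last cell of the zone. With [zt = 0] a whole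
    block lands in cell 1, so that cells 0 and 1 suffice even when [M = 2]; the words of a table or
    heavy block are then all equal, see [init_disk]. *)
Definition zmap : {ffun 'I_B -> 'I_M} := [ffun j : 'I_B => cl (1 + minn j zt)].

Definition pmapd (d : nat) : {ffun 'I_B -> 'I_M} :=
  [ffun j : 'I_B => cl (if (j < b)%N then pb + d * b + j
                        else if j == b :> nat then cb + d else 1)%N].

(** [rdT 0] also serves as an idle transfer, because a round that does not end the query has to
    perform an I/O. *)
Definition rdT (be : nat) : io M B K := Read (bk be) zmap.
Definition rdH (j : nat) : io M B K := Read (bk (tb + j)) zmap.
Definition rdA (l i : nat) : io M B K := Read (bk (addrA l i)) zmap.
Definition rdP (l i d : nat) : io M B K :=
  Read (bk (addrA l.-1 (i * f + d))) (pmapd d).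
Definition wrP (l i d : nat) : io M B K :=
  Write (bk (addrA l.-1 (i * f + d))) (pmapd d).

Definition code (hb kq : nat) (s : st) : nat := enc Q [:: hb, kq & st_seq s].

Definition keep (a : nat) : nat + nat := inl a.

Definition mk (hb kq : nat) (rep : seq nat) (sr : nat -> nat + nat) (s : st)
    (i : io M B K) : act :=
  ([set x : 'I_M | (x : nat) \in rep],
   [ffun x : 'I_M => if x == 0 :> nat then inr (wd (code hb kq s))
      else match sr x with inl y => inl (cl y) | inr k => inr (wd k) end],
   i).

Definition th (kq : nat) : R := kq%:R * dl.

Definition rate (kq : nat) : R := slots%:R * th kq.

Section Steps.
Variables (u : view R M W) (hb kq : nat).

Definition vget (a : nat) : R + 'I_W := u (cl a).
Definition vnat (a : nat) : nat := if vget a is inr k then k : nat else 0%N.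
Definition hq (a : nat) : R := if vget a is inl x then clamp x else 0.
Definition aq (a : nat) : R :=
  if vget a is inl x then clamp (accept (th kq) x) else 0.

Definition finish (rep : seq nat) (x : nat) : fd R act :=
  if hb == 0%N then ret R (mk hb kq rep keep (Idle x) (Halt _ _ _))
  else ret R (mk hb kq rep keep (HScan 0 x) (rdH 0)).

(** Uses up what is left of the root buffer. For the samples still missing it starts a refill of the
    root or, without a tree ([f0 = 0]), reads one random slot per sample. *)
Definition draw (rep : seq nat) (N x : nat) : fd R act :=
  let live := (fan L * b - x)%N in
  bind (subs [seq (aq a, a) | a <- iota (pb + x) (minn N live)]) (fun D =>
    if (N <= live)%N then finish (D ++ rep) (x + N)
    else if f0 == 0%N then
      fmap (fun s => mk hb kq (D ++ rep) keep (Direct s N.-1) (rdT (s %/ b)))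
        (unif R slots)
    else ret R (mk hb kq (D ++ rep) keep (Label L 0 (N - live)) (rdT 0))).

Definition pwords (l : nat) := [seq vget a | a <- iota pb (fan l * b)].

Definition refill (l : nat) (res : seq (nat + nat)) (a : nat) : nat + nat :=
  if (pb <= a < pb + fan l * b)%N then nth (inl a) res (a - pb) else inl a.

Definition setc (sr : nat -> nat + nat) (d x a : nat) : nat + nat :=
  if a == (cb + d)%N then inr x else sr a.

(** Refill cycle: [Label] draws labels, [Gather] selects the first label [d] left, and [Take]
    substitutes samples for the labels [d], from a table block at level 1 and from the current block
    of child [d] above. An exhausted child is swapped in by [SaveD] and [RestD] and refilled; a
    completed node gives way to its parent by [SaveU] and [RestU]. *)
Definition step (s : st) : fd R act :=
  match s with
  | Idle x =>
      bind (subs [seq (hq a, a) | a <- iota hbase hm]) (fun S0 =>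
      bind (checked 0%N (count_dist J (rate kq))) (fun N =>
        if N == J.+1 then ret R (mk hb kq S0 keep (FScan 0 J.+1 x) (rdT 0))
        else draw S0 N x))
  | Direct s N =>
      bind (subs [:: (aq (1 + s %% b), 1 + s %% b)%N]) (fun D => draw D N 0)
  | HScan j x =>
      fmap (fun D =>
        if (j.+1 < hb)%N then mk hb kq D keep (HScan j.+1 x) (rdH j.+1)
        else mk hb kq D keep (Idle x) (Halt _ _ _))
      (subs [seq (hq a, a) | a <- iota 1 b])
  | FScan s t x =>
      let a := (1 + s %% b)%N in
      bind (checked (false, 0%N)
             (scan_dist (th kq) ((slots - s.+1)%:R * th kq) t (aq a)))
      (fun z =>
        let rep := if z.1 then [:: a] else [::] in
        if (s.+1 < slots)%N
        then ret R (mk hb kq rep keep (FScan s.+1 z.2 x) (rdT (s.+1 %/ b)))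
        else finish rep x)
  | Label l i N =>
      fmap (fun ds => mk hb kq [::] (refill l [seq inr d | d <- ds])
                        (Gather l i N) (rdT 0))
        (iid (fan l * b) (unif R (fan l)))
  | Gather l i N =>
      if first_label (fan l) (pwords l) is Some d then
        if l == 1%N then ret R (mk hb kq [::] keep (Take l i d N) (rdT (i * f + d)))
        else let x := vnat (cb + d) in
          if (x < fan l.-1 * b)%N then
            ret R (mk hb kq [::] keep (Take l i d N)
                     (rdA l.-2 ((i * f + d) * f + x %/ b)))
          else ret R (mk hb kq [::] (setc keep d 0) (SaveD l i d 0 N) (rdT 0))
      else if l == L then draw [::] N 0
      else ret R (mk hb kq [::] keep (SaveU l i 0 N) (rdT 0))
  | Take l i d N =>
      let mask := lmask (@lab_of W R (fan l)) d (pwords l) in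
      let xs := [seq keep a | a <- iota pb (fan l * b)] in
      if l == 1%N then
        fmap (fun ts => mk hb kq [::]
                (refill l (fillm mask [seq keep (1 + t)%N | t <- ts] xs))
                (Gather l i N) (rdT 0))
          (iid (fan l * b) (unif R b))
      else let x := vnat (cb + d) in
        let k := minn (b - x %% b) (count id mask) in
        ret R (mk hb kq [::]
          (setc (refill l (fillm mask [seq keep a | a <- iota (1 + x %% b) k] xs))
             d (x + k)) (Gather l i N) (rdT 0))
  | SaveD l i d j N =>
      ret R (mk hb kq [::] keep
        (if (j.+1 < fan l)%N then SaveD l i d j.+1 N
         else RestD l.-1 (i * f + d) 0 N) (wrP l i j))
  | SaveU l i j N =>
      ret R (mk hb kq [::] keep
        (if (j.+1 < fan l)%N then SaveU l i j.+1 N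
         else RestU l.+1 (i %/ f) 0 N) (wrP l i j))
  | RestD l i j N =>
      ret R (mk hb kq [::] keep
        (if (j.+1 < fan l)%N then RestD l i j.+1 N else Label l i N) (rdP l i j))
  | RestU l i j N =>
      ret R (mk hb kq [::] keep
        (if (j.+1 < fan l)%N then RestU l i j.+1 N else Gather l i N) (rdP l i j))
  end.

Lemma valid_finish rep x : fd_valid (finish rep x).
Proof. by rewrite /finish; case: eqP => _; exact: valid_ret. Qed.

Lemma valid_subs_map (q : nat -> R) r :
  (forall a, 0 <= q a <= 1) -> fd_valid (subs [seq (q a, a) | a <- r]).
Proof.
by move=> H; apply: valid_subs => x xr; have [a [<- _]] := In_map xr; apply: H.
Qed.

Lemma hq01 a : 0 <= hq a <= 1.
Proof. by rewrite /hq; case: vget => [x|_]; rewrite ?clamp01 // lexx ler01. Qed.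

Lemma aq01 a : 0 <= aq a <= 1.
Proof. by rewrite /aq; case: vget => [x|_]; rewrite ?clamp01 // lexx ler01. Qed.

Lemma valid_draw rep N x : fd_valid (draw rep N x).
Proof.
rewrite /draw; apply: valid_bind => [|D].
  by apply: valid_subs_map; exact: aq01.
case: leqP => _; first exact: valid_finish.
case: eqP => _; last exact: valid_ret.
by apply: valid_fmap; exact: valid_unif.
Qed.

Lemma valid_step s : fd_valid (step s).
Proof.
case: s => [x|s N|j x|s t x|l i N|l i N|l i d N|l i d j N|l i j N|l i j N|l i j N] /=;
  try exact: valid_ret.
- apply: valid_bind => [|S0]; first by apply: valid_subs_map; exact: hq01.
  apply: valid_bind => [|N]; first exact: valid_checked.
  by case: eqP => _; [exact: valid_ret | exact: valid_draw].
- apply: valid_bind => [|D]; last exact: valid_draw.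
  by apply: (@valid_subs_map aq [:: (1 + s %% b)%N]); exact: aq01.
- by apply: valid_fmap; apply: valid_subs_map; exact: hq01.
- apply: valid_bind => [|z]; first exact: valid_checked.
  by case: ltnP => _; [exact: valid_ret | exact: valid_finish].
- by apply: valid_fmap; apply: valid_iid; exact: valid_unif.
- case: first_label => [d|]; last first.
    by case: eqP => _; [exact: valid_draw | exact: valid_ret].
  case: eqP => _; first exact: valid_ret.
  by case: ltnP => _; exact: valid_ret.
case: eqP => _; last exact: valid_ret.
by apply: valid_fmap; apply: valid_iid; exact: valid_unif.
Qed.

End Steps.

Definition pdist (u : view R M W) : fd R act :=
  let g k := dec Q k (vnat u 0) in
  step u (g 0%N) (g 1%N) (seq_st (fun k => g k.+2)).

Lemma valid_pdist u : fd_valid (pdist u).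
Proof. exact: valid_step. Qed.

End Program.

(** * Invariants of the machine *)

Lemma leq_div_add_mul (b d e t : nat) : (t < b)%N -> (d < e)%N ->
  (d * b + t < e * b)%N.
Proof. by move=> tb de; apply: leq_trans (_ : d.+1 * b <= _)%N; rewrite ?leq_mul2r ?de ?orbT // mulSn addnC ltn_add2r. Qed.

Section Machine.
Variables (R : realType) (M' B' K' W' : nat).
Variables (Q J : nat) (dl : R) (b zt hm f f0 L tb hmax : nat).
Variables (S : finType) (p : S -> R).

Notation M := M'.+1.
Notation B := B'.+1.
Notation K := K'.+1.
Notation W := W'.+1.
Notation act := (action M B K W).
Notation fan := (fan f f0 L).
Notation cl := (cl M').
Notation bk := (bk K').
Notation wd := (wd W').
Notation pb := (pb zt hm).
Notation cb := (cb b zt hm f).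
Notation hbase := (hbase zt).
Notation cnt := (cnt f f0 L).
Notation off := (off f f0 L).
Notation addrA := (addrA f f0 L tb hmax).
Notation slots := (slots b tb).
Notation zmap := (zmap M' B' zt).
Notation pmapd := (pmapd M' B' b zt hm f).
Notation mk := (@mk M' B' K' W' Q).
Notation code := (code Q).
Notation wordT := (S + 'I_W)%type.
Notation mem := (memory M W S).
Notation dsk := (disk B K W S).
Notation cfg := (config M B K W S).
Notation nxt := (@next_config M B K W S).
Notation rdT := (@rdT M' B' K' zt).
Notation rdH := (@rdH M' B' K' zt tb).
Notation rdA := (@rdA M' B' K' zt f f0 L tb hmax).
Notation rdP := (@rdP M' B' K' b zt hm f f0 L tb hmax).
Notation wrP := (@wrP M' B' K' b zt hm f f0 L tb hmax).

Hypothesis b_gt0 : (0 < b)%N.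
Hypothesis b_leB : (b <= B)%N.
(** First case: the useful words of a block fill cells [1] to [b] and the others go to cell [1 + b],
    while [b < B] leaves a word for a read position. Second case, for small [B]: one slot per block
    and no tree. *)
Hypothesis zt_cases : zt = b /\ (b < B)%N \/ [/\ zt = 0%N, b = 1%N & f0 = 0%N].
Hypothesis f0_le : (f0 <= f)%N.
Hypothesis f0_L : (0 < L)%N = (0 < f0)%N.
Hypothesis mem_fits : (cb + f <= M)%N.
Hypothesis disk_fits : (tb + hmax + off L <= K)%N.
Hypothesis tb_cnt : (0 < f0)%N -> tb = cnt 0.

Definition mget (m : mem) (a : nat) : wordT := m (cl a).

Definition nullw : wordT := inr ord_max.

Lemma cl_inj a a' : (a < M)%N -> (a' < M)%N -> cl a = cl a' -> a = a'.
Proof. by move=> aM aM' /(congr1 val); rewrite /= !inordK. Qed.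

Lemma cl_surj (x : 'I_M) : cl x = x.
Proof. exact: inord_val. Qed.

Definition srcval (m : mem) (x : nat + nat) : wordT :=
  match x with inl y => mget m y | inr k => inr (wd k) end.

Lemma mget_compute hb kq rep sr s i (m : mem) a : (a < M)%N ->
  mget (compute (mk hb kq rep sr s i) m) a =
  if a == 0%N then inr (wd (code hb kq s)) else srcval m (sr a).
Proof.
move=> aM; rewrite /mget /compute /mk ffunE /= ffunE inordK //.
by case: eqP => // _; case: (sr a).
Qed.

(** Several words may be aimed at the same cell, so its new content is known only when they
    agree. *)
Lemma read_hit (g : {ffun 'I_B -> 'I_M}) (blk : {ffun 'I_B -> wordT}) (m : mem)
    x w :
  (exists j, g j = x) -> (forall j, g j = x -> blk j = w) ->
  ([ffun x => if [pick j | g j == x] is Some j then blk j else m x] : mem) x = w.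
Proof.
move=> [j gj] H; rewrite ffunE; case: pickP => [k /eqP/H //|/(_ j)].
by rewrite gj eqxx.
Qed.

Lemma read_miss (g : {ffun 'I_B -> 'I_M}) (blk : {ffun 'I_B -> wordT}) (m : mem)
    x :
  (forall j, g j <> x) ->
  ([ffun x => if [pick j | g j == x] is Some j then blk j else m x] : mem) x = m x.
Proof. by move=> H; rewrite ffunE; case: pickP => // k /eqP/H. Qed.

Lemma zt_fits : (1 + zt < M)%N.
Proof. by move: mem_fits; rewrite /cb /pb /hbase; lia. Qed.

Lemma zmap_other a j : (a < M)%N -> a = 0%N \/ (zt.+2 <= a)%N -> zmap j <> cl a.
Proof.
move=> aM ha; rewrite /zmap ffunE => /cl_inj.
by have := zt_fits; have := geq_minr j zt; move=> ? ? H; have := H ltac:(lia) aM; lia.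
Qed.

Lemma zmap_hit t : (t < b)%N -> exists j : 'I_B, zmap j = cl (1 + t).
Proof.
move=> tb'; have tB : (t < B)%N by lia.
exists (Ordinal tB); rewrite ffunE /=; congr (cl (1 + _)); apply/minn_idPl.
by case: zt_cases => [[-> _]|[-> ? _]]; lia.
Qed.

Lemma zmap_inv t (j : 'I_B) : (t < b)%N -> zmap j = cl (1 + t) -> minn j zt = t.
Proof.
move=> tb'; rewrite ffunE => /cl_inj H; have := zt_fits.
have tz : (t <= zt)%N by case: zt_cases => [[-> _]|[-> ? _]]; lia.
by have := geq_minr j zt; move=> ? ?; have := H ltac:(lia) ltac:(lia); lia.
Qed.

Definition zread (m' : mem) (blk : {ffun 'I_B -> wordT}) : Prop :=
  forall t w, (t < b)%N -> (forall j : 'I_B, minn j zt = t -> blk j = w) ->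
  mget m' (1 + t) = w.

Lemma next_readz hb kq rep sr s be (c : cfg) :
  let c2 := nxt (mk hb kq rep sr s (Read be zmap)) c in
  [/\ c2.2 = c.2, mget c2.1 0 = inr (wd (code hb kq s)),
      forall a, (zt.+2 <= a < M)%N -> mget c2.1 a = srcval c.1 (sr a) &
      zread c2.1 (c.2 be)].
Proof.
rewrite /next_config /=; split=> //.
- by rewrite {1}/mget read_miss => [|j]; [exact: mget_compute | apply: zmap_other; [|left]].
- move=> a /andP[a2 aM]; rewrite {1}/mget read_miss => [|j].
    by rewrite -[LHS]/(mget _ a) mget_compute //; case: a a2 aM.
  by apply: zmap_other => //; right.
move=> t w tb' H; rewrite /mget; apply: read_hit => [|j].
  exact: zmap_hit.
by move/(zmap_inv tb'); apply: H.
Qed.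

Lemma next_halt hb kq rep sr s (c : cfg) :
  let c2 := nxt (mk hb kq rep sr s (Halt _ _ _)) c in
  [/\ c2.2 = c.2, mget c2.1 0 = inr (wd (code hb kq s)) &
      forall a, (0 < a < M)%N -> mget c2.1 a = srcval c.1 (sr a)].
Proof.
rewrite /next_config /=; split=> // [|[|a] // /andP[_ aM]]; exact: mget_compute.
Qed.

Lemma next_readp hb kq rep s be d (c : cfg) : (d < f)%N -> (b < B)%N ->
  let c2 := nxt (mk hb kq rep keep s (Read be (pmapd d))) c in
  [/\ c2.2 = c.2, mget c2.1 0 = inr (wd (code hb kq s)),
      forall a, (1 < a < M)%N -> ~~ (pb + d * b <= a < pb + d * b + b)%N ->
        a != (cb + d)%N -> mget c2.1 a = mget c.1 a,
      forall t, (t < b)%N -> mget c2.1 (pb + d * b + t) = c.2 be (inord t) &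
      mget c2.1 (cb + d) = c.2 be (inord b)].
Proof.
move=> df bB; rewrite /next_config /=.
have db : (d * b + b <= f * b)%N by rewrite -mulSnr leq_mul2r df orbT.
have cbE : cb = (pb + f * b)%N by [].
have pb2 : (2 <= pb)%N by rewrite /pb /hbase.
have ltM (j : 'I_B) : (( if (j < b)%N then pb + d * b + j
    else if j == b :> nat then cb + d else 1) < M)%N.
  by have := mem_fits; case: (ltnP j b) => ?; [lia|case: (j =P b :> nat) => ?; lia].
split=> //.
- rewrite {1}/mget read_miss => [|j]; first exact: mget_compute.
  rewrite ffunE => /cl_inj H; have := H (ltM j) isT.
  by case: (ltnP j b) => ?; [lia|case: (j =P b :> nat) => ?; lia].
- move=> a /andP[a1 aM] na nc; rewrite {1}/mget read_miss => [|j].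
    by rewrite -[LHS]/(mget _ a) mget_compute // (_ : a == 0%N = false) //; lia.
  rewrite ffunE => /cl_inj H; have := H (ltM j) aM.
  by case: (ltnP j b) => ?; [lia|case: (j =P b :> nat) => ?; lia].
- move=> t tb'; have tM : (pb + d * b + t < M)%N by have := mem_fits; lia.
  rewrite /mget; apply: read_hit.
    exists (inord t); rewrite ffunE inordK; last by lia.
    by rewrite tb'.
  move=> j; rewrite ffunE => /cl_inj H; have := H (ltM j) tM.
  case: (ltnP j b) => ? E; last by move: E; case: (j =P b :> nat) => ? ?; lia.
  by congr (_ _); apply: val_inj; rewrite /= inordK; lia.
have cM : (cb + d < M)%N by have := mem_fits; lia.
rewrite /mget; apply: read_hit.
  by exists (inord b); rewrite ffunE inordK // ltnn eqxx.
move=> j; rewrite ffunE => /cl_inj H; have := H (ltM j) cM.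
case: (ltnP j b) => ? E; first lia.
move: E; case: (j =P b :> nat) => [jb ?|? ?]; last lia.
by congr (_ _); apply: val_inj; rewrite /= inordK.
Qed.

Lemma pmapdE d (j : 'I_B) : pmapd d j =
  cl (if (j < b)%N then pb + d * b + j else if j == b :> nat then cb + d else 1)%N.
Proof. by rewrite ffunE. Qed.

Lemma next_write hb kq rep s be d (c : cfg) : (d < f)%N -> (b < B)%N ->
  let c2 := nxt (mk hb kq rep keep s (Write be (pmapd d))) c in
  [/\ forall be', be' != be -> c2.2 be' = c.2 be',
      mget c2.1 0 = inr (wd (code hb kq s)),
      forall a, (0 < a < M)%N -> mget c2.1 a = mget c.1 a,
      forall t, (t < b)%N -> c2.2 be (inord t) = mget c.1 (pb + d * b + t) &
      c2.2 be (inord b) = mget c.1 (cb + d)].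
Proof.
move=> df bB; rewrite /next_config /=.
have db : (d * b + b <= f * b)%N by rewrite -mulSnr leq_mul2r df orbT.
have cbE : cb = (pb + f * b)%N by [].
have pb2 : (2 <= pb)%N by rewrite /pb /hbase.
split.
- by move=> be' /negPf nb; rewrite ffunE nb.
- exact: mget_compute.
- by move=> [|a] // /andP[_ aM]; rewrite mget_compute.
- move=> t tb'; rewrite ffunE eqxx ffunE pmapdE inordK ?tb'; last lia.
  rewrite -[LHS]/(mget _ _) mget_compute; last by have := mem_fits; lia.
  by rewrite (_ : _ == 0%N = false) //; lia.
rewrite ffunE eqxx ffunE pmapdE inordK // ltnn eqxx.
rewrite -[LHS]/(mget _ _) mget_compute; last by have := mem_fits; lia.
by rewrite (_ : _ == 0%N = false) //; lia.
Qed.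

(* The part of the configuration that depends on the instance. *)
Variables (hb kq : nat) (hw Tw : nat -> wordT).
Hypothesis hb_le : (hb <= hmax)%N.
Hypothesis Tw_nolab : forall fa s, (fa <= f)%N -> lab_of fa (Tw s) = None.

Definition static (m : mem) (dk : dsk) : Prop :=
  [/\ forall t, (t < hm)%N -> mget m (hbase + t) = hw t,
      forall be (j : 'I_B), (be < tb)%N -> dk (bk be) j = Tw (be * b + minn j b.-1) &
      forall j (j' : 'I_B), (j < hb)%N ->
        dk (bk (tb + j)) j' = hw (hm + j * b + minn j' b.-1)].

Section Rep.
Variables (ct : nat -> nat -> seq wordT) (ps : nat -> nat -> nat).

Definition inmem1 (m : mem) l i d : Prop :=
  (forall t, (t < b)%N -> mget m (pb + d * b + t) = nth nullw (ct l i) (d * b + t))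
  /\ mget m (cb + d) = inr (wd (ps l.-1 (i * f + d))).

Definition ondisk1 (dk : dsk) l i d : Prop :=
  (forall t, (t < b)%N ->
     dk (bk (addrA l.-1 (i * f + d))) (inord t) = nth nullw (ct l i) (d * b + t))
  /\ dk (bk (addrA l.-1 (i * f + d))) (inord b) = inr (wd (ps l.-1 (i * f + d))).

Definition node l i : bool := [&& 0 < l, l <= L & i < cnt l]%N.

(** The disk copy of the node in memory may be stale, so nothing is required of it. The block for
    child [d] is addressed by the child and also holds its read position, hence loading a node
    brings along the positions of its children. *)
Definition rep (m : mem) (dk : dsk) (cur : option (nat * nat)) : Prop :=
  forall l i d, node l i -> (d < fan l)%N ->
  if cur == Some (l, i) then inmem1 m l i d else ondisk1 dk l i d.

End Rep.

Lemma f_gt0 : (0 < L)%N -> (0 < f)%N. Proof. by rewrite f0_L; lia. Qed.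

Lemma zt_b : (0 < L)%N -> zt = b /\ (b < B)%N.
Proof. by rewrite f0_L => h; case: zt_cases => // -[_ _ e]; rewrite e in h. Qed.

Lemma fanle l : (fan l <= f)%N. Proof. exact: fan_le. Qed.

Lemma fanL : fan L = f0. Proof. by rewrite /fan eqxx. Qed.

Lemma fan_lt l : (l < L)%N -> fan l = f.
Proof. by move=> h; rewrite /fan ltn_eqF. Qed.

Lemma node_pos l i : node l i -> (0 < L)%N. Proof. by case/and3P; lia. Qed.

Lemma cnt_child l i d : node l i -> (d < fan l)%N -> (i * f + d < cnt l.-1)%N.
Proof.
case/and3P=> l0 lL; rewrite /cnt.
have n1 : (l.-1 == L) = false by lia.
rewrite n1; case: eqP => [->|/eqP nl].
  by rewrite ltnS leqn0 => /eqP->; rewrite fanL mul0n subnn muln1.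
have llL : (l < L)%N by rewrite ltn_neqAle nl.
rewrite fan_lt // => il df.
have -> : (L.-1 - l.-1 = (L.-1 - l).+1)%N by lia.
by rewrite expnSr mulnA; apply: leq_div_add_mul.
Qed.

Lemma node_child l i d : node l i -> (1 < l)%N -> (d < fan l)%N ->
  node l.-1 (i * f + d).
Proof.
move=> nl l1 df; rewrite /node (cnt_child nl df) andbT.
by case/and3P: nl => ? ? _; lia.
Qed.

Lemma node_parent l i : node l i -> (l < L)%N -> node l.+1 (i %/ f).
Proof.
move=> nl lL; have f0' := f_gt0 (node_pos nl); case/and3P: nl => l0 _ il.
rewrite /node lL /=; move: il; rewrite /cnt ltn_eqF //.
case: eqP => [<-|ne] il.
  rewrite divn_small //; move: il; rewrite -pred_Sn subnn muln1.
  by move/leq_trans; apply.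
rewrite ltn_divLR //; move: il.
have -> : (L.-1 - l = (L.-1 - l.+1).+1)%N by lia.
by rewrite expnSr mulnA.
Qed.

Lemma node_child_parent i d : (d < f)%N -> ((i * f + d) %/ f = i)%N.
Proof. by move=> df; rewrite divnMDl ?divn_small ?addn0 //; lia. Qed.

Lemma node_small l i : node l i -> (i < f ^ (L - l))%N.
Proof.
move=> nl; have := f_gt0 (node_pos nl); case/and3P: nl => l0 lL.
rewrite /cnt; case: eqP => [->|ne]; first by rewrite subnn expn0.
have -> : (L - l = (L.-1 - l).+1)%N by lia.
move=> il f1; apply: leq_trans il _.
by rewrite expnS leq_mul2r f0_le orbT.
Qed.

Lemma cnt_le l : (l < L)%N -> (cnt l <= cnt 0)%N.
Proof.
move=> lL; have f1 := f_gt0 (leq_ltn_trans (leq0n _) lL).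
rewrite /cnt !ltn_eqF ?(leq_ltn_trans _ lL) //.
by apply: leq_mul => //; apply: leq_pexp2l => //; rewrite subn0 leq_subr.
Qed.

Lemma off_mono l l' : (l < l')%N -> (off l + cnt l <= off l')%N.
Proof.
elim: l' => // l' IH; rewrite ltnS leq_eqVlt /off big_ord_recr /=.
by case/predU1P=> [->//|/IH h]; apply: leq_trans h _; rewrite leq_addr.
Qed.

Lemma addrA_lt l i : (l < L)%N -> (i < cnt l)%N -> (addrA l i < K)%N.
Proof. by move=> /off_mono; have := disk_fits; rewrite /addrA; lia. Qed.

Lemma bk_inj a a' : (a < K)%N -> (a' < K)%N -> bk a = bk a' -> a = a'.
Proof. by move=> aK aK' /(congr1 val); rewrite /= !inordK. Qed.

Lemma addrA_inj l i l' i' : (l < L)%N -> (i < cnt l)%N -> (l' < L)%N ->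
  (i' < cnt l')%N -> bk (addrA l i) = bk (addrA l' i') -> (l, i) = (l', i').
Proof.
move=> lL il lL' il' /bk_inj H.
have := H (addrA_lt lL il) (addrA_lt lL' il'); rewrite /addrA.
have [h|h|->] := ltngtP l l'; last by move=> E; congr (_, _); lia.
  by have := off_mono h; lia.
by have := off_mono h; lia.
Qed.

Lemma block_inj l i d l' i' d' : node l i -> node l' i' ->
  (d < fan l)%N -> (d' < fan l')%N ->
  bk (addrA l.-1 (i * f + d)) = bk (addrA l'.-1 (i' * f + d')) ->
  [/\ l = l', i = i' & d = d'].
Proof.
move=> n1 n2 h1 h2; have df := leq_trans h1 (fanle _); have df' := leq_trans h2 (fanle _).
have lv l0 i0 : node l0 i0 -> (l0.-1 < L)%N by case/and3P; lia.
move=> /(addrA_inj (lv _ _ n1) (cnt_child n1 h1) (lv _ _ n2) (cnt_child n2 h2)).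
case=> E1 E2; have lE : l = l' by case/and3P: n1; case/and3P: n2; lia.
have iE : i = i' by rewrite -(node_child_parent i df) E2 node_child_parent.
by split=> //; move: E2; rewrite iE; lia.
Qed.

Definition nolab l (s : seq wordT) : bool :=
  all (fun w => lab_of (fan l) w == None) s.

(** Start of the path to the root on which buffers may contain labels. For [Label] and [RestD] the
    node itself has no labels yet, and for [SaveU] none any more, so the path starts at its parent;
    level [L.+1] means an empty path. *)
Definition anc0 (s : st) : nat * nat :=
  match s with
  | Gather l i _ | Take l i _ _ | SaveD l i _ _ _ | RestU l i _ _ => (l, i)
  | SaveU l i _ _ | RestD l i _ _ | Label l i _ => (l.+1, i %/ f)%N
  | _ => (L.+1, 0%N)
  end.

Definition isanc (n : nat * nat) l i : bool :=
  (n.1 <= l)%N && (n.2 %/ f ^ (l - n.1) == i)%N.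

(** Node whose exhausted buffer is about to be overwritten: its position is already reset to 0, but
    its old content must not count as samples to deliver. *)
Definition fresh (s : st) : option (nat * nat) :=
  match s with
  | Label l i _ | RestD l i _ _ => Some (l, i)
  | SaveD l i d _ _ => Some (l.-1, i * f + d)%N
  | _ => None
  end.

(** During a reload the P zone mixes two nodes and every node is intact on disk, hence [None]. *)
Definition curs (s : st) : option (nat * nat) :=
  match s with
  | Label l i _ | Gather l i _ | Take l i _ _ | SaveD l i _ _ _
  | SaveU l i _ _ => Some (l, i)
  | RestD _ _ _ _ | RestU _ _ _ _ => None
  | _ => Some (L, 0%N)
  end.

Definition shape (ct : nat -> nat -> seq wordT) (ps : nat -> nat -> nat) : Prop :=
  forall l i, node l i -> size (ct l i) = (fan l * b)%N /\ (ps l i <= fan l * b)%N.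

Definition lab_ok n (ct : nat -> nat -> seq wordT) (ps : nat -> nat -> nat) : Prop :=
  forall l i, node l i ->
  if isanc n l i then ps l i = 0%N else nolab l (ct l i).

Definition mode_ok (s : st) ct (ps : nat -> nat -> nat) : Prop :=
  match s with
  | Idle x => x = ps L 0%N /\ (x <= fan L * b)%N
  | Direct s N => [/\ f0 = 0%N, (s < slots)%N, (N <= J)%N & ps L 0%N = 0%N]
  | HScan j x => [/\ (j < hb)%N, x = ps L 0%N & (x <= fan L * b)%N]
  | FScan s t x => [/\ (s < slots)%N, (t <= J.+1)%N, x = ps L 0%N & (x <= fan L * b)%N]
  | Label l i N => [/\ node l i, (N <= J)%N & ps l i = 0%N]
  | Gather l i N => node l i /\ (N <= J)%N
  | Take l i d N => [/\ node l i, (N <= J)%N, (d < fan l)%N,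
      (0 < count id (lmask (@lab_of W S (fan l)) d (ct l i)))%N &
      (1 < l)%N -> (ps l.-1 (i * f + d) < f * b)%N]
  | SaveD l i d j N => [/\ node l i, (N <= J)%N, (1 < l)%N && (d < fan l)%N,
      (j < fan l)%N & ps l.-1 (i * f + d)%N = 0%N]
  | SaveU l i j N => [/\ node l i, (N <= J)%N, (l < L)%N & (j < fan l)%N]
  | RestD l i j N =>
     [/\ node l i, (N <= J)%N, (l < L)%N, (j < fan l)%N & ps l i = 0%N]
  | RestU l i j N => [/\ node l i, (N <= J)%N & (j < fan l)%N]
  end.

Definition zone (s : st) (m : mem) (dk : dsk) ct ps : Prop :=
  match s with
  | Direct s _ | FScan s _ _ => mget m (1 + s %% b) = Tw s
  | HScan j _ => forall t, (t < b)%N -> mget m (1 + t) = hw (hm + j * b + t)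
  | Take l i d _ => forall t, (t < b)%N -> mget m (1 + t) =
      if l == 1%N then Tw ((i * f + d) * b + t)
      else nth nullw (ct l.-1 (i * f + d)%N)
             (ps l.-1 (i * f + d)%N %/ b * b + t)
  | SaveD l i _ j _ | SaveU l i j _ =>
      forall d, (d < j)%N -> ondisk1 ct ps dk l i d
  | RestD l i j _ | RestU l i j _ => forall d, (d < j)%N -> inmem1 ct ps m l i d
  | _ => True
  end.

Definition core (c : cfg) cur ct ps : Prop :=
  static c.1 c.2 /\ rep ct ps c.1 c.2 cur.

Definition wf (s : st) ct ps : Prop :=
  [/\ shape ct ps, lab_ok (anc0 s) ct ps & mode_ok s ct ps].

Definition Inv (c : cfg) (s : st) ct ps : Prop :=
  [/\ mget c.1 0 = inr (wd (code hb kq s)), core c (curs s) ct ps,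
      zone s c.1 c.2 ct ps & wf s ct ps].

(* Every address used for the P zone, the counters and the heavy records lies
   above the Z zone. *)
Lemma core_mem (c c2 : cfg) cur ct ps : c2.2 = c.2 ->
  (forall a, (zt.+2 <= a < M)%N -> mget c2.1 a = mget c.1 a) ->
  core c cur ct ps -> core c2 cur ct ps.
Proof.
move=> E Hm [[h1 h2 h3] hr]; have mf := mem_fits.
have cbE : cb = (pb + f * b)%N by [].
have pbE : pb = (zt.+2 + hm)%N by [].
split; first split; rewrite ?E //.
  by move=> t th; rewrite Hm ?h1 // /hbase; lia.
move=> l i d nl df; have := hr l i d nl df.
have df' := leq_trans df (fanle l).
case: ifP => _ -[H1 H2] //.
split=> [t tb'|]; last by rewrite Hm ?H2 //; lia.
rewrite Hm ?H1 //.
by have := leq_div_add_mul tb' df'; lia.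
Qed.

Lemma T_word (c : cfg) be t (j : 'I_B) : static c.1 c.2 -> (be < tb)%N -> (t < b)%N ->
  minn j zt = t -> c.2 (bk be) j = Tw (be * b + t).
Proof.
move=> [_ h2 _] bet tb' jz; rewrite h2 //; congr (Tw (_ + _)).
by case: zt_cases jz => [[-> _]|[-> -> _]]; lia.
Qed.

Lemma inv_readz (c : cfg) rp s be ct ps :
  core c (curs s) ct ps -> wf s ct ps ->
  (forall m', zread m' (c.2 be) -> zone s m' c.2 ct ps) ->
  Inv (nxt (mk hb kq rp keep s (Read be zmap)) c) s ct ps.
Proof.
move=> hc hw' hz; have [E1 E2 E3 E4] := next_readz hb kq rp keep s be c.
split=> //; first by apply: core_mem hc.
by rewrite E1; apply: hz.
Qed.

Lemma inv_halt (c : cfg) rp x ct ps :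
  core c (Some (L, 0%N)) ct ps -> wf (Idle x) ct ps ->
  Inv (nxt (mk hb kq rp keep (Idle x) (Halt _ _ _)) c) (Idle x) ct ps.
Proof.
move=> hc hw'; have [E1 E2 E3] := next_halt hb kq rp keep (Idle x) c.
split=> //; apply: core_mem hc => // a /andP[a2 aM].
by rewrite E3 //; lia.
Qed.

(* Only the node in memory and the counters of its children change. *)
Lemma inv_change (c : cfg) sr s ct ps ct' ps' l i :
  core c (Some (l, i)) ct ps -> node l i -> curs s = Some (l, i) ->
  (forall a, (hbase <= a < pb)%N -> sr a = inl a) ->
  (forall d, (d < fan l)%N ->
     (forall t, (t < b)%N -> srcval c.1 (sr (pb + d * b + t)%N) =
        nth nullw (ct' l i) (d * b + t)) /\
     srcval c.1 (sr (cb + d)%N) = inr (wd (ps' l.-1 (i * f + d)%N))) ->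
  (forall l' i', ~~ ((l' == l) && (i' == i)) -> ct' l' i' = ct l' i') ->
  (forall l' i' d, node l' i' -> ~~ ((l' == l) && (i' == i)) -> (d < fan l')%N ->
     ps' l'.-1 (i' * f + d)%N = ps l'.-1 (i' * f + d)%N) ->
  wf s ct' ps' ->
  (forall m' dk', zone s m' dk' ct' ps') ->
  Inv (nxt (mk hb kq [::] sr s (rdT 0)) c) s ct' ps'.
Proof.
move=> [[h1 h2 h3] hr] nl cs Hh HP Hct Hps hwf hz; have mf := mem_fits.
have cbE : cb = (pb + f * b)%N by [].
have pbE : pb = (zt.+2 + hm)%N by [].
have [E1 E2 E3 _] := next_readz hb kq [::] sr s (bk 0) c.
split=> //; rewrite cs; split; first split; rewrite ?E1 //.
  move=> t th; rewrite -[rdT 0]/(Read _ _) E3; last by rewrite /hbase; lia.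
  rewrite Hh; first exact: h1.
  by rewrite /hbase; lia.
move=> l' i' d nl' df; have df' := leq_trans df (fanle l').
have := hr l' i' d nl' df.
case: (Some (l, i) =P Some (l', i')) => [[e1 e2]|ne].
  subst l' i' => _; have [H1 H2] := HP d df.
  split=> [t tb'|]; rewrite -[rdT 0]/(Read _ _) E3 ?H1 ?H2 //.
    by have := leq_div_add_mul tb' df'; lia.
  by lia.
have ne' : ~~ ((l' == l) && (i' == i)).
  by apply/negP => /andP[/eqP e1 /eqP e2]; apply: ne; rewrite e1 e2.
by rewrite /ondisk1 Hct // Hps.
Qed.

Lemma inv_save_next (c : cfg) s s' l i j ct ps :
  core c (Some (l, i)) ct ps -> node l i -> (j < fan l)%N ->
  (forall d, (d < j)%N -> ondisk1 ct ps c.2 l i d) -> wf s' ct ps ->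
  curs s = Some (l, i) ->
  let c2 := nxt (mk hb kq [::] keep s' (wrP l i j)) c in
  [/\ mget c2.1 0 = inr (wd (code hb kq s')), static c2.1 c2.2,
      rep ct ps c2.1 c2.2 (Some (l, i)) &
      forall d, (d < j.+1)%N -> ondisk1 ct ps c2.2 l i d].
Proof.
move=> [[h1 h2 h3] hr] nl jf hd hwf cs; rewrite /wrP.
have L0 := node_pos nl; have [_ bB] := zt_b L0.
have jf' : (j < f)%N := leq_trans jf (fanle l); have mf := mem_fits.
have cbE : cb = (pb + f * b)%N by [].
have pbE : pb = (zt.+2 + hm)%N by [].
have l1L : (l.-1 < L)%N by case/and3P: nl; lia.
have [E1 E2 E3 E4 E5] := next_write hb kq [::] s' (bk (addrA l.-1 (i * f + j))) c jf' bB.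
have far a : (a < tb + hmax)%N -> bk a != bk (addrA l.-1 (i * f + j)).
  move=> ah; apply/eqP => /bk_inj H.
  have := H ltac:(have := disk_fits; lia) (addrA_lt l1L (cnt_child nl jf)).
  by rewrite /addrA; lia.
split=> //.
- split.
  + by move=> t th; rewrite E3 ?h1 // /hbase; lia.
  + by move=> be j' bet; rewrite E1 ?h2 //; apply: far; lia.
  by move=> j1 j' jh; rewrite E1 ?h3 //; apply: far; lia.
- move=> l' i' d nl' df; have df' := leq_trans df (fanle l').
  have := hr l' i' d nl' df; case: ifP => ne [H1 H2].
    split=> [t tb'|]; rewrite E3 ?H1 ?H2 //; last lia.
    by have := leq_div_add_mul tb' df'; lia.
  have nb : bk (addrA l'.-1 (i' * f + d)) != bk (addrA l.-1 (i * f + j)).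
    apply/eqP => /(block_inj nl' nl df jf)[e1 e2 _].
    by rewrite e1 e2 eqxx in ne.
  by rewrite /ondisk1 E1.
move=> d; rewrite ltnS leq_eqVlt => /predU1P[->|dj].
  have := hr l i j nl jf; rewrite eqxx => -[H1 H2].
  by split=> [t tb'|]; [rewrite -H1 //; exact: E4 | rewrite -H2; exact: E5].
have nb : bk (addrA l.-1 (i * f + d)) != bk (addrA l.-1 (i * f + j)).
  apply/eqP => /(block_inj nl nl (ltn_trans dj jf) jf)[_ _ e].
  by rewrite e ltnn in dj.
by rewrite /ondisk1 E1 //; apply: hd.
Qed.

Lemma inv_rest_next (c : cfg) s' l i j ct ps :
  core c None ct ps -> node l i -> (j < fan l)%N ->
  (forall d, (d < j)%N -> inmem1 ct ps c.1 l i d) ->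
  let c2 := nxt (mk hb kq [::] keep s' (rdP l i j)) c in
  [/\ mget c2.1 0 = inr (wd (code hb kq s')), static c2.1 c2.2,
      rep ct ps c2.1 c2.2 None &
      forall d, (d < j.+1)%N -> inmem1 ct ps c2.1 l i d].
Proof.
move=> [[h1 h2 h3] hr] nl jf hd; rewrite /rdP.
have L0 := node_pos nl; have [_ bB] := zt_b L0.
have jf' : (j < f)%N := leq_trans jf (fanle l); have mf := mem_fits.
have cbE : cb = (pb + f * b)%N by [].
have pbE : pb = (zt.+2 + hm)%N by [].
have [E1 E2 E3 E4 E5] := next_readp hb kq [::] s' (bk (addrA l.-1 (i * f + j))) c jf' bB.
have [D1 D2] := hr l i j nl jf.
split=> //.
- split; rewrite ?E1 // => t th; rewrite E3 ?h1 // /hbase.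
  + lia.
  + lia.
  by apply/eqP; lia.
move=> d; rewrite ltnS leq_eqVlt => /predU1P[->|dj].
  by split=> [t tb'|]; [rewrite -D1 //; exact: E4 | rewrite -D2; exact: E5].
have [H1 H2] := hd d dj.
have dfb : (d * b + b <= j * b)%N by rewrite -mulSnr leq_mul2r dj orbT.
have jfb : (j * b + b <= f * b)%N by rewrite -mulSnr leq_mul2r jf' orbT.
split=> [t tb'|]; rewrite E3 ?H1 ?H2 //; try lia.
all: by apply/eqP; lia.
Qed.

Hypothesis Q_big : [/\ (10 < Q)%N, (J.+1 < Q)%N, (slots < Q)%N,
  (L < Q)%N & (f < Q)%N /\ (f * b < Q)%N].
(** Eight digits: [hb], [kq] and the six entries of [st_seq]. *)
Hypothesis W_big : (Q ^ 8 <= W)%N.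
Hypotheses (hbQ : (hb < Q)%N) (kqQ : (kq < Q)%N) (slots_gt0 : (0 < slots)%N).

Notation stp := (@step R M' B' K' W' Q J dl b zt hm f f0 L tb hmax).
Notation pdst := (@pdist R M' B' K' W' Q J dl b zt hm f f0 L tb hmax).
Notation vu c := (view_of p c.1).

Lemma node_lt_Q l i : node l i -> (l < Q)%N && (i < Q)%N.
Proof.
case: Q_big => q1 q2 q3 q4 [q5 q6] /and3P[l0 lL].
have [->|ne] := eqVneq l L; first by rewrite /cnt eqxx; lia.
have lL' : (l < L)%N by lia.
move=> il; have := cnt_le lL'; rewrite -tb_cnt; last by rewrite -f0_L; lia.
have : (tb <= slots)%N by rewrite /slots leq_pmulr.
by lia.
Qed.

Lemma wf_fits s ct ps : wf s ct ps -> all (fun x => x < Q)%N (st_seq s).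
Proof.
case: Q_big => q1 q2 q3 q4 [q5 q6] [_ _].
have fb l x : (x <= fan l * b)%N -> (x < Q)%N.
  have : (fan l * b <= f * b)%N by rewrite leq_mul2r fanle orbT.
  by lia.
have fj l x : (x < fan l)%N -> (x < Q)%N by have := fanle l; lia.
case: s => [x|s N|j x|s t x|l i N|l i N|l i d N|l i d j N|l i j N|l i j N|l i j N] /=.
- by case=> _ /fb; lia.
- by case; lia.
- by case=> ? _ /fb; lia.
- by case=> ? ? _ /fb; lia.
- by case=> /node_lt_Q/andP[? ?]; lia.
- by case=> /node_lt_Q/andP[? ?]; lia.
- by case=> /node_lt_Q/andP[? ?] ? /fj ?; lia.
- by case=> /node_lt_Q/andP[? ?] ? /andP[? /fj ?] /fj ?; lia.
- by case=> /node_lt_Q/andP[? ?] ? ? /fj ?; lia.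
- by case=> /node_lt_Q/andP[? ?] ? ? /fj ?; lia.
by case=> /node_lt_Q/andP[? ?] ? /fj ?; lia.
Qed.

Lemma wdK a : (a < Q)%N -> wd a = a :> nat.
Proof.
case: Q_big => q1 *; rewrite inordK // (leq_trans _ W_big) //.
by rewrite (@leq_trans Q) // -{1}(expn1 Q) leq_pexp2l //; lia.
Qed.

Lemma vgetE (c : cfg) a : vget (vu c) a =
  match mget c.1 a with inl v => inl (p v) | inr k => inr k end.
Proof. by rewrite /vget ffunE. Qed.

Lemma lab_vget (c : cfg) fa a : lab_of fa (vget (vu c) a) = lab_of fa (mget c.1 a).
Proof. by rewrite vgetE; case: (mget _ _). Qed.

Lemma pdistE (c : cfg) s ct ps : Inv c s ct ps ->
  pdst (vu c) = stp (vu c) hb kq s.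
Proof.
case=> h0 _ _ /wf_fits hs.
have hall : all (fun x => x < Q)%N [:: hb, kq & st_seq s] by rewrite /= hbQ kqQ.
have hsz : size [:: hb, kq & st_seq s] = 8%N by case: s {hs h0 hall}.
have cW : (code hb kq s < W)%N.
  by apply: leq_trans W_big; rewrite -hsz; exact: enc_lt.
have v0 : vnat (vu c) 0 = code hb kq s.
  by rewrite /vnat vgetE h0 /= inordK.
rewrite /pdist v0.
have dk k : (k < 8)%N -> dec Q k (code hb kq s) = nth 0%N [:: hb, kq & st_seq s] k.
  by move=> k8; apply: dec_enc => //; rewrite hsz.
rewrite !dk //=; congr (stp _ _ _ _).
by rewrite /seq_st !dk //; case: s {hs h0 hall hsz cW v0 dk}.
Qed.

(** * Effect of single rounds on the invariant *)

Definition ready (c : cfg) ct ps x : Prop :=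
  [/\ core c (Some (L, 0%N)) ct ps, shape ct ps, lab_ok (L.+1, 0%N) ct ps,
      x = ps L 0%N & (x <= fan L * b)%N].

Lemma inv_ready c x ct ps : Inv c (Idle x) ct ps -> ready c ct ps x.
Proof. by case=> _ hc _ [h1 h2 [h3 h4]]. Qed.

(** The read position of the root is held in the control state, not in a word next to a child block,
    so changing it leaves the buffers and counters alone. *)
Lemma ready_upd c ct ps x x' : ready c ct ps x -> (x' <= fan L * b)%N ->
  ready c ct (upd2 ps L 0 x') x'.
Proof.
move=> [[hs hr] h1 h2 h3 h4] hx.
have lev l i d : node l i -> upd2 ps L 0 x' l.-1 (i * f + d)%N = ps l.-1 (i * f + d)%N.
  by case/and3P=> l0 lL _; rewrite upd2_other // (_ : l.-1 == L = false) //; lia.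
split=> //.
- split=> // l i d nl df; have := hr l i d nl df.
  by rewrite /inmem1 /ondisk1 lev.
- move=> l i nl; have [? ?] := h1 l i nl; split=> //.
  by rewrite /upd2; case: ifP => // /andP[/eqP-> _].
- move=> l i nl; have := h2 l i nl; rewrite /isanc /= leqNgt ltnS.
  by case/and3P: nl => _ -> _.
by rewrite upd2_same.
Qed.

Definition fin_st x : st := if hb == 0%N then Idle x else HScan 0 x.

Lemma eff_idle c rp x ct ps : ready c ct ps x ->
  Inv (nxt (mk hb kq rp keep (Idle x) (Halt _ _ _)) c) (Idle x) ct ps.
Proof. by move=> [h1 h2 h3 h4 h5]; apply: inv_halt. Qed.

Lemma H_word (c : cfg) j t (j' : 'I_B) : static c.1 c.2 -> (j < hb)%N -> (t < b)%N ->
  minn j' zt = t -> c.2 (bk (tb + j)) j' = hw (hm + j * b + t).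
Proof.
move=> [_ _ h3] jh tb' jz; rewrite h3 //; congr (hw (_ + _)).
by case: zt_cases jz => [[-> _]|[-> -> _]]; lia.
Qed.

Lemma eff_hscan c rp j x ct ps : ready c ct ps x -> (j < hb)%N ->
  Inv (nxt (mk hb kq rp keep (HScan j x) (rdH j)) c) (HScan j x) ct ps.
Proof.
move=> [h1 h2 h3 h4 h5] jh; apply: inv_readz => //.
move=> m' hz t tb'; apply: hz => // j' jz; apply: H_word => //.
by case: h1.
Qed.

Lemma eff_fscan c rp s t x ct ps : ready c ct ps x -> (s < slots)%N -> (t <= J.+1)%N ->
  Inv (nxt (mk hb kq rp keep (FScan s t x) (rdT (s %/ b))) c) (FScan s t x) ct ps.
Proof.
move=> [h1 h2 h3 h4 h5] sm tJ; apply: inv_readz => //.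
move=> m' hz /=; apply: hz; first by rewrite ltn_mod.
have [hst _] := h1; have bt : (s %/ b < tb)%N by rewrite ltn_divLR.
by move=> j jz; rewrite (T_word hst bt (ltn_pmod s b_gt0) jz) -divn_eq.
Qed.

Lemma eff_direct c rp s N ct ps : ready c ct ps 0 -> f0 = 0%N -> (s < slots)%N ->
  (N <= J)%N ->
  Inv (nxt (mk hb kq rp keep (Direct s N) (rdT (s %/ b))) c) (Direct s N) ct ps.
Proof.
move=> [h1 h2 h3 h4 h5] f00 sm NJ; apply: inv_readz => //.
move=> m' hz /=; apply: hz; first by rewrite ltn_mod.
have [hst _] := h1; have bt : (s %/ b < tb)%N by rewrite ltn_divLR.
by move=> j jz; rewrite (T_word hst bt (ltn_pmod s b_gt0) jz) -divn_eq.
Qed.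

Lemma eff_root_label c rp N x ct ps : ready c ct ps x -> (0 < f0)%N -> (N <= J)%N ->
  Inv (nxt (mk hb kq rp keep (Label L 0 N) (rdT 0)) c) (Label L 0 N) ct
    (upd2 ps L 0 0).
Proof.
move=> hr f0p NJ; have [h1 h2 h3 h4 h5] := ready_upd hr (leq0n _).
apply: inv_readz => //; split=> //=; first by rewrite div0n.
by split=> //; rewrite /node -f0_L in f0p *; rewrite f0p leqnn /cnt eqxx.
Qed.

Lemma P_word c l i ct ps j : core c (Some (l, i)) ct ps -> node l i ->
  (j < fan l * b)%N -> mget c.1 (pb + j) = nth nullw (ct l i) j.
Proof.
move=> [_ hr] nl jl; have df : (j %/ b < fan l)%N by rewrite ltn_divLR.
have := hr l i _ nl df; rewrite eqxx => -[H _].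
by have := H (j %% b)%N; rewrite -addnA -divn_eq ltn_mod b_gt0; apply.
Qed.

Lemma P_words c l i ct ps : core c (Some (l, i)) ct ps -> node l i -> shape ct ps ->
  [seq mget c.1 a | a <- iota pb (fan l * b)] = ct l i.
Proof.
move=> hc nl hs; have [sz _] := hs l i nl.
apply: (@eq_from_nth _ nullw); rewrite size_map size_iota ?sz // => j jl.
by rewrite (nth_map 0%N) ?size_iota // nth_iota // (P_word hc nl).
Qed.

Lemma lab_pwords c l i ct ps fa : core c (Some (l, i)) ct ps -> node l i ->
  shape ct ps ->
  [seq lab_of fa w | w <- pwords b zt hm f f0 L (vu c) l] =
  [seq lab_of fa w | w <- ct l i].
Proof.
move=> hc nl hs; rewrite /pwords -(P_words hc nl hs) -!map_comp.
by apply: eq_map => a /=; rewrite lab_vget.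
Qed.

Lemma lmask_pwords c l i ct ps d : core c (Some (l, i)) ct ps -> node l i ->
  shape ct ps ->
  lmask (@lab_of W R (fan l)) d (pwords b zt hm f f0 L (vu c) l) =
  lmask (@lab_of W S (fan l)) d (ct l i).
Proof.
move=> hc nl hs; have := lab_pwords (fan l) hc nl hs.
move/(congr1 (map (fun o => o == Some d))).
by rewrite /lmask -!map_comp.
Qed.

Lemma first_labelE (A : Type) fa (ws : seq (A + 'I_W)) :
  first_label fa ws = ohead (pmap id [seq lab_of fa w | w <- ws]).
Proof.
rewrite /first_label; congr ohead; elim: ws => //= w ws ->.
by case: (lab_of fa w).
Qed.

Lemma first_label_pwords c l i ct ps : core c (Some (l, i)) ct ps -> node l i ->
  shape ct ps ->
  first_label (fan l) (pwords b zt hm f f0 L (vu c) l) =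
  first_label (fan l) (ct l i).
Proof. by move=> hc nl hs; rewrite !first_labelE (lab_pwords _ hc nl hs). Qed.

Lemma first_label_some fa (ws : seq wordT) d : first_label fa ws = Some d ->
  (d < fa)%N /\ (0 < count id (lmask (@lab_of W S fa) d ws))%N.
Proof.
rewrite /first_label; elim: ws => //= w ws IH.
case lw : (lab_of fa w) => [e|] /=; last by move/IH.
case=> <-; rewrite eqxx; split=> //; move: lw; rewrite /lab_of.
by case: w => // k; case: ifP => // kf [<-].
Qed.

Lemma first_label_none l (ws : seq wordT) :
  first_label (fan l) ws = None -> nolab l ws.
Proof.
rewrite /first_label /nolab; elim: ws => //= w ws IH.
by case: (lab_of (fan l) w).
Qed.

Lemma isanc_step l i l' i' : (0 < f)%N -> isanc (l, i) l' i' =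
  ((l' == l) && (i' == i)) || isanc (l.+1, i %/ f)%N l' i'.
Proof.
move=> f1; rewrite /isanc /=; case: (ltngtP l l') => [h|h|->] //=.
  by rewrite -divnMA -expnS subnSK.
by rewrite subnn expn0 divn1 eq_sym orbF.
Qed.

Lemma isanc_low l i l' i' : (l' < l)%N -> isanc (l, i) l' i' = false.
Proof. by move=> h; rewrite /isanc /= leqNgt h. Qed.

Definition mklab (d : nat) : wordT := inr (wd d).

Lemma lab_mklab fa d : (d < fa)%N -> (fa <= f)%N -> lab_of fa (mklab d) = Some d.
Proof.
by case: Q_big => _ _ _ _ [q5 _] df ff; rewrite /lab_of /= wdK ?df //; lia.
Qed.

Lemma refillE m l res a : (pb <= a < pb + fan l * b)%N -> size res = (fan l * b)%N ->
  srcval m (refill b zt hm f f0 L l res a) =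
  nth nullw [seq srcval m y | y <- res] (a - pb).
Proof.
move=> h sz; rewrite /refill h (nth_map (inl a)) // sz; lia.
Qed.

Lemma P_range d l t : (d < fan l)%N -> (t < b)%N ->
  (pb <= pb + d * b + t < pb + fan l * b)%N /\ (pb + d * b + t != cb + d)%N.
Proof.
move=> df tb'; have h := leq_div_add_mul tb' df.
have : (fan l * b <= f * b)%N by rewrite leq_mul2r fanle orbT.
by split; [lia | apply/eqP; rewrite /cb; lia].
Qed.

Lemma eff_label c l i N ct ps ds : Inv c (Label l i N) ct ps ->
  size ds = (fan l * b)%N -> all (fun d => d < fan l)%N ds ->
  Inv (nxt (mk hb kq [::] (refill b zt hm f f0 L l [seq inr d | d <- ds])
              (Gather l i N) (rdT 0)) c) (Gather l i N)
      (upd2 ct l i (map mklab ds)) ps.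
Proof.
move=> [_ hc _ [h1 h2 [nl NJ p0]]] sz al.
have f1 := f_gt0 (node_pos nl).
have nP a : (a < pb)%N || (pb + fan l * b <= a)%N ->
   refill b zt hm f f0 L l [seq inr d | d <- ds] a = inl a.
  by rewrite /refill => h; rewrite ifF //; lia.
apply: (inv_change hc nl) => //.
- by move=> a /andP[_ h]; apply: nP; rewrite h.
- move=> d df; split=> [t tb'|].
    have [r1 r2] := P_range df tb'.
    rewrite refillE ?size_map // upd2_same -map_comp.
    by rewrite (_ : (_ - _)%N = d * b + t)%N //; lia.
  have [_ hr] := hc; have := hr l i d nl df; rewrite eqxx => -[_ H].
  rewrite nP //= ?H //; have : (fan l * b <= f * b)%N by rewrite leq_mul2r fanle orbT.
  by rewrite /cb; lia.
- by move=> l' i'; apply: upd2_other.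
split=> //.
- move=> l' i' nl'; have [? ?] := h1 l' i' nl'; split=> //.
  by rewrite /upd2; case: ifP => // /andP[/eqP-> _]; rewrite size_map.
- move=> l' i' nl'; have := h2 l' i' nl'.
  rewrite /= [isanc (l, i) l' i']isanc_step //.
  case: (boolP ((l' == l) && (i' == i))) => [/andP[/eqP-> /eqP->] //|ne] /=.
  by rewrite upd2_other.
Qed.

Lemma eff_gather_take1 c i d N ct ps : Inv c (Gather 1 i N) ct ps ->
  first_label (fan 1) (ct 1%N i) = Some d ->
  Inv (nxt (mk hb kq [::] keep (Take 1 i d N) (rdT (i * f + d))) c)
    (Take 1 i d N) ct ps.
Proof.
move=> [_ hc _ [h1 h2 [nl NJ]]] /first_label_some[df cd].
apply: inv_readz => // m' hz t tb'; apply: hz => // j jz.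
have [hst _] := hc; rewrite (@T_word _ (i * f + d) t _ hst) //.
by rewrite tb_cnt -?f0_L ?(node_pos nl) //; exact: (cnt_child nl).
Qed.

Lemma eff_gather_take c l i d N ct ps : Inv c (Gather l i N) ct ps -> (1 < l)%N ->
  first_label (fan l) (ct l i) = Some d ->
  (ps l.-1 (i * f + d) < fan l.-1 * b)%N ->
  Inv (nxt (mk hb kq [::] keep (Take l i d N)
     (rdA l.-2 ((i * f + d) * f + ps l.-1 (i * f + d) %/ b))) c)
    (Take l i d N) ct ps.
Proof.
move=> [_ hc _ [h1 h2 [nl NJ]]] l1 /first_label_some[df cd] px.
have L0 := node_pos nl; have [zb bB] := zt_b L0.
have nc := node_child nl l1 df.
apply: inv_readz => //.
  split=> //; split=> // _.
  by apply: leq_trans px _; rewrite leq_mul2r fanle orbT.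
move=> m' hz t tb'; rewrite (_ : (l == 1%N) = false); last by lia.
apply: hz => // j jz.
have qf : (ps l.-1 (i * f + d) %/ b < fan l.-1)%N by rewrite ltn_divLR.
have [_ hr] := hc; have := hr _ _ _ nc qf.
rewrite (_ : (_ == _) = false); last by apply/eqP => -[]; lia.
case=> H _; rewrite -(H t tb'); congr (_ _); apply: val_inj => /=.
rewrite inordK; last by lia.
by move: jz; rewrite zb; lia.
Qed.

Lemma eff_gather_down c l i d N ct ps : Inv c (Gather l i N) ct ps -> (1 < l)%N ->
  first_label (fan l) (ct l i) = Some d ->
  Inv (nxt (mk hb kq [::] (setc b zt hm f keep d 0) (SaveD l i d 0 N) (rdT 0)) c)
    (SaveD l i d 0 N) ct (upd2 ps l.-1 (i * f + d) 0).
Proof.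
move=> [_ hc _ [h1 h2 [nl NJ]]] l1 /first_label_some[df cd].
have df' := leq_trans df (fanle l).
have cbE : cb = (pb + f * b)%N by [].
have nc a : a != (cb + d)%N -> setc b zt hm f keep d 0 a = inl a.
  by rewrite /setc => /negPf->.
have [_ hr] := hc.
apply: (inv_change hc nl) => //.
- by move=> a h; apply: nc; apply/eqP; lia.
- move=> d' df2; have := hr l i d' nl df2; rewrite eqxx => -[H1 H2].
  split=> [t tb'|].
    have [r1 r2] := P_range df2 tb'; rewrite nc /= ?H1 //.
    have h := leq_div_add_mul tb' (leq_trans df2 (fanle l)).
    by apply/eqP; lia.
  rewrite /upd2 eqxx /= eqn_add2l /setc eqn_add2l; by case: (d' =P d).
- move=> l' i' d' nl' ne df2; rewrite upd2_other //.
  apply: contra ne => /andP[/eqP e1 /eqP e2].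
  have -> : l' = l by case/and3P: nl'; case/and3P: nl; lia.
  rewrite eqxx /= -(node_child_parent i' (leq_trans df2 (fanle _))) e2.
  by rewrite node_child_parent.
split=> //=.
- move=> l' i' nl'; have [? ?] := h1 l' i' nl'; split=> //.
  by rewrite /upd2; case: ifP.
- move=> l' i' nl'; have := h2 l' i' nl'; case: ifP => //.
  by rewrite /upd2 => _; case: ifP.
by rewrite l1 df upd2_same; split=> //; lia.
Qed.

Lemma eff_gather_up c l i N ct ps : Inv c (Gather l i N) ct ps ->
  first_label (fan l) (ct l i) = None -> (l < L)%N ->
  Inv (nxt (mk hb kq [::] keep (SaveU l i 0 N) (rdT 0)) c) (SaveU l i 0 N) ct ps.
Proof.
move=> [_ hc _ [h1 h2 [nl NJ]]] /first_label_none nlb lL.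
have f1 := f_gt0 (node_pos nl).
apply: inv_readz => //; split=> //=; last by split=> //; rewrite fan_lt.
move=> l' i' nl'; have := h2 l' i' nl'; rewrite [anc0 _]/= isanc_step //.
case: (boolP ((l' == l) && (i' == i))) => [/andP[/eqP-> /eqP->] _|_] //=.
by rewrite isanc_low.
Qed.

Lemma gather_ready c N ct ps : Inv c (Gather L 0 N) ct ps ->
  first_label (fan L) (ct L 0%N) = None -> ready c ct ps 0.
Proof.
move=> [_ hc _ [h1 h2 [nl NJ]]] /first_label_none nlb.
have f1 := f_gt0 (node_pos nl).
have p0 : ps L 0%N = 0%N.
  by have := h2 L 0%N nl; rewrite /isanc /= leqnn subnn expn0 divn1 eqxx.
split=> // l' i' nl'; have := h2 l' i' nl'; rewrite [anc0 _]/= isanc_step // div0n.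
case: (boolP ((l' == L) && (i' == 0%N))) => [/andP[/eqP-> /eqP->] _|_] //=.
by rewrite isanc_low.
Qed.

Lemma eff_take1 c i d N ct ps ts : Inv c (Take 1 i d N) ct ps ->
  size ts = (fan 1 * b)%N -> all (fun t => t < b)%N ts ->
  Inv (nxt (mk hb kq [::] (refill b zt hm f f0 L 1
         (fillm (lmask (@lab_of W R (fan 1)) d (pwords b zt hm f f0 L (vu c) 1))
            [seq keep (1 + t)%N | t <- ts] [seq keep a | a <- iota pb (fan 1 * b)]))
         (Gather 1 i N) (rdT 0)) c) (Gather 1 i N)
    (upd2 ct 1 i (fillm (lmask (@lab_of W S (fan 1)) d (ct 1%N i))
       [seq Tw ((i * f + d) * b + t) | t <- ts] (ct 1%N i))) ps.
Proof.
move=> [_ hc hz [h1 h2 [nl NJ df cd _]]] sz al.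
rewrite (lmask_pwords _ hc nl h1); set mask := lmask _ _ _.
set res := fillm mask _ _.
have szr : size res = (fan 1 * b)%N by rewrite size_fillm size_map size_iota.
have hres : [seq srcval c.1 y | y <- res] =
    fillm mask [seq Tw ((i * f + d) * b + t) | t <- ts] (ct 1%N i).
  rewrite map_fillm -!map_comp; congr fillm; last exact: (P_words hc nl h1).
  by apply/eq_in_map => t /(allP al) tb'; exact: (hz t tb').
have nP a : (a < pb)%N || (pb + fan 1 * b <= a)%N ->
   refill b zt hm f f0 L 1 res a = inl a.
  by rewrite /refill => h; rewrite ifF //; lia.
apply: (inv_change hc nl) => //.
- by move=> a /andP[_ h]; apply: nP; rewrite h.
- move=> d' df2; split=> [t tb'|].
    have [r1 r2] := P_range df2 tb'.
    rewrite refillE // upd2_same hres.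
    by rewrite (_ : (_ - _)%N = d' * b + t)%N //; lia.
  have [_ hr] := hc; have := hr 1%N i d' nl df2; rewrite eqxx => -[_ H].
  rewrite nP //= ?H //; have : (fan 1 * b <= f * b)%N by rewrite leq_mul2r fanle orbT.
  by rewrite /cb; lia.
- by move=> l' i'; apply: upd2_other.
split=> //.
  move=> l' i' nl'; have [? ?] := h1 l' i' nl'; split=> //.
  rewrite /upd2; case: ifP => // /andP[/eqP-> _]; rewrite size_fillm.
  by have [] := h1 1%N i nl.
move=> l' i' nl'; have := h2 l' i' nl'; rewrite [anc0 _]/=.
case: ifP => // nanc; rewrite upd2_other //.
apply: contraFN nanc => /andP[/eqP-> /eqP->].
by rewrite /isanc leqnn subnn expn0 divn1 eqxx.
Qed.

(** Only the block containing the read position of the child is loaded, so at most the rest of that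
    block can be taken at once. *)
Definition take_count l i d ct (ps : nat -> nat -> nat) : nat :=
  minn (b - ps l.-1 (i * f + d)%N %% b)
    (count id (lmask (@lab_of W S (fan l)) d (ct l i))).

Definition take_items l i d (ct : nat -> nat -> seq wordT) ps : seq wordT :=
  take (take_count l i d ct ps)
    (drop (ps l.-1 (i * f + d)%N) (ct l.-1 (i * f + d)%N)).

Lemma take_count_le l i d N ct ps : wf (Take l i d N) ct ps -> (1 < l)%N ->
  (ps l.-1 (i * f + d) + take_count l i d ct ps <= f * b)%N /\
  size (ct l.-1 (i * f + d)%N) = (f * b)%N.
Proof.
move=> [h1 _ [nl NJ df cd px]] l1; have nc := node_child nl l1 df.
have lL : (l.-1 < L)%N by case/and3P: nl; lia.
have [sz _] := h1 _ _ nc; rewrite fan_lt // in sz; split=> //.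
have := px l1; rewrite /take_count; set x := ps _ _ => xb.
have -> : (x = x %/ b * b + x %% b)%N by exact: divn_eq.
have : ((x %/ b).+1 * b <= f * b)%N by rewrite leq_mul2r ltn_divLR // xb orbT.
have := ltn_pmod x b_gt0; rewrite mulSn modnMDl modn_mod.
by lia.
Qed.

Lemma eff_take c l i d N ct ps : Inv c (Take l i d N) ct ps -> (1 < l)%N ->
  let x := ps l.-1 (i * f + d)%N in let k := take_count l i d ct ps in
  vnat (vu c) (cb + d) = x /\
  Inv (nxt (mk hb kq [::] (setc b zt hm f (refill b zt hm f f0 L l
         (fillm (lmask (@lab_of W R (fan l)) d (pwords b zt hm f f0 L (vu c) l))
            [seq keep a | a <- iota (1 + x %% b) k]
            [seq keep a | a <- iota pb (fan l * b)])) d (x + k))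
         (Gather l i N) (rdT 0)) c) (Gather l i N)
    (upd2 ct l i (fillm (lmask (@lab_of W S (fan l)) d (ct l i))
       (take_items l i d ct ps) (ct l i)))
    (upd2 ps l.-1 (i * f + d) (x + k)).
Proof.
move=> hI l1 x k; have [_ hc hz hwf] := hI; have [h1 h2 [nl NJ df cd px]] := hwf.
have [xk szc] := take_count_le hwf l1.
have df' := leq_trans df (fanle l).
case: Q_big => q1 q2 q3 q4 [q5 q6].
have [_ hr] := hc; have := hr l i d nl df; rewrite eqxx => -[_ Hd].
split; first by rewrite /vnat vgetE Hd /= wdK //; lia.
rewrite (lmask_pwords _ hc nl h1); set mask := lmask _ _ _.
set res := fillm mask _ _.
have szr : size res = (fan l * b)%N by rewrite size_fillm size_map size_iota.
have xm := ltn_pmod x b_gt0.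
have hres : [seq srcval c.1 y | y <- res] =
    fillm mask (take_items l i d ct ps) (ct l i).
  rewrite map_fillm -!map_comp; congr fillm; last exact: (P_words hc nl h1).
  have szt : size (take_items l i d ct ps) = k.
    rewrite size_takel // size_drop szc -/x -/k.
    by move: xk; rewrite -/x -/k; lia.
  apply: (@eq_from_nth _ nullw); rewrite size_map size_iota ?szt // => r rk.
  have kb : (k <= b - x %% b)%N by rewrite geq_minl.
  rewrite (nth_map 0%N) ?size_iota // nth_iota //= -addnA hz; last by lia.
  rewrite (_ : (l == 1%N) = false); last by lia.
  by rewrite nth_take // nth_drop addnA -/x -divn_eq.
have cbE : cb = (pb + f * b)%N by [].
have fb : (fan l * b <= f * b)%N by rewrite leq_mul2r fanle orbT.
have nP a : (a < pb)%N || (pb + fan l * b <= a)%N -> a != (cb + d)%N ->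
   setc b zt hm f (refill b zt hm f f0 L l res) d (x + k) a = inl a.
  by rewrite /setc => h /negPf->; rewrite /refill ifF //; lia.
apply: (inv_change hc nl) => //.
- by move=> a /andP[_ h]; apply: nP; [rewrite h | apply/eqP; lia].
- move=> d' df2; have df2' := leq_trans df2 (fanle l); split=> [t tb'|].
    have [r1 r2] := P_range df2 tb'.
    rewrite /setc ifF; last by apply/eqP; have := leq_div_add_mul tb' df2; lia.
    rewrite refillE // upd2_same hres.
    by rewrite (_ : (_ - _)%N = d' * b + t)%N //; lia.
  have := hr l i d' nl df2; rewrite eqxx => -[_ H].
  rewrite /upd2 eqxx /= eqn_add2l; case: (d' =P d) => [->|/eqP ne].
    by rewrite /setc eqxx.
  by rewrite nP /= ?H // ?eqn_add2l //; lia.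
- by move=> l' i'; apply: upd2_other.
- move=> l' i' d' nl' ne df2; rewrite upd2_other //.
  apply: contra ne => /andP[/eqP e1 /eqP e2].
  have -> : l' = l by case/and3P: nl'; case/and3P: nl; lia.
  rewrite eqxx /= -(node_child_parent i' (leq_trans df2 (fanle _))) e2.
  by rewrite node_child_parent.
split=> //=.
- move=> l' i' nl'; have [s1 s2] := h1 l' i' nl'; split.
    rewrite /upd2; case: ifP => // /andP[/eqP-> _]; rewrite size_fillm.
    by have [] := h1 l i nl.
  rewrite /upd2; case: ifP => // /andP[/eqP e1 _].
  by rewrite e1 fan_lt //; case/and3P: nl; lia.
move=> l' i' nl'; have := h2 l' i' nl'; rewrite [anc0 _]/=.
case: ifP => nanc.
  rewrite upd2_other //; apply/negP => /andP[/eqP e1 _].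
  by rewrite e1 isanc_low // in nanc; lia.
rewrite upd2_other //.
apply: contraFN nanc => /andP[/eqP-> /eqP->].
by rewrite /isanc leqnn subnn expn0 divn1 eqxx.
Qed.

Lemma eff_saved c l i d j N ct ps : Inv c (SaveD l i d j N) ct ps ->
  let s' := if (j.+1 < fan l)%N then SaveD l i d j.+1 N
            else RestD l.-1 (i * f + d) 0 N in
  Inv (nxt (mk hb kq [::] keep s' (wrP l i j)) c) s' ct ps.
Proof.
move=> [_ hc hz hwf] s'; have [h1 h2 [nl NJ /andP[l1 df] jf p0]] := hwf.
have df' := leq_trans df (fanle l).
have lL : (l.-1 < L)%N by case/and3P: nl; lia.
have wf' : wf s' ct ps.
  rewrite /s'; case: ltnP => hj; first by split=> //; split=> //; apply/andP.
  split=> //=; first by rewrite node_child_parent // prednK; [|lia].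
  split=> //; first exact: node_child.
  by rewrite fan_lt //; lia.
have [E1 E2 E3 E4] := inv_save_next hc nl jf hz wf' (erefl : curs (SaveD l i d j N) = _).
have [hj|hj] := ltnP j.+1 (fan l).
  have Es : s' = SaveD l i d j.+1 N by rewrite /s' hj.
  by clearbody s'; rewrite Es in E1 E2 E3 E4 wf' *; split.
have Es : s' = RestD l.-1 (i * f + d) 0 N by rewrite /s' ltnNge hj.
clearbody s'; rewrite Es in E1 E2 E3 E4 wf' *; split=> //.
split=> // l' i' d' nl' df2 /=; have := E3 l' i' d' nl' df2.
case: (Some (l, i) =P Some (l', i')) => [[e1 e2] _|//]; subst l' i'.
by apply: E4; apply: leq_trans df2 hj.
Qed.

Lemma eff_saveu c l i j N ct ps : Inv c (SaveU l i j N) ct ps ->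
  let s' := if (j.+1 < fan l)%N then SaveU l i j.+1 N
            else RestU l.+1 (i %/ f) 0 N in
  Inv (nxt (mk hb kq [::] keep s' (wrP l i j)) c) s' ct ps.
Proof.
move=> [_ hc hz hwf] s'; have [h1 h2 [nl NJ lL jf]] := hwf.
have np := node_parent nl lL.
have wf' : wf s' ct ps.
  rewrite /s'; case: ltnP => hj; first by split=> //; split.
  by split=> //=; split=> //; rewrite fan_gt0 //; [exact: (f_gt0 (node_pos nl)) | rewrite -f0_L; exact: node_pos nl].
have [E1 E2 E3 E4] := inv_save_next hc nl jf hz wf' (erefl : curs (SaveU l i j N) = _).
have [hj|hj] := ltnP j.+1 (fan l).
  have Es : s' = SaveU l i j.+1 N by rewrite /s' hj.
  by clearbody s'; rewrite Es in E1 E2 E3 E4 wf' *; split.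
have Es : s' = RestU l.+1 (i %/ f) 0 N by rewrite /s' ltnNge hj.
clearbody s'; rewrite Es in E1 E2 E3 E4 wf' *; split=> //.
split=> // l' i' d' nl' df2 /=; have := E3 l' i' d' nl' df2.
case: (Some (l, i) =P Some (l', i')) => [[e1 e2] _|//]; subst l' i'.
by apply: E4; apply: leq_trans df2 hj.
Qed.

Lemma rest_core c s' l i j ct ps :
  core c None ct ps -> node l i -> (j < fan l)%N ->
  (forall d, (d < j)%N -> inmem1 ct ps c.1 l i d) -> (fan l <= j.+1)%N ->
  core (nxt (mk hb kq [::] keep s' (rdP l i j)) c) (Some (l, i)) ct ps.
Proof.
move=> hc nl jf hd hj; have [E1 E2 E3 E4] := inv_rest_next s' hc nl jf hd.
split=> // l' i' d' nl' df2; have := E3 l' i' d' nl' df2.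
case: (Some (l, i) =P Some (l', i')) => [[e1 e2] _|//]; subst l' i'.
by apply: E4; apply: leq_trans df2 hj.
Qed.

Lemma eff_restd c l i j N ct ps : Inv c (RestD l i j N) ct ps ->
  let s' := if (j.+1 < fan l)%N then RestD l i j.+1 N else Label l i N in
  Inv (nxt (mk hb kq [::] keep s' (rdP l i j)) c) s' ct ps.
Proof.
move=> [_ hc hz hwf] s'; have [h1 h2 [nl NJ lL jf p0]] := hwf.
have wf' : wf s' ct ps by rewrite /s'; case: ltnP => hj; split.
have [E1 E2 E3 E4] := inv_rest_next s' hc nl jf hz.
have [hj|hj] := ltnP j.+1 (fan l).
  have Es : s' = RestD l i j.+1 N by rewrite /s' hj.
  by clearbody s'; rewrite Es in E1 E2 E3 E4 wf' *; split.
have Es : s' = Label l i N by rewrite /s' ltnNge hj.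
clearbody s'; rewrite Es in E1 E2 E3 E4 wf' *; split=> //.
exact: rest_core.
Qed.

Lemma eff_restu c l i j N ct ps : Inv c (RestU l i j N) ct ps ->
  let s' := if (j.+1 < fan l)%N then RestU l i j.+1 N else Gather l i N in
  Inv (nxt (mk hb kq [::] keep s' (rdP l i j)) c) s' ct ps.
Proof.
move=> [_ hc hz hwf] s'; have [h1 h2 [nl NJ jf]] := hwf.
have wf' : wf s' ct ps by rewrite /s'; case: ltnP => hj; split.
have [E1 E2 E3 E4] := inv_rest_next s' hc nl jf hz.
have [hj|hj] := ltnP j.+1 (fan l).
  have Es : s' = RestU l i j.+1 N by rewrite /s' hj.
  by clearbody s'; rewrite Es in E1 E2 E3 E4 wf' *; split.
have Es : s' = Gather l i N by rewrite /s' ltnNge hj.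
clearbody s'; rewrite Es in E1 E2 E3 E4 wf' *; split=> //.
exact: rest_core.
Qed.

(** * Amortized cost *)

Hypothesis f_ge2 : (0 < L)%N -> (1 < f)%N.
Hypothesis small_b : f0 = 0%N -> b = 1%N.

(** Price of one sample delivered at level [l], in units of [1 / b] I/Os; [rank_gather_down] shows
    where 10 comes from. *)
Definition wgt (l : nat) : nat := (10 * l)%N.
Definition wN : nat := if f0 == 0%N then 1%N else wgt L.
(** The consumed samples of a node save up for its next refill. The term [2 * (x %% b)] is released
    when the reader leaves a block and helps to pay the two rounds of an access. *)
Definition own (l x : nat) : nat := (wgt l * x + 2 * (x %% b))%N.
Definition lcount l d (s : seq wordT) : nat :=
  count id (lmask (@lab_of W S (fan l)) d s).
(** Reserve for [q] labels of one child: the price of the samples, 2 more for each, and [2 * b] for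
    the last access, which may stop inside a block. *)
Definition pend1 (l q : nat) : nat :=
  ((wgt l.-1 + 2) * q + 2 * b * (0 < q))%N.
Definition pend l (s : seq wordT) : nat := (\sum_(d < fan l) pend1 l (lcount l d s))%N.
Definition nodeSum (h : nat -> nat -> nat) : nat :=
  (\sum_(l < L.+1) \sum_(i < cnt l) (if l == 0 :> nat then 0 else h l i))%N.
Definition Phi (ps : nat -> nat -> nat) : nat :=
  nodeSum (fun l i => if l == L then 0%N else own l (ps l i)).
Definition Pend (ct : nat -> nat -> seq wordT) : nat :=
  nodeSum (fun l i => pend l (ct l i)).
(** Pays for the way back to the root: per level one idle round, one save and one reload of at most
    [f] blocks each. *)
Definition credit l : nat := ((L - l) * ((2 * f + 2) * b))%N.
(** Bound on [pend] for a freshly labelled node, plus its return to the parent. *)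
Definition freshc l : nat :=
  ((wgt l.-1 + 2) * (fan l * b) + 2 * b * fan l +
   (if l == L then 0 else (2 * f + 2) * b))%N.

(* Upper bound, in units of [1 / b] I/Os, on the remaining cost of the current
   query plus the potential of the final configuration. *)
Definition rank (s : st) ct ps : nat :=
  (Phi ps + Pend ct +
  match s with
  | Idle x => wgt L * x
  | Direct _ N => wN * N + b * hb
  | HScan j x => wgt L * x + b * (hb - j.+1)
  | FScan s _ x => wgt L * x + b * (slots - s.+1) + b * hb
  | Label l _ N => credit l.+1 + freshc l + b + wN * N + b * hb
  | Gather l _ N => credit l + wN * N + b * hb
  | Take l _ _ N => credit l + wN * N + b * hb
  | SaveD l _ _ j N =>
      credit l + freshc l.-1 + b + f * b + (fan l - j) * b + wN * N + b * hb
  | SaveU l _ j N => credit l.+1 + f * b + (fan l - j) * b + wN * N + b * hb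
  | RestD l _ j N =>
      credit l.+1 + freshc l + b + (fan l - j) * b + wN * N + b * hb
  | RestU l _ j N => credit l + (fan l - j) * b + wN * N + b * hb
  end - (if s is Take _ _ _ _ then b else 0))%N.

Lemma nodeSum_upd h h' l i : node l i ->
  (forall l' i', ~~ ((l' == l) && (i' == i)) -> h l' i' = h' l' i') ->
  (nodeSum h + h' l i = nodeSum h' + h l i)%N.
Proof.
case/and3P=> l0 lL il H; have lL' : (l < L.+1)%N by rewrite ltnS.
rewrite /nodeSum (bigD1 (Ordinal lL')) //= [X in (_ = X + _)%N](bigD1 (Ordinal lL')) //=.
rewrite (bigD1 (Ordinal il)) //= [X in (_ = X + _ + _)%N](bigD1 (Ordinal il)) //=.
rewrite (_ : (l == 0%N) = false); last by lia.
set A := (\sum_(j < cnt l | j != Ordinal il) h l j)%N.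
set A' := (\sum_(j < cnt l | j != Ordinal il) h' l j)%N.
set C := (\sum_(k < L.+1 | k != Ordinal lL') _)%N.
set C' := (\sum_(k < L.+1 | k != Ordinal lL') _)%N.
have -> : A = A'.
  by apply: eq_bigr => j ne; apply: H; rewrite eqxx; exact: ne.
have -> : C = C'.
  apply: eq_bigr => k ne; apply: eq_bigr => j _; case: ifP => // _; apply: H.
  by rewrite negb_and (_ : (k != l :> nat) = true) //; exact: ne.
by lia.
Qed.

Lemma lcount_le l d s : (lcount l d s <= size s)%N.
Proof. by rewrite /lcount (leq_trans (count_size _ _)) // size_map. Qed.

Lemma sum_lcount_le l s : (\sum_(d < fan l) lcount l d s <= size s)%N.
Proof.
rewrite /lcount /lmask; elim: s => [|w s IH] /=; first by rewrite big1.
rewrite big_split /= -[(size s).+1]add1n leq_add //.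
case lw: (lab_of (fan l) w) => [e|]; last by rewrite big1.
have ef : (e < fan l)%N.
  by move: lw; rewrite /lab_of; case: w => // k; case: ifP => // kf [<-].
rewrite (bigD1 (Ordinal ef)) //= eqxx big1 ?addn0 // => d ne.
by case: eqP => // -[e1]; case/eqP: ne; apply: val_inj.
Qed.

Lemma pend_label l ds : size ds = (fan l * b)%N ->
  (pend l ds <= (wgt l.-1 + 2) * (fan l * b) + 2 * b * fan l)%N.
Proof.
move=> sz; rewrite /pend /pend1 big_split /= -!big_distrr /= leq_add //.
  by rewrite leq_mul2l -sz sum_lcount_le orbT.
rewrite leq_mul2l; apply/orP; right.
rewrite -[X in (_ <= X)%N]card_ord -sum1_card; apply: leq_sum => d _.
by case: (0 < _)%N.
Qed.

Lemma pend_fill l d ys s : (d < fan l)%N ->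
  (forall y, List.In y ys -> lab_of (fan l) y = None) ->
  (pend l (fillm (lmask (@lab_of W S (fan l)) d s) ys s) + pend1 l (lcount l d s) =
   pend l s + pend1 l (lcount l d s - minn (size ys) (lcount l d s)))%N.
Proof.
move=> df Hy; rewrite /pend (bigD1 (Ordinal df)) //=.
rewrite [X in (_ = X + _)%N](bigD1 (Ordinal df)) //= /lcount count_fillm // eqxx.
rewrite (eq_bigr (fun e : 'I_(fan l) => pend1 l (lcount l e s))); first by rewrite /lcount; lia.
move=> e ne; rewrite /lcount count_fillm // (_ : (e == d :> nat) = false) ?subn0 //.
exact: negbTE.
Qed.

(** The [- b] in the [rank] of [Take] accounts for the first of the two rounds of an access; this
    bound makes that truncated subtraction exact. *)
Lemma Pend_ge l i d ct : node l i -> (d < fan l)%N -> (0 < lcount l d (ct l i))%N ->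
  (2 * b <= Pend ct)%N.
Proof.
move=> nl df h; have := @nodeSum_upd (fun l i => pend l (ct l i))
  (upd2 (fun l i => pend l (ct l i)) l i 0%N) l i nl.
rewrite upd2_same addn0 /Pend => ->; last by move=> l' i' ne; rewrite upd2_other.
rewrite /pend (bigD1 (Ordinal df)) //= /pend1 h muln1; lia.
Qed.

Definition isIdle (s : st) : bool := if s is Idle _ then true else false.

Definition leaf (c : cfg) (rk : nat) (a : act) : Prop :=
  exists s ct ps, [/\ Inv (nxt a c) s ct ps, is_halt a.2 = isIdle s &
    (rank s ct ps + (~~ isIdle s) * b <= rk)%N].

(** The root is left out of [Phi], because its consumed part is charged as [wgt L * x] in [rank]. *)
Lemma Phi_root ps x : Phi (upd2 ps L 0 x) = Phi ps.
Proof.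
apply: eq_bigr => l _; apply: eq_bigr => i _; case: ifP => // _.
by case: eqP => // ne; rewrite upd2_other // (introF eqP ne).
Qed.

Lemma rank_fin ct ps x :
  (rank (fin_st x) ct ps + (~~ isIdle (fin_st x)) * b <=
   Phi ps + Pend ct + wgt L * x + b * hb)%N.
Proof.
rewrite /fin_st /rank; case: eqP => /= h; first by rewrite h; lia.
have : (b * hb = b * (hb - 1) + b)%N by rewrite -mulnSr; congr muln; lia.
by lia.
Qed.

Lemma rank_draw_fin ct ps x N : (N <= fan L * b - x)%N ->
  (rank (fin_st (x + N)) ct (upd2 ps L 0 (x + N)) +
     (~~ isIdle (fin_st (x + N))) * b <=
   Phi ps + Pend ct + wgt L * x + wN * N + b * hb)%N.
Proof.
move=> h; apply: leq_trans (rank_fin _ _ _) _; rewrite Phi_root mulnDr.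
suff : (wgt L * N <= wN * N)%N by lia.
rewrite /wN; case: eqP => // e; move: h; rewrite fanL e mul0n sub0n leqn0 => /eqP->.
by rewrite !muln0.
Qed.

Lemma rank_root_label ct ps x N : (0 < f0)%N -> (x <= fan L * b)%N ->
  (fan L * b - x < N)%N ->
  (rank (Label L 0 (N - (fan L * b - x))) ct (upd2 ps L 0 0) + b <=
   Phi ps + Pend ct + wgt L * x + wN * N + b * hb)%N.
Proof.
move=> f0p xb hN; rewrite /rank Phi_root subn0 /credit subnS subnn mul0n.
rewrite /freshc eqxx /wN (_ : (f0 == 0%N) = false); last by lia.
rewrite fanL in xb hN *; rewrite mulnBr -/(f0 * b)%N.
have wE : (wgt L = wgt L.-1 + 10)%N by rewrite /wgt; have := f0_L; lia.
have le : (wgt L * (f0 * b - x) <= wgt L * N)%N by rewrite leq_mul2l ltnW ?orbT.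
have : (wgt L * (f0 * b - x) + wgt L * x = wgt L * (f0 * b))%N.
  by rewrite -mulnDr subnK.
have : (b <= f0 * b)%N by rewrite leq_pmull.
have e3 : (wgt L * (f0 * b) = wgt L.-1 * (f0 * b) + 10 * (f0 * b))%N.
  by rewrite wE mulnDl.
have e1 := mulnDl (wgt L.-1) 2 (f0 * b); have e2 : (2 * b * f0 = 2 * (f0 * b))%N by lia.
rewrite e1 e2; lia.
Qed.

Lemma rank_direct ct ps N : f0 = 0%N -> (0 < N)%N ->
  forall s, (rank (Direct s N.-1) ct ps + b <= Phi ps + Pend ct + wN * N + b * hb)%N.
Proof.
move=> e N0 s; rewrite /rank /wN e eqxx !mul1n (small_b e) subn0; lia.
Qed.

Lemma Pend_upd ct l i s : node l i ->
  (Pend (upd2 ct l i s) + pend l (ct l i) = Pend ct + pend l s)%N.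
Proof.
move=> nl; have := @nodeSum_upd (fun l' i' => pend l' (upd2 ct l i s l' i'))
  (fun l' i' => pend l' (ct l' i')) l i nl.
by rewrite upd2_same; apply=> l' i' ne; rewrite upd2_other.
Qed.

Lemma rank_label l i N ct ps ds : node l i -> size ds = (fan l * b)%N ->
  (rank (Gather l i N) (upd2 ct l i ds) ps + b <= rank (Label l i N) ct ps)%N.
Proof.
move=> nl sz; rewrite /rank !subn0.
have H := Pend_upd ct ds nl.
have hp := pend_label sz; rewrite /freshc.
have : (credit l <= credit l.+1 + (if l == L then 0 else (2 * f + 2) * b))%N.
  rewrite /credit; case: eqP => [->|ne]; first by rewrite subnn mul0n.
  have -> : (L - l = (L - l.+1).+1)%N by case/and3P: nl; lia.
  by rewrite mulSn addnC.
by lia.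
Qed.

Lemma rank_gather_take l i d N ct ps : node l i -> (d < fan l)%N ->
  (0 < lcount l d (ct l i))%N ->
  (rank (Take l i d N) ct ps + b <= rank (Gather l i N) ct ps)%N.
Proof.
by move=> nl df h; have := Pend_ge nl df h; rewrite /rank; lia.
Qed.

Lemma rank_gather_down l i d N ct ps : node l i -> (1 < l)%N -> (d < fan l)%N ->
  ps l.-1 (i * f + d)%N = (f * b)%N ->
  (rank (SaveD l i d 0 N) ct (upd2 ps l.-1 (i * f + d) 0) + b <=
   rank (Gather l i N) ct ps)%N.
Proof.
move=> nl l1 df px; rewrite /rank !subn0.
have nc := node_child nl l1 df.
have lL : (l.-1 < L)%N by case/and3P: nl; lia.
have H : (Phi (upd2 ps l.-1 (i * f + d) 0) + own l.-1 (f * b) = Phi ps)%N.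
  have := @nodeSum_upd
    (fun l' i' => if l' == L then 0%N else own l' (upd2 ps l.-1 (i * f + d)%N 0%N l' i'))
    (fun l' i' => if l' == L then 0%N else own l' (ps l' i')) l.-1 (i * f + d)%N nc.
  rewrite upd2_same ltn_eqF // px [own _ 0]/own muln0 mod0n muln0.
  by move=> H0; rewrite -[RHS]addn0; apply: H0 => l' i' ne; rewrite upd2_other.
(* The released [wgt l.-1 * (f * b)] has to cover [freshc l.-1], a save and a reload of at most [f]
   blocks each, and two more rounds: in all at most [wgt l.-2 * (f * b) + 8 * (f * b) + 4 * b].
   Since [f >= 2], an increment of 10 in [wgt] is enough. *)
rewrite -H /own modnMl muln0 addn0 /freshc (ltn_eqF lL) fan_lt //.
have wE : (wgt l.-1 = wgt l.-2 + 10)%N by rewrite /wgt; lia.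
have fl : (fan l * b <= f * b)%N by rewrite leq_mul2r fanle orbT.
have f2 : (2 * b <= f * b)%N by rewrite leq_mul2r (f_ge2 (node_pos nl)) orbT.
have e3 : (wgt l.-1 * (f * b) = wgt l.-2 * (f * b) + 10 * (f * b))%N.
  by rewrite wE mulnDl.
have e1 := mulnDl (wgt l.-2) 2 (f * b); have e2 : (2 * b * f = 2 * (f * b))%N by lia.
have e4 : ((2 * f + 2) * b = 2 * (f * b) + 2 * b)%N by lia.
rewrite e1 e2 e3 e4; lia.
Qed.

Lemma rank_gather_up l i N ct ps : node l i -> (l < L)%N ->
  (rank (SaveU l i 0 N) ct ps + b <= rank (Gather l i N) ct ps)%N.
Proof.
move=> nl lL; rewrite /rank !subn0 /credit.
have -> : (L - l = (L - l.+1).+1)%N by lia.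
have e4 : ((2 * f + 2) * b = 2 * (f * b) + 2 * b)%N by lia.
rewrite mulSn e4 fan_lt //; lia.
Qed.

Lemma rank_take1 i d N ct ps ys : node 1 i -> (d < fan 1)%N ->
  (0 < lcount 1 d (ct 1%N i))%N -> (lcount 1 d (ct 1%N i) <= size ys)%N ->
  (forall y, List.In y ys -> lab_of (fan 1) y = None) ->
  (rank (Gather 1 i N) (upd2 ct 1 i
     (fillm (lmask (@lab_of W S (fan 1)) d (ct 1%N i)) ys (ct 1%N i))) ps + b <=
   rank (Take 1 i d N) ct ps)%N.
Proof.
move=> nl df q0 qs Hy; have := Pend_ge nl df q0; rewrite /rank.
set s' := fillm _ _ _.
have := Pend_upd ct s' nl; have := pend_fill (ct 1%N i) df Hy.
rewrite -/s' (minn_idPr qs) subnn /pend1 q0 ltnn !muln0 muln1 !addn0 subn0.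
by lia.
Qed.

Lemma rank_take l i d N ct ps ys k : node l i -> (1 < l)%N -> (d < fan l)%N ->
  (0 < lcount l d (ct l i))%N -> size ys = k ->
  k = minn (b - ps l.-1 (i * f + d)%N %% b) (lcount l d (ct l i)) ->
  (forall y, List.In y ys -> lab_of (fan l) y = None) ->
  (rank (Gather l i N) (upd2 ct l i
     (fillm (lmask (@lab_of W S (fan l)) d (ct l i)) ys (ct l i)))
     (upd2 ps l.-1 (i * f + d) (ps l.-1 (i * f + d) + k)) + b <=
   rank (Take l i d N) ct ps)%N.
Proof.
move=> nl l1 df q0 sz kE Hy; have := Pend_ge nl df q0; rewrite /rank.
set s' := fillm _ _ _; set x := ps _ _ in kE *.
have nc := node_child nl l1 df.
have lL : (l.-1 < L)%N by case/and3P: nl; lia.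
have H : (Phi (upd2 ps l.-1 (i * f + d) (x + k)) + own l.-1 x =
          Phi ps + own l.-1 (x + k))%N.
  have := @nodeSum_upd
    (fun l' i' => if l' == L then 0%N else own l' (upd2 ps l.-1 (i * f + d)%N (x + k)%N l' i'))
    (fun l' i' => if l' == L then 0%N else own l' (ps l' i')) l.-1 (i * f + d)%N nc.
  rewrite upd2_same ltn_eqF //; apply.
  by move=> l' i' ne; rewrite upd2_other.
have := Pend_upd ct s' nl; have := pend_fill (ct l i) df Hy.
rewrite -/s' sz; move: (lcount l d (ct l i)) q0 kE => q q0 kE.
have kq' : (k <= q)%N by rewrite kE geq_minr.
rewrite (minn_idPl kq') /pend1 q0 muln1 subn0.
have xm := ltn_pmod x b_gt0.
move: H; rewrite /own mulnDr.
have wE : ((wgt l.-1 + 2) * q = (wgt l.-1 + 2) * (q - k) + (wgt l.-1 * k + 2 * k))%N.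
  by rewrite -mulnDl -mulnDr subnK.
(* Either all labels of the child are served and its reserve [2 * b] is released, or the block is
   used up and the [2 * (x %% b)] of [own] together with [2 * k] of [pend1] make up [2 * b]. *)
have [kqE|klt] : k = q \/ (k < q)%N /\ k = (b - x %% b)%N by move: kE; lia.
  have : ((x + k) %% b <= x %% b + k)%N.
    by rewrite -modnDml; exact: leq_mod.
  move: wE; rewrite kqE subnn ltnn !muln0; lia.
have [_ kb] := klt.
have -> : ((x + k) %% b = 0)%N.
  by rewrite -modnDml kb subnKC ?modnn // ltnW.
have : (0 < q - k)%N by lia.
move=> ->; lia.
Qed.

Lemma sub_step n j : (j < n)%N -> ((n - j) * b = (n - j.+1) * b + b)%N.
Proof. by move=> h; rewrite -mulSnr; congr muln; lia. Qed.

Lemma rank_saved l i d j N ct ps : node l i -> (1 < l)%N -> (d < fan l)%N ->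
  (j < fan l)%N ->
  (rank (if (j.+1 < fan l)%N then SaveD l i d j.+1 N else RestD l.-1 (i * f + d) 0 N)
     ct ps + b <= rank (SaveD l i d j N) ct ps)%N.
Proof.
move=> nl l1 df jf; have lL : (l.-1 < L)%N by case/and3P: nl; lia.
have e := sub_step jf; case: ltnP => h; rewrite /rank !subn0; first by lia.
rewrite prednK; last by lia.
by rewrite (fan_lt lL) //; lia.
Qed.

Lemma rank_saveu l i j N ct ps : node l i -> (l < L)%N -> (j < fan l)%N ->
  (rank (if (j.+1 < fan l)%N then SaveU l i j.+1 N else RestU l.+1 (i %/ f) 0 N)
     ct ps + b <= rank (SaveU l i j N) ct ps)%N.
Proof.
move=> nl lL jf.
have fl : (fan l.+1 * b <= f * b)%N by rewrite leq_mul2r fanle orbT.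
by have e := sub_step jf; case: ltnP => h; rewrite /rank !subn0; lia.
Qed.

Lemma rank_restd l i j N ct ps : (j < fan l)%N ->
  (rank (if (j.+1 < fan l)%N then RestD l i j.+1 N else Label l i N) ct ps + b <=
   rank (RestD l i j N) ct ps)%N.
Proof. by move=> jf; have e := sub_step jf; case: ltnP => h; rewrite /rank !subn0; lia. Qed.

Lemma rank_restu l i j N ct ps : (j < fan l)%N ->
  (rank (if (j.+1 < fan l)%N then RestU l i j.+1 N else Gather l i N) ct ps + b <=
   rank (RestU l i j N) ct ps)%N.
Proof. by move=> jf; have e := sub_step jf; case: ltnP => h; rewrite /rank !subn0; lia. Qed.

Lemma rank_hscan j x ct ps : (j.+1 < hb)%N ->
  (rank (HScan j.+1 x) ct ps + b <= rank (HScan j x) ct ps)%N.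
Proof.
move=> h; rewrite /rank !subn0.
have -> : (b * (hb - j.+1) = b * (hb - j.+2) + b)%N by rewrite -mulnSr; congr muln; lia.
by lia.
Qed.

Lemma rank_fscan s t t' x ct ps : (s.+1 < slots)%N ->
  (rank (FScan s.+1 t' x) ct ps + b <= rank (FScan s t x) ct ps)%N.
Proof.
move=> h; rewrite /rank !subn0.
have -> : (b * (slots - s.+1) = b * (slots - s.+2) + b)%N.
  by rewrite -mulnSr; congr muln; lia.
by lia.
Qed.

(** * Values of configurations *)

Notation drw := (@draw R M' B' K' W' Q dl b zt hm f f0 L tb).
Notation fnsh := (@finish R M' B' K' W' Q zt tb hb kq).

Lemma E_fmap_fun T U (g : T -> U) (d : fd R T) F :
  E (fmap g d) F = E d (fun x => F (g x)).
Proof. exact: E_fmap. Qed.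

Lemma finishE rp x : fnsh rp x =
  ret R (mk hb kq rp keep (fin_st x) (if hb == 0%N then Halt _ _ _ else rdH 0)).
Proof. by rewrite /finish /fin_st; case: eqP. Qed.

Lemma inv_fin c rp x ct ps : ready c ct ps x ->
  Inv (nxt (mk hb kq rp keep (fin_st x) (if hb == 0%N then Halt _ _ _ else rdH 0)) c)
    (fin_st x) ct ps.
Proof.
move=> hr; rewrite /fin_st; case: eqP => h; first exact: eff_idle.
by apply: eff_hscan => //; lia.
Qed.

Lemma halt_fin x :
  is_halt (if hb == 0%N then Halt _ _ _ else rdH 0) = isIdle (fin_st x).
Proof. by rewrite /fin_st; case: eqP. Qed.

Lemma support_iid_unif k n : (0 < n)%N ->
  on_support (iid k (unif R n)) (fun s => size s = k /\ all (fun d => d < n)%N s).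
Proof. by move=> n0; apply: support_iid; exact: support_unif. Qed.

Lemma draw_leaf c ct ps x rp N : ready c ct ps x -> (N <= J)%N ->
  on_support (drw (vu c) hb kq rp N x)
    (leaf c (Phi ps + Pend ct + wgt L * x + wN * N + b * hb)).
Proof.
move=> hr NJ; rewrite /draw; apply: support_bind => D _.
have [_ _ _ xE xb] := hr.
case: leqP => hN.
  rewrite finishE; apply/support_ret.
  exists (fin_st (x + N)), ct, (upd2 ps L 0 (x + N)); split.
  - by apply: inv_fin; apply: ready_upd hr _; lia.
  - exact: halt_fin.
  exact: rank_draw_fin.
case: eqP => f00.
  have x0 : x = 0%N by move: xb; rewrite fanL f00; lia.
  apply: support_fmap => s sd; exists (Direct s.2 N.-1), ct, ps; split=> //.
    apply: eff_direct => //; [by rewrite -x0 | | lia].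
    exact: (support_unif slots_gt0 sd).
  by rewrite mul1n x0 muln0 addn0; apply: rank_direct => //; lia.
have f0p : (0 < f0)%N by lia.
apply/support_ret; exists (Label L 0 (N - (fan L * b - x))), ct, (upd2 ps L 0 0).
split=> //; first by apply: eff_root_label hr f0p _; lia.
by rewrite mul1n; apply: rank_root_label.
Qed.

Lemma gather_counter c l i d N ct ps : Inv c (Gather l i N) ct ps -> (1 < l)%N ->
  (d < fan l)%N -> vnat (vu c) (cb + d) = ps l.-1 (i * f + d)%N.
Proof.
move=> [_ [_ hr] _ [h1 h2 [nl NJ]]] l1 df.
case: Q_big => q1 q2 q3 q4 [q5 q6].
have := hr l i d nl df; rewrite eqxx => -[_ H].
have [_ px] := h1 _ _ (node_child nl l1 df).
have fb : (fan l.-1 * b <= f * b)%N by rewrite leq_mul2r fanle orbT.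
by rewrite /vnat vgetE H /= wdK //; lia.
Qed.

Lemma take_nolab c l i d N ct ps : Inv c (Take l i d N) ct ps -> (1 < l)%N ->
  forall y, List.In y (take_items l i d ct ps) ->
  lab_of (fan l) y = None /\ lab_of (fan l.-1) y = None.
Proof.
move=> [_ _ _ [h1 h2 [nl NJ df _ _]]] l1 y /In_mem /mem_take /mem_drop yc.
have nc := node_child nl l1 df.
have := h2 _ _ nc; rewrite [anc0 _]/= isanc_low; last by lia.
move/allP/(_ y yc)/eqP => e; split=> //; move: e.
have lL : (l.-1 < L)%N by case/and3P: nl; lia.
rewrite (fan_lt lL) /lab_of; case: y {yc} => // k; case: ifP => // kf _.
by rewrite ifF //; have := fanle l; lia.
Qed.

Lemma step_leaf c s ct ps : Inv c s ct ps -> ~~ isIdle s ->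
  on_support (stp (vu c) hb kq s) (leaf c (rank s ct ps)).
Proof.
move=> hI ni; have [_ hc hz [h1 h2 hm']] := hI.
case: s ni hI hc hz h2 hm' => [x|s N|j x|s t x|l i N|l i N|l i d N|l i d j N|l i j N|l i j N|l i j N] // _ hI hc hz h2 hm' /=.
- have [f00 sm NJ p0] := hm'; apply: support_bind => D _.
  have hr : ready c ct ps 0 by split.
  have := @draw_leaf c ct ps 0 D.2 N hr NJ; rewrite muln0 addn0 => H y yd.
  by have := H y yd; rewrite /rank subn0 addnA.
- have [jh xE xb] := hm'; have hr : ready c ct ps x by split.
  apply: support_fmap => D _ /=; case: ltnP => hj.
    exists (HScan j.+1 x), ct, ps; split=> //; first exact: eff_hscan.
    by rewrite mul1n; apply: rank_hscan.
  exists (Idle x), ct, ps; split=> //; first exact: eff_idle.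
  by rewrite mul0n addn0 /rank !subn0; lia.
- have [sm tJ xE xb] := hm'; have hr : ready c ct ps x by split.
  apply: support_bind => z zd; case: ltnP => hs.
    apply/support_ret; exists (FScan s.+1 z.2.2 x), ct, ps; split=> //.
      apply: eff_fscan => //; move: zd; rewrite /checked; case: asboolP => _.
        by move/support_scan_dist => h; apply: leq_trans h tJ.
      by case=> [<-|[]].
    by rewrite mul1n; apply: rank_fscan.
  rewrite finishE; apply/support_ret; exists (fin_st x), ct, ps; split.
  - exact: inv_fin.
  - exact: halt_fin.
  by apply: leq_trans (rank_fin _ _ _) _; rewrite /rank !subn0; lia.
- have [nl NJ p0] := hm'; apply: support_fmap => y yd.
  have fg : (0 < fan l)%N.
    by apply: fan_gt0; [exact: f_gt0 (node_pos nl) | rewrite -f0_L; exact: node_pos nl].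
  have [sz al] := @support_iid_unif _ _ fg _ yd.
  exists (Gather l i N), (upd2 ct l i (map mklab y.2)), ps; split=> //.
    exact: eff_label hI sz al.
  by rewrite mul1n; apply: rank_label => //; rewrite size_map.
- have [nl NJ] := hm'; rewrite (first_label_pwords hc nl h1).
  case fl : (first_label _ _) => [d|]; last first.
    case: eqP => [lE|ne].
      subst l; have i0 : i = 0%N by case/and3P: nl; rewrite /cnt eqxx; lia.
      subst i; have hr := gather_ready hI fl.
      have := @draw_leaf c ct ps 0 [::] N hr NJ; rewrite muln0 addn0 => H y yd.
      by have := H y yd; rewrite /rank subn0 /credit subnn mul0n add0n addnA.
    have lL : (l < L)%N by case/and3P: nl; lia.
    apply/support_ret; exists (SaveU l i 0 N), ct, ps; split=> //.
      exact: eff_gather_up.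
    by rewrite mul1n; apply: rank_gather_up.
  have [df cd] := first_label_some fl; case: eqP => [lE|/eqP ne].
    subst l; apply/support_ret; exists (Take 1 i d N), ct, ps; split=> //.
      exact: eff_gather_take1.
    by rewrite mul1n; apply: rank_gather_take.
  have l1 : (1 < l)%N by case/and3P: nl; lia.
  rewrite (gather_counter hI l1 df); case: ltnP => hx; apply/support_ret.
    exists (Take l i d N), ct, ps; split=> //; first exact: eff_gather_take.
    by rewrite mul1n; apply: rank_gather_take.
  exists (SaveD l i d 0 N), ct, (upd2 ps l.-1 (i * f + d) 0); split=> //.
    exact: eff_gather_down.
  rewrite mul1n; apply: rank_gather_down => //.
  have [_ px] := h1 _ _ (node_child nl l1 df).
  have lL : (l.-1 < L)%N by case/and3P: nl; lia.
  by rewrite (fan_lt lL) in px hx; lia.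
- have [nl NJ df cd px] := hm'; case: eqP => [lE|/eqP ne].
    subst l; apply: support_fmap => y yd.
    have [sz al] := @support_iid_unif _ _ b_gt0 _ yd; exists (Gather 1 i N).
    exists (upd2 ct 1 i (fillm (lmask (@lab_of W S (fan 1)) d (ct 1%N i))
       [seq Tw ((i * f + d) * b + t) | t <- y.2] (ct 1%N i))), ps; split=> //.
      exact: eff_take1.
    rewrite mul1n; apply: rank_take1 => //.
      by rewrite size_map sz -(h1 _ _ nl).1; exact: lcount_le.
    move=> w wy; have [t [<- _]] := In_map wy.
    by apply: Tw_nolab; exact: fanle.
  have l1 : (1 < l)%N by case/and3P: nl; lia.
  have [vE hI'] := eff_take hI l1.
  rewrite vE (lmask_pwords _ hc nl h1) -/(take_count l i d ct ps).
  apply/support_ret; exists (Gather l i N); do 2 eexists; split=> //.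
    by move: hI'; rewrite (lmask_pwords _ hc nl h1); apply.
  rewrite mul1n; apply: rank_take => //.
  + have [xk szc] := take_count_le (And3 h1 h2 hm' : wf (Take l i d N) ct ps) l1.
    by rewrite size_takel // size_drop szc; lia.
  by move=> y /(take_nolab hI l1)[].
- have [nl NJ /andP[l1 df] jf p0] := hm'; apply/support_ret.
  have := eff_saved hI; have := rank_saved N ct ps nl l1 df jf.
  by case: ltnP => _ h1' h2'; do 3 eexists; (split; [exact: h2' | by [] | by rewrite mul1n; exact: h1']).
- have [nl NJ lL jf] := hm'; apply/support_ret.
  have := eff_saveu hI; have := rank_saveu N ct ps nl lL jf.
  by case: ltnP => _ h1' h2'; do 3 eexists; (split; [exact: h2' | by [] | by rewrite mul1n; exact: h1']).
- have [nl NJ lL jf p0] := hm'; apply/support_ret.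
  have := eff_restd hI; have := rank_restd i N ct ps jf.
  by case: ltnP => _ h1' h2'; do 3 eexists; (split; [exact: h2' | by [] | by rewrite mul1n; exact: h1']).
have [nl NJ jf] := hm'; apply/support_ret.
have := eff_restu hI; have := rank_restu i N ct ps jf.
by case: ltnP => _ h1' h2'; do 3 eexists; (split; [exact: h2' | by [] | by rewrite mul1n; exact: h1']).
Qed.

Definition idle_rank x ct ps N : nat :=
  (Phi ps + Pend ct + wgt L * x + b * hb +
   (if N == J.+1 then b * slots else wN * N))%N.

Lemma idle_leaf c x ct ps S0 N : Inv c (Idle x) ct ps -> (N <= J.+1)%N ->
  on_support (if N == J.+1 then ret R (mk hb kq S0 keep (FScan 0 J.+1 x) (rdT 0))
              else drw (vu c) hb kq S0 N x) (leaf c (idle_rank x ct ps N)).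
Proof.
move=> hI NJ; have hr := inv_ready hI; rewrite /idle_rank; case: eqP => [_|ne].
  apply/support_ret; exists (FScan 0 J.+1 x), ct, ps; split=> //.
    by have := @eff_fscan c S0 0 J.+1 x ct ps hr slots_gt0 (leqnn _); rewrite div0n.
  rewrite mul1n /rank !subn0.
  have : (b * slots = b * (slots - 1) + b)%N by rewrite -mulnSr; congr muln; lia.
  by lia.
have NJ' : (N <= J)%N by lia.
have H := @draw_leaf c ct ps x S0 N hr NJ'; move=> y yd; have := H y yd.
by rewrite addnAC.
Qed.

(** Crude, but valid in every ready configuration: [PQ] needs one bound on the rounds of a query for
    all of them. *)
Definition rank_max : nat :=
  (nodeSum (fun l _ => wgt l * (f * b) + 2 * b) +
   nodeSum (fun l _ => (wgt l.-1 + 2) * (fan l * b) + 2 * b * fan l) +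
   wgt L * (fan L * b) + b * hb + b * slots + wN * J).+2%N.

Lemma leq_nodeSum h h' : (forall l i, node l i -> h l i <= h' l i)%N ->
  (nodeSum h <= nodeSum h')%N.
Proof.
move=> H; apply: leq_sum => l _; apply: leq_sum => i _; case: eqP => // l0.
by apply: H; rewrite /node lt0n (introF eqP l0) /= -ltnS !ltn_ord.
Qed.

Lemma idle_rank_max c x ct ps N : Inv c (Idle x) ct ps -> (N <= J.+1)%N ->
  ((idle_rank x ct ps N).+1 < rank_max)%N.
Proof.
move=> hI NJ; have [_ h1 h2 xE xb] := inv_ready hI.
rewrite /rank_max /idle_rank !ltnS.
have a1 : (Phi ps <= nodeSum (fun l _ => wgt l * (f * b) + 2 * b))%N.
  apply: leq_nodeSum => l i nl; case: eqP => // _; have [_ px] := h1 _ _ nl.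
  have fb : (fan l * b <= f * b)%N by rewrite leq_mul2r fanle orbT.
  rewrite /own leq_add // leq_mul2l ?(ltnW (ltn_pmod _ b_gt0)) ?orbT //.
  by rewrite (leq_trans px fb) orbT.
have a2 : (Pend ct <= nodeSum (fun l _ => (wgt l.-1 + 2) * (fan l * b) + 2 * b * fan l))%N.
  by apply: leq_nodeSum => l i nl; apply: pend_label; have [] := h1 _ _ nl.
have a3 : (wgt L * x <= wgt L * (fan L * b))%N by rewrite leq_mul2l xb orbT.
case: eqP => [_|ne]; first by lia.
have : (wN * N <= wN * J)%N by rewrite leq_mul2l; lia.
by lia.
Qed.

(** * Preservation of the invariant and termination *)

Definition InvP (c : cfg) : Prop := exists s ct ps, Inv c s ct ps.
Definition RdP (c : cfg) : Prop := exists x ct ps, Inv c (Idle x) ct ps.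

Lemma RdP_InvP c : RdP c -> InvP c.
Proof. by move=> [x [ct [ps h]]]; exists (Idle x), ct, ps. Qed.

Lemma any_leaf c s ct ps : Inv c s ct ps ->
  exists rk, on_support (pdst (vu c)) (leaf c rk).
Proof.
move=> hI; rewrite (pdistE hI); case: (boolP (isIdle s)) => [|ni]; last first.
  by exists (rank s ct ps); apply: step_leaf.
case: s hI => // x hI _; exists rank_max => /=.
apply: support_bind => S0 _; apply: support_bind => N Nd.
have NJ : (N.2 <= J.+1)%N.
  move: Nd; rewrite /checked; case: asboolP => _; last by case=> [<-|[]].
  exact: support_count_dist.
move=> y yd; have [s' [ct' [ps' [e1 e2 e3]]]] := @idle_leaf c x ct ps S0.2 N.2 hI NJ y yd.
exists s', ct', ps'; split=> //; apply: leq_trans e3 _.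
by have := idle_rank_max hI NJ; lia.
Qed.

Lemma InvP_step c : InvP c -> on_support (pdst (vu c))
  (fun a => if is_halt a.2 then RdP (nxt a c) else InvP (nxt a c)).
Proof.
move=> [s [ct [ps hI]]]; have [rk H] := any_leaf hI.
move=> y yd; have [s' [ct' [ps' [e1 -> e3]]]] := H y yd.
case: s' e1 {e3} => [x|||||||||| ] *; do 3 eexists; eassumption.
Qed.

(** Each round lowers the rank by [b >= 1], so the potential also proves termination. *)
Lemma stops_rank k c s ct ps : Inv c s ct ps -> ~~ isIdle s ->
  (rank s ct ps < k)%N -> stops_within p pdst k c.
Proof.
elim: k c s ct ps => // k IH c s ct ps hI ni hk; rewrite /= (pdistE hI).
move=> y yd; have [s' [ct' [ps' [e1 e2 e3]]]] := step_leaf hI ni yd.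
case: (boolP (isIdle s')) => is'; first by left; rewrite e2.
right; apply: (IH _ _ _ _ e1 is'); rewrite is' mul1n in e3.
by move: b_gt0; lia.
Qed.

Lemma RdP_stops c : RdP c -> stops_within p pdst rank_max c.
Proof.
move=> [x [ct [ps hI]]]; have [r rE] : exists r, rank_max = r.+1 by eexists.
rewrite rE [stops_within _ _ _ _]/= (pdistE hI) [stp _ _ _ _]/=.
apply: support_bind => S0 _; apply: support_bind => N Nd.
have NJ : (N.2 <= J.+1)%N.
  move: Nd; rewrite /checked; case: asboolP => _; last by case=> [<-|[]].
  exact: support_count_dist.
move=> y yd; have [s' [ct' [ps' [e1 e2 e3]]]] := @idle_leaf c x ct ps S0.2 N.2 hI NJ y yd.
case: (boolP (isIdle s')) => is'; first by left; rewrite e2.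
right; apply: (stops_rank e1 is').
by have := idle_rank_max hI NJ; rewrite rE; rewrite is' mul1n in e3; lia.
Qed.

(** * Tests of the answers and the law of the remaining stream *)

Definition safe (Y : {set S}) (w : wordT) : bool := if w is inl v then v \in Y else true.

Lemma reported_mk rp sr s io (c : cfg) (Y : {set S}) : all (fun a => a < M)%N rp ->
  (reported (mk hb kq rp sr s io) c.1 \subset Y)%:R =
  \prod_(a <- rp) (safe Y (mget c.1 a))%:R :> R.
Proof.
move=> rM; rewrite -natr_prod; congr (_%:R).
have -> : (\prod_(a <- rp) safe Y (mget c.1 a))%N = all (fun a => safe Y (mget c.1 a)) rp :> nat.
  by elim: rp {rM} => [|a rp IH]; rewrite ?big_nil // big_cons IH /= mulnb.
congr nat_of_bool; apply/fintype.subsetP/allP => [H a arp|H v].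
  case E : (mget c.1 a) => [v|] //=; apply: H; rewrite inE; apply/existsP.
  exists (cl a); rewrite inE inordK ?arp ?(allP rM) //=.
  by rewrite -[c.1 (cl a)]/(mget c.1 a) E.
rewrite inE => /existsP[i]; rewrite inE => /andP[ir /eqP E].
by have := H _ ir; rewrite /mget cl_surj E.
Qed.

Lemma support_subs (l : seq (R * nat)) (a : pred nat) : (forall x, List.In x l -> a x.2) ->
  on_support (subs l) (fun s => all a s).
Proof.
elim: l => [|x l IH] H; first by apply/support_ret.
apply: support_bind => s sd.
have as' : all a s.2 by apply: IH sd => y yl; apply: H; right.
by move=> y [<-|[<-|[]]] //=; rewrite as' andbT; apply: H; left.
Qed.

Definition aqw (w : wordT) : R :=
  if w is inl v then clamp (accept (th dl kq) (p v)) else 0.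
Definition hqw (w : wordT) : R := if w is inl v then clamp (p v) else 0.
(** Probability that a drawn slot passes the test: only an accepted record outside [Y] fails it. *)
Definition gY Y w : R := 1 - aqw w * (1 - (safe Y w)%:R).
Definition hY Y w : R := 1 - hqw w * (1 - (safe Y w)%:R).

Lemma aqE (c : cfg) a : aq dl (vu c) kq a = aqw (mget c.1 a).
Proof. by rewrite /aq vgetE; case: (mget c.1 a). Qed.

Lemma hqE (c : cfg) a : hq (vu c) a = hqw (mget c.1 a).
Proof. by rewrite /hq vgetE; case: (mget c.1 a). Qed.

Lemma aqw01 w : 0 <= aqw w <= 1.
Proof. by case: w => [v|k]; rewrite /aqw ?clamp01 // lexx ler01. Qed.

Lemma gY01 Y w : 0 <= gY Y w <= 1.
Proof.
rewrite /gY; have /andP[h0 h1] := aqw01 w.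
by case: (safe Y w); rewrite ?subrr ?mulr0 ?subr0 ?lexx ?ler01 // mulr1 subr_ge0 h1 lerBlDr lerDl.
Qed.

Lemma pair_neqF (l i l0 i0 : nat) : Some (l0, i0) <> Some (l, i) ->
  (l == l0) && (i == i0) = false.
Proof. by move=> ne; apply/negbTE/negP => /andP[/eqP e1 /eqP e2]; apply: ne; rewrite e1 e2. Qed.

(** What [tree_law] sees of a node: the part not yet read, and nothing for a node about to be
    relabelled. *)
Definition cells fr (ct : nat -> nat -> seq wordT) (ps : nat -> nat -> nat) l i :
    seq wordT :=
  if fr == Some (l, i) then [::] else drop (ps l i) (ct l i).

Definition meanT (g : wordT -> R) : R := slots%:R^-1 * \sum_(s < slots) g (Tw s).

Definition Dst fr ct ps (gs : seq (wordT -> R)) : R :=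
  if f0 == 0%N then \prod_(g <- gs) meanT g
  else tree_law f f0 L b (@lab_of W S) Tw (cells fr ct ps) L 0 gs.

(** The next [N] samples belong to the current query and face its test [g]; the rest of the stream
    is left to later queries. *)
Definition sh N (g : wordT -> R) (D : seq (wordT -> R) -> R) gs : R :=
  D (nseq N g ++ gs).

Notation thq := (th dl kq).
Notation rt := (rate dl b tb kq).

Definition hvm Y : R := \prod_(t < hm) hY Y (hw t).
Definition hvd j Y : R := \prod_(j <= j' < hb) \prod_(t < b) hY Y (hw (hm + j' * b + t)).
Definition sgr s Y : R := \sum_(s <= s' < slots) thq * gY Y (Tw s').
Definition sval s t Y : R := scan_value t ((slots - s)%:R * thq) (sgr s Y).

(** Probability that the coming queries pass the tests [Ys], given the law [D] of the stream: heavy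
    records in memory and on disk, then either [N <= J] stream samples or the lumped event with its
    table scan, which leaves the stream untouched. *)
Fixpoint KK (Ys : seq {set S}) (D : seq (wordT -> R) -> R) : R :=
  if Ys is Y :: Ys' then
    hvm Y * (hvd 0 Y * (\sum_(N < J.+1) pois rt N * KK Ys' (sh N (gY Y) D) +
      tail J.+1 rt * sval 0 J.+1 Y * KK Ys' D))
  else D [::].

Lemma eq_KK Ys D D' : D =1 D' -> KK Ys D = KK Ys D'.
Proof.
elim: Ys D D' => [|Y Ys IH] D D' H /=; first exact: H.
congr (_ * (_ * (_ + _))); last by rewrite (IH _ _ H).
by apply: eq_bigr => N _; rewrite (IH _ (sh N (gY Y) D')) // => gs; apply: H.
Qed.

Lemma KK_scale Ys a D : KK Ys (fun gs => a * D gs) = a * KK Ys D.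
Proof.
elim: Ys D => [|Y Ys IH] D //=.
rewrite IH; under eq_bigr => N _ do
  rewrite -[sh _ _ _]/(fun gs => a * sh N (gY Y) D gs) IH mulrCA.
by rewrite -mulr_sumr; ring.
Qed.

(** Linearity in [D]: randomness in the buffers can be averaged inside the stream law, however many
    queries are going to consume it. *)
Lemma E_KK T (d : fd R T) Ys (Dw : T -> seq (wordT -> R) -> R) :
  E d (fun w => KK Ys (Dw w)) = KK Ys (fun gs => E d (fun w => Dw w gs)).
Proof.
elim: Ys Dw => [|Y Ys IH] Dw //=.
rewrite !E_scalel E_add E_scalel IH; congr (_ * (_ * (_ + _))).
rewrite (E_sum d (index_enum _) (fun (N : 'I_J.+1) w => pois rt N * KK Ys (sh N (gY Y) (Dw w)))).
by apply: eq_bigr => N _; rewrite E_scalel IH.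
Qed.

Definition vout Y Ys (s : st) (D : seq (wordT -> R) -> R) : R :=
  match s with
  | Idle _ => KK Ys D
  | Direct s N => gY Y (Tw s) * (hvd 0 Y * KK Ys (sh N (gY Y) D))
  | HScan j _ => hvd j Y * KK Ys D
  | FScan s t _ => sval s t Y * (hvd 0 Y * KK Ys D)
  | Label _ _ N | Gather _ _ N | Take _ _ _ N | SaveD _ _ _ _ N
  | SaveU _ _ _ N | RestD _ _ _ N | RestU _ _ _ N =>
      hvd 0 Y * KK Ys (sh N (gY Y) D)
  end.

Lemma vout_fin Y Ys x D : vout Y Ys (fin_st x) D = hvd 0 Y * KK Ys D.
Proof.
by rewrite /fin_st; case: eqP => h //=; rewrite /hvd h big_geq // mul1r.
Qed.

Lemma fresh_fin x : fresh (fin_st x) = None.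
Proof. by rewrite /fin_st; case: eqP. Qed.

Lemma eq_Dst fr fr' ct ps ct' ps' :
  (forall l i, cells fr ct ps l i = cells fr' ct' ps' l i) ->
  Dst fr ct ps =1 Dst fr' ct' ps'.
Proof.
by move=> H gs; rewrite /Dst; case: eqP => // _; apply: eq_tree_law.
Qed.

(** A root buffer without labels is a list of known samples, so each of the next [k] tests is simply
    evaluated. *)
Lemma root_pop ct ps x k g gs : (0 < f0)%N -> ps L 0%N = x ->
  size (ct L 0%N) = (fan L * b)%N -> nolab L (ct L 0%N) -> (x + k <= fan L * b)%N ->
  Dst None ct ps (nseq k g ++ gs) =
  \prod_(a <- iota x k) g (nth nullw (ct L 0%N) a) *
  Dst None ct (upd2 ps L 0 (x + k)%N) gs.
Proof.
move=> f0p; rewrite /Dst (_ : (f0 == 0%N) = false); last by lia.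
elim: k ps x => [|k IH] ps x px sz nlb xk.
  rewrite big_nil mul1r addn0; apply: eq_tree_law => l i; rewrite /cells /upd2 /=.
  by case: ifP => // /andP[/eqP-> /eqP->]; rewrite px.
rewrite /= big_cons -mulrA -addSnnS in xk *.
have xs : (x < size (ct L 0%N))%N by rewrite sz; lia.
rewrite (_ : _ (nth _ _ _) * _ = g (nth nullw (ct L 0%N) x) *
  tree_law f f0 L b (@lab_of W S) Tw (cells None ct (upd2 ps L 0 x.+1)) L 0 (nseq k g ++ gs)); last first.
  rewrite (IH (upd2 ps L 0 x.+1) x.+1) ?upd2_same //; congr (_ * (_ * _)).
  apply: eq_tree_law => l i; rewrite /cells /upd2 /=.
  by case: ifP.
have L0 : (0 < L)%N by rewrite f0_L.
have [L' LE] : exists L', L = L'.+1 by exists L.-1; lia.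
rewrite [in LHS]LE [in RHS]LE /= -LE.
rewrite {1}/cells px /= (drop_nth nullw xs) /=.
have -> : lab_of (fan L) (nth nullw (ct L 0%N) x) = None.
  by apply/eqP; move/allP: nlb; apply; exact: mem_nth.
congr (_ * _); rewrite {3}/cells upd2_same /=.
apply: eq_merge_law => // d gs' df.
transitivity (tree_law f f0 L b (@lab_of W S) Tw
  (upd2 (cells None ct ps) L 0 (drop x.+1 (ct L 0%N))) L' (0 * f + d) gs').
  by rewrite tree_law_upd // LE.
apply: eq_tree_law => l i; rewrite /cells /upd2 /=.
by case: ifP => // /andP[/eqP-> /eqP->].
Qed.

Hypothesis thq_gt0 : 0 < thq.

Section Value.
Variables (Y : {set S}) (Ys : seq {set S}).

(** The rank bound plays the part of fuel: with the continuation required to be correct only below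
    it, one proof of [step_value] serves every [k] in [PV]. *)
Definition cont_ok (c : cfg) (rk : nat) (Cont : act -> R) : Prop :=
  forall a s ct ps, Inv (nxt a c) s ct ps -> is_halt a.2 = isIdle s ->
  (rank s ct ps + (~~ isIdle s) * b <= rk)%N ->
  Cont a = vout Y Ys s (Dst (fresh s) ct ps).

Definition rcont (c : cfg) (Cont : act -> R) (a : act) : R :=
  (reported a c.1 \subset Y)%:R * Cont a.

Lemma E_subs_safe (c : cfg) (q : nat -> R) (qw : wordT -> R) (r : seq nat) (V : R) F :
  (forall a, q a = qw (mget c.1 a)) -> all (fun a => a < M)%N r ->
  (forall D, all (fun a => a < M)%N D ->
     F D = \prod_(a <- D) (safe Y (mget c.1 a))%:R * V) ->
  E (subs [seq (q a, a) | a <- r]) F =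
  \prod_(a <- r) (1 - qw (mget c.1 a) * (1 - (safe Y (mget c.1 a))%:R)) * V.
Proof.
move=> qE rM HF.
rewrite (@eq_E_on _ _ _ _ (fun D => \prod_(a <- D) (safe Y (mget c.1 a))%:R * V)).
  rewrite E_scaler E_subs big_map; congr (_ * _).
  by apply: eq_bigr => a _; rewrite qE.
move=> D Dd; apply: HF; apply: (@support_subs _ _ _ D Dd) => x xr.
by have [a [<- /In_mem ar]] := In_map xr; apply: (allP rM).
Qed.

Lemma addr_M a : (a < cb + f)%N -> (a < M)%N.
Proof. by move=> h; apply: leq_trans h mem_fits. Qed.

Lemma draw_value c ct ps x rp N Cont : ready c ct ps x -> (N <= J)%N ->
  all (fun a => a < M)%N rp ->
  cont_ok c (Phi ps + Pend ct + wgt L * x + wN * N + b * hb) Cont ->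
  E (drw (vu c) hb kq rp N x) (rcont c Cont) =
  \prod_(a <- rp) (safe Y (mget c.1 a))%:R *
    (hvd 0 Y * KK Ys (sh N (gY Y) (Dst None ct ps))).
Proof.
move=> hr NJ rM HC; have [hc h1 h2 xE xb] := hr; rewrite /draw E_bind.
set live := (fan L * b - x)%N.
have iM : all (fun a => a < M)%N (iota (pb + x) (minn N live)).
  apply/allP => a; rewrite mem_iota => h; apply: addr_M; rewrite /cb.
  have : (fan L * b <= f * b)%N by rewrite leq_mul2r fanle orbT.
  by move: h; rewrite /live; lia.
have catM D : all (fun a => a < M)%N D -> all (fun a => a < M)%N (D ++ rp).
  by rewrite all_cat => ->.
pose P := \prod_(a <- rp) (safe Y (mget c.1 a))%:R : R.
case: (posnP f0) => f00.
  (* Without a tree the root buffer is always empty, and each sample contributes the mean of [gY Y]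
     over the table. *)
  have live0 : live = 0%N by rewrite /live fanL f00.
  have x0 : x = 0%N by move: xb; rewrite fanL f00; lia.
  rewrite live0 minn0 E_ret leqn0 cat0s.
  case: eqP => N0.
    rewrite finishE E_ret /rcont reported_mk ?catM //; congr (_ * _).
    rewrite (HC _ _ _ _ (inv_fin rp (ready_upd hr (_ : (x + N <= fan L * b)%N))) (halt_fin _)).
    - rewrite vout_fin; congr (_ * _); apply: eq_KK => gs.
      by rewrite /sh N0 /= /Dst f00.
    - by rewrite N0 addn0.
    by apply: rank_draw_fin; rewrite N0.
  rewrite E_fmap_fun.
  rewrite (@eq_E_on _ _ _ _ (fun s => P * (gY Y (Tw s) *
     (hvd 0 Y * KK Ys (sh N.-1 (gY Y) (Dst None ct ps)))))); last first.
    move=> s sd; rewrite /rcont reported_mk //; congr (_ * _).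
    have sm := support_unif slots_gt0 sd.
    rewrite (HC _ (Direct s.2 N.-1) ct ps) //.
      by apply: eff_direct => //; [rewrite -x0 | lia].
    by rewrite mul1n x0 muln0 addn0; apply: rank_direct => //; lia.
  rewrite E_scalel; congr (_ * _); rewrite E_scaler E_unif // -/(meanT (gY Y)).
  rewrite mulrCA; congr (_ * _); rewrite -KK_scale; apply: eq_KK => gs.
  rewrite /sh /Dst f00 /= -{2}(prednK (_ : 0 < N)%N); last by lia.
  by rewrite /= big_cons.
have fn0 : (f0 == 0%N) = false by lia.
have nL : node L 0 by rewrite /node f0_L f00 leqnn /cnt eqxx.
have [sz _] := h1 L 0%N nL.
have nlb : nolab L (ct L 0%N) by have := h2 L 0%N nL; rewrite isanc_low.
pose k := minn N live.
have pop gs : Dst None ct ps (nseq N (gY Y) ++ gs) =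
   \prod_(a <- iota (pb + x) k) gY Y (mget c.1 a) *
   Dst None ct (upd2 ps L 0 (x + k)%N) (nseq (N - k) (gY Y) ++ gs).
  rewrite -{1}(subnKC (geq_minl N live : (k <= N)%N)) nseqD -catA.
  rewrite (@root_pop ct ps x) //; last by rewrite /k /live; lia.
  congr (_ * _); rewrite iotaDl big_map [LHS]big_seq [RHS]big_seq.
  apply: eq_bigr => a; rewrite mem_iota => ha.
  by rewrite (P_word hc nL) //; move: ha; rewrite /k /live; lia.
rewrite (@E_subs_safe c _ aqw _ (P * (hvd 0 Y * KK Ys
   (sh (N - k) (gY Y) (Dst None ct (upd2 ps L 0 (x + k)%N)))))) //.
- rewrite mulrCA; congr (_ * _); rewrite mulrCA; congr (_ * _).
  by rewrite -KK_scale; apply: eq_KK => gs; rewrite /sh pop.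
- by move=> a; exact: aqE.
move=> D DM; have DR := catM D DM; rewrite mulrA -big_cat /=.
case: leqP => hN.
  have kN : k = N by apply/minn_idPl.
  rewrite finishE E_ret /rcont reported_mk //; congr (_ * _).
  rewrite (HC _ _ _ _ (inv_fin (D ++ rp) (ready_upd hr (_ : (x + N <= fan L * b)%N))) (halt_fin _)).
  - by rewrite vout_fin fresh_fin kN subnn.
  - by move: hN; rewrite /live; lia.
  exact: rank_draw_fin.
have kl : k = live by apply/minn_idPr; exact: ltnW.
rewrite ?fn0 E_ret /rcont reported_mk //; congr (_ * _).
rewrite (HC _ (Label L 0 (N - live)) ct (upd2 ps L 0 0)) //.
(* A fully read root buffer and a root marked fresh both present [[::]] to [tree_law]. *)
- rewrite /= kl; congr (_ * _); apply: eq_KK => gs; rewrite /sh; apply: eq_Dst => l i.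
  rewrite /cells /upd2 /=; case: (Some (L, 0%N) =P Some (l, i)) => [[<- <-]|ne].
    by rewrite !eqxx /= drop_oversize // sz /live; lia.
  by rewrite (pair_neqF ne).
- by apply: eff_root_label hr f00 _; rewrite /live; lia.
by rewrite mul1n; apply: rank_root_label.
Qed.

Lemma prod_iota (F : nat -> R) n k :
  \prod_(a <- iota n k) F a = \prod_(t < k) F (n + t)%N.
Proof.
by rewrite -{1}(addn0 n) iotaDl big_map -{1}(subn0 k) -/(index_iota 0 k) big_mkord.
Qed.

Lemma rcont_nil c Cont sr s io :
  rcont c Cont (mk hb kq [::] sr s io) = Cont (mk hb kq [::] sr s io).
Proof. by rewrite /rcont reported_mk // big_nil mul1r. Qed.

Lemma sgr_rec s : (s < slots)%N -> sgr s Y = sgr s.+1 Y + thq * gY Y (Tw s).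
Proof. by move=> h; rewrite /sgr big_ltn // addrC. Qed.

Lemma sgr_bounds s : 0 <= sgr s Y <= (slots - s)%:R * thq.
Proof.
rewrite /sgr; apply/andP; split.
  apply: sumr_ge0 => i _; have /andP[g0 _] := gY01 Y (Tw i).
  by rewrite mulr_ge0 // ltW.
have -> : (slots - s)%:R * thq = \sum_(s <= i < slots) thq.
  by rewrite big_const_nat iter_addr_0 mulr_natl.
apply: ler_sum => i _; have /andP[_ g1] := gY01 Y (Tw i).
by rewrite ger_pMr.
Qed.

Lemma anc_ps0 l i ct ps : lab_ok (l, i) ct ps -> node l i -> ps l i = 0%N.
Proof.
by move=> h nl; have := h l i nl; rewrite /isanc leqnn subnn expn0 divn1 eqxx.
Qed.

Lemma cells_upd ct ps fr l i s l' i' : ps l i = 0%N -> fr != Some (l, i) ->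
  cells fr (upd2 ct l i s) ps l' i' = upd2 (cells fr ct ps) l i s l' i'.
Proof.
move=> p0 hfr; rewrite /cells {2}/upd2.
case: (boolP ((l' == l) && (i' == i))) => [/andP[/eqP-> /eqP->]|ne].
  by rewrite (negPf hfr) upd2_same p0 drop0.
by rewrite upd2_other.
Qed.

(** Refill rounds change the stream law only through [tree_law_labels], [tree_law_pick] and
    [tree_law_take]; saving, reloading and idle rounds leave it as it is, and the scans peel one
    factor off [hvd] or [sval]. *)
Lemma step_value c s ct ps Cont : Inv c s ct ps -> ~~ isIdle s ->
  cont_ok c (rank s ct ps) Cont ->
  E (stp (vu c) hb kq s) (rcont c Cont) = vout Y Ys s (Dst (fresh s) ct ps).
Proof.
move=> hI ni HC; have [_ hc hz [h1 h2 hm']] := hI.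
case: s ni hI HC hc hz h2 hm' => [x|s N|j x|s t x|l i N|l i N|l i d N|l i d j N|l i j N|l i j N|l i j N] // _ hI HC hc hz h2 hm'; rewrite /step.
- have [f00 sm NJ p0] := hm'; have hr : ready c ct ps 0 by split.
  rewrite E_bind -[[:: _]]/([seq (aq dl (vu c) kq a, a) | a <- [:: (1 + s %% b)%N]]).
  have aM : (1 + s %% b < M)%N.
    by apply: leq_trans zt_fits; have := ltn_pmod s b_gt0; case: zt_cases => [[-> _]|[-> -> _]]; lia.
  rewrite (@E_subs_safe c _ aqw _ (hvd 0 Y * KK Ys (sh N (gY Y) (Dst None ct ps)))).
  + by rewrite big_seq1 hz.
  + by move=> a; exact: aqE.
  + by rewrite /= aM.
  move=> D DM; apply: draw_value => //.
  by move: HC; rewrite /rank subn0 muln0 addn0 addnA.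
- have [jh xE xb] := hm'; have hr : ready c ct ps x by split.
  have ztb : (b <= zt.+1)%N by case: zt_cases => [[-> _]|[-> -> _]]; lia.
  rewrite E_fmap_fun (@E_subs_safe c _ hqw _ (hvd j.+1 Y * KK Ys (Dst None ct ps))).
  + rewrite mulrA; congr (_ * _); rewrite /hvd [RHS]big_ltn //; congr (_ * _).
    rewrite (prod_iota (fun a => 1 - hqw (mget c.1 a) * (1 - (safe Y (mget c.1 a))%:R))).
    by apply: eq_bigr => t _; rewrite hz.
  + by move=> a; exact: hqE.
  + by apply/allP => a; rewrite mem_iota => h; apply: leq_trans zt_fits; lia.
  move=> D DM; case: ltnP => hj; rewrite /rcont reported_mk //; congr (_ * _).
    rewrite (HC _ (HScan j.+1 x) ct ps) //; first exact: eff_hscan.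
    by rewrite mul1n; apply: rank_hscan.
  rewrite (HC _ (Idle x) ct ps) //=; first by rewrite /hvd big_geq // mul1r.
    exact: eff_idle.
  by rewrite mul0n addn0 /rank !subn0; lia.
- have [sm tJ xE xb] := hm'; have hr : ready c ct ps x by split.
  have aM : (1 + s %% b < M)%N.
    by apply: leq_trans zt_fits; have := ltn_pmod s b_gt0; case: zt_cases => [[-> _]|[-> -> _]]; lia.
  have rho0 : 0 <= (slots - s.+1)%:R * thq by rewrite mulr_ge0 // ltW.
  have al01 := aq01 dl (vu c) kq (1 + s %% b).
  set V := hvd 0 Y * KK Ys (Dst None ct ps).
  rewrite E_bind checkedE; last exact: valid_scan_dist.
  have repE (z : bool) : \prod_(a <- if z then [:: (1 + s %% b)%N] else [::])
      (safe Y (mget c.1 a))%:R = (z ==> safe Y (Tw s))%:R :> R.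
    by case: z; rewrite ?big_seq1 ?big_nil ?hz.
  have repM (z : bool) : all (fun a => a < M)%N (if z then [:: (1 + s %% b)%N] else [::]).
    by case: z; rewrite //= aM.
  have sE2 : sgr s Y = sgr s.+1 Y +
      thq * (1 - aq dl (vu c) kq (1 + s %% b) * (1 - (safe Y (Tw s))%:R)).
    by rewrite (sgr_rec sm) aqE hz.
  have rE : (slots - s)%:R * thq = (slots - s.+1)%:R * thq + thq.
    by rewrite -(subnSK sm) -natr1 mulrDl mul1r.
  case: ltnP => hs.
    rewrite (@eq_E_on _ _ _ _ (fun z => (z.1 ==> safe Y (Tw s))%:R *
       scan_value z.2 ((slots - s.+1)%:R * thq) (sgr s.+1 Y) * V)); last first.
      move=> z zd; rewrite E_ret /rcont reported_mk // repE -mulrA; congr (_ * _).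
      rewrite (HC _ (FScan s.+1 z.2.2 x) ct ps) //.
        apply: eff_fscan => //; apply: leq_trans tJ.
        exact: (support_scan_dist zd).
      by rewrite mul1n; apply: rank_fscan.
    rewrite E_scaler E_scan_value ?sgr_bounds //; congr (_ * _).
    by rewrite /sval sE2 rE.
  rewrite (@eq_E_on _ _ _ _ (fun z => (z.1 ==> safe Y (Tw s))%:R * V)); last first.
    move=> z zd; rewrite finishE E_ret /rcont reported_mk // repE; congr (_ * _).
    rewrite (HC _ _ _ _ (inv_fin _ hr) (halt_fin _)) ?vout_fin ?fresh_fin //.
    by apply: leq_trans (rank_fin _ _ _) _; rewrite /rank !subn0; lia.
  have sE : (slots - s.+1)%:R * thq = 0 by rewrite (_ : (slots - s.+1)%N = 0%N) ?mul0r //; lia.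
  have sg0 : sgr s.+1 Y = 0 by rewrite /sgr big_geq.
  rewrite E_scaler E_scan_last //; congr (_ * _).
  by rewrite /sval sE2 rE sg0 sE !add0r.
- have [nl NJ p0] := hm'.
  have fg : (0 < fan l)%N.
    by apply: fan_gt0; [exact: f_gt0 (node_pos nl) | rewrite -f0_L; exact: node_pos nl].
  have f1 := f_gt0 (node_pos nl).
  have f0p : (0 < f0)%N by rewrite -f0_L; exact: node_pos nl.
  rewrite E_fmap_fun (@eq_E_on _ _ _ _ (fun ds => hvd 0 Y *
    KK Ys (sh N (gY Y) (Dst None (upd2 ct l i (map mklab ds)) ps)))); last first.
    move=> y yd; have [sz al] := @support_iid_unif _ _ fg _ yd.
    rewrite rcont_nil (HC _ _ _ _ (eff_label hI sz al)) //.
    by rewrite mul1n; apply: rank_label => //; rewrite size_map.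
  rewrite E_scalel E_KK /=; congr (_ * _); apply: eq_KK => gs; rewrite /sh /Dst.
  rewrite (_ : (f0 == 0%N) = false); last by lia.
  have lL : (l <= L)%N by case/and3P: nl.
  transitivity (tree_law f f0 L b (@lab_of W S) Tw
     (upd2 (cells (Some (l, i)) ct ps) l i [::]) L 0 (nseq N (gY Y) ++ gs)); last first.
    apply: eq_tree_law => l' i'; rewrite /upd2 /cells.
    by case: ifP => // /andP[/eqP-> /eqP->]; rewrite eqxx.
  rewrite -(@tree_law_labels R _ f f0 L b (@lab_of W S) Tw f1 f0p f0_le b_gt0 mklab _ l i (fan l * b)) //.
  + apply: eq_E => ds; apply: eq_tree_law => l' i'; rewrite cells_upd //.
    rewrite /upd2 /cells; case: ifP => // ne.
    by rewrite ifF //; apply/negbTE/negP => /eqP[e1 e2]; rewrite e1 e2 !eqxx in ne.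
  + by case/and3P: nl.
  + exact: node_small.
  by move=> d df; apply: lab_mklab => //; exact: fanle.
- have [nl NJ] := hm'; rewrite (first_label_pwords hc nl h1).
  case fl : (first_label _ _) => [d|]; last first.
    case: eqP => [lE|ne].
      subst l; have i0 : i = 0%N by case/and3P: nl; rewrite /cnt eqxx; lia.
      subst i; have hr := gather_ready hI fl.
      rewrite (draw_value hr) // ?big_nil ?mul1r //.
      by move: HC; rewrite /rank subn0 muln0 addn0 /credit subnn mul0n add0n addnA.
    have lL : (l < L)%N by case/and3P: nl; lia.
    rewrite E_ret rcont_nil (HC _ _ _ _ (eff_gather_up hI fl lL)) //.
    by rewrite mul1n; apply: rank_gather_up.
  have [df cd] := first_label_some fl; case: eqP => [lE|/eqP ne].
    subst l; rewrite E_ret rcont_nil (HC _ _ _ _ (eff_gather_take1 hI fl)) //.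
    by rewrite mul1n; apply: rank_gather_take.
  have l1 : (1 < l)%N by case/and3P: nl; lia.
  rewrite (gather_counter hI l1 df); case: ltnP => hx; rewrite E_ret rcont_nil.
    rewrite (HC _ _ _ _ (eff_gather_take hI l1 fl hx)) //.
    by rewrite mul1n; apply: rank_gather_take.
  have [szc px] := h1 _ _ (node_child nl l1 df).
  have lL : (l.-1 < L)%N by case/and3P: nl; lia.
  rewrite (HC _ _ _ _ (eff_gather_down hI l1 fl)) //.
    rewrite /=; congr (_ * _); apply: eq_KK => gs; rewrite /sh; apply: eq_Dst => l' i'.
    rewrite /cells /upd2 /=; case: eqP => [[<- <-]|ne'].
      by rewrite drop_oversize // szc.
    by rewrite ifF //; apply/negbTE/negP => /andP[/eqP e1 /eqP e2]; apply: ne'; rewrite e1 e2.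
  rewrite mul1n; apply: rank_gather_down => //.
  by rewrite (fan_lt lL) in px hx; lia.
- have [nl NJ df cd px] := hm'.
  have f1 := f_gt0 (node_pos nl).
  have f0p : (0 < f0)%N by rewrite -f0_L; exact: node_pos nl.
  have fn0 : (f0 == 0%N) = false by lia.
  have p0 := anc_ps0 h2 nl.
  case: eqP => [lE|/eqP ne].
    subst l; rewrite E_fmap_fun (@eq_E_on _ _ _ _ (fun ts => hvd 0 Y *
      KK Ys (sh N (gY Y) (Dst None (upd2 ct 1 i (fillm (lmask (@lab_of W S (fan 1)) d (ct 1%N i))
       [seq Tw ((i * f + d) * b + t) | t <- ts] (ct 1%N i))) ps)))); last first.
      move=> y yd; have [sz al] := @support_iid_unif _ _ b_gt0 _ yd.
      rewrite rcont_nil (HC _ _ _ _ (eff_take1 hI sz al)) //.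
      rewrite mul1n; apply: rank_take1 => //.
        by rewrite size_map sz -(h1 _ _ nl).1; exact: lcount_le.
      move=> w wy; have [t [<- _]] := In_map wy.
      by apply: Tw_nolab; exact: fanle.
    rewrite E_scalel E_KK /=; congr (_ * _); apply: eq_KK => gs; rewrite /sh /Dst fn0.
    have cE : cells None ct ps 1%N i = ct 1%N i by rewrite /cells p0 drop0.
    rewrite -(@tree_law_pick R _ f f0 L b (@lab_of W S) Tw f1 f0p f0_le b_gt0 _ i d (fan 1 * b)) //.
    + by apply: eq_E => ts; apply: eq_tree_law => l' i'; rewrite cells_upd // cE.
    + exact: node_pos nl.
    + exact: node_small nl.
    + exact: leq_trans df (fanle _).
    + by move=> s'; apply: Tw_nolab; exact: fanle.
    by rewrite cE -(h1 _ _ nl).1; exact: lcount_le.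
  have l1 : (1 < l)%N by case/and3P: nl; lia.
  have [vE hI'] := eff_take hI l1.
  rewrite vE (lmask_pwords _ hc nl h1) -/(take_count l i d ct ps) E_ret rcont_nil.
  have [xk szc] := take_count_le (And3 h1 h2 hm' : wf (Take l i d N) ct ps) l1.
  have tsz : size (take_items l i d ct ps) = take_count l i d ct ps.
    by rewrite size_takel // size_drop szc; lia.
  rewrite (lmask_pwords _ hc nl h1) in hI'; rewrite (HC _ _ _ _ hI') //; last first.
    by rewrite mul1n; apply: rank_take => // y /(take_nolab hI l1)[].
  rewrite /=; congr (_ * _); apply: eq_KK => gs; rewrite /sh /Dst fn0.
  case: l {ne} l1 nl df cd px hI hI' HC hc hz h2 hm' p0 vE xk szc tsz => // l l1 nl df cd px hI hI' HC hc hz h2 hm' p0 vE xk szc tsz.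
  have cE : cells None ct ps l.+1 i = ct l.+1 i by rewrite /cells p0 drop0.
  have nc := node_child nl l1 df.
  have lL : (l < L)%N by case/and3P: nl.
  rewrite -(@tree_law_take R _ f f0 L b (@lab_of W S) Tw f1 f0p f0_le b_gt0 (cells None ct ps) l i d
     (take_items l.+1 i d ct ps)
     (drop (ps l (i * f + d)%N + take_count l.+1 i d ct ps) (ct l (i * f + d)%N))) //.
  + apply: eq_tree_law => l' i'; rewrite cE {1}/cells.
    case: (boolP ((l' == l) && (i' == (i * f + d)%N))) => [/andP[/eqP-> /eqP->]|ne].
      rewrite upd2_same [RHS]upd2_same [in LHS]upd2_other //.
      by rewrite (_ : (l == l.+1) = false) //; lia.
    rewrite [X in drop X _]upd2_other // [RHS]upd2_other //.
    case: (boolP ((l' == l.+1) && (i' == i))) => [/andP[/eqP-> /eqP->]|ne2].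
      by rewrite !upd2_same p0 drop0.
    by rewrite !upd2_other.
  + exact: node_small nl.
  + exact: leq_trans df (fanle _).
  + rewrite /cells /take_items [(ps l _ + take_count _ _ _ _ _)%N]addnC -drop_drop.
    by rewrite cat_take_drop.
  + by move=> y /(take_nolab hI l1).
  by rewrite cE tsz geq_minr.
- have [nl NJ /andP[l1 df] jf p0] := hm'; rewrite E_ret rcont_nil.
  have := eff_saved hI; have := rank_saved N ct ps nl l1 df jf.
  by case: ltnP => _ h1' h2'; rewrite (HC _ _ _ _ h2') // mul1n.
- have [nl NJ lL jf] := hm'; rewrite E_ret rcont_nil.
  have := eff_saveu hI; have := rank_saveu N ct ps nl lL jf.
  by case: ltnP => _ h1' h2'; rewrite (HC _ _ _ _ h2') // mul1n.
- have [nl NJ lL jf p0] := hm'; rewrite E_ret rcont_nil.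
  have := eff_restd hI; have := rank_restd i N ct ps jf.
  by case: ltnP => _ h1' h2'; rewrite (HC _ _ _ _ h2') // mul1n.
have [nl NJ jf] := hm'; rewrite E_ret rcont_nil.
have := eff_restu hI; have := rank_restu i N ct ps jf.
by case: ltnP => _ h1' h2'; rewrite (HC _ _ _ _ h2') // mul1n.
Qed.

Lemma idle_value c x ct ps Cont : Inv c (Idle x) ct ps ->
  (forall N, (N <= J.+1)%N -> cont_ok c (idle_rank x ct ps N) Cont) ->
  E (stp (vu c) hb kq (Idle x)) (rcont c Cont) = KK (Y :: Ys) (Dst None ct ps).
Proof.
move=> hI HC; have hr := inv_ready hI; have [[hst _] _ _ _ _] := hr.
have hs1 : forall t, (t < hm)%N -> mget c.1 (hbase + t) = hw t by case: hst.
have rt0 : 0 <= rt by rewrite mulr_ge0 // ltW.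
rewrite /step E_bind (@E_subs_safe c _ hqw (iota hbase hm)
  (hvd 0 Y * (\sum_(N < J.+1) pois rt N * KK Ys (sh N (gY Y) (Dst None ct ps)) +
      tail J.+1 rt * sval 0 J.+1 Y * KK Ys (Dst None ct ps)))).
- rewrite [RHS]/=; congr (_ * _).
  rewrite (prod_iota (fun a => 1 - hqw (mget c.1 a) * (1 - (safe Y (mget c.1 a))%:R))).
  by apply: eq_bigr => t _; rewrite hs1.
- by move=> a; exact: hqE.
- apply/allP => a; rewrite mem_iota => h; apply: leq_trans mem_fits.
  by rewrite /cb /pb; lia.
move=> D DM; rewrite E_bind checkedE; last exact: valid_count_dist.
rewrite E_count_dist eqxx E_ret /rcont reported_mk //.
set P := \prod_(a <- D) _.
have h0 : Inv (nxt (mk hb kq D keep (FScan 0 J.+1 x) (rdT (0 %/ b))) c) (FScan 0 J.+1 x) ct ps.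
  by apply: eff_fscan.
rewrite div0n in h0; rewrite (HC J.+1 (leqnn _) _ _ _ _ h0) //; last first.
  rewrite mul1n /rank /idle_rank eqxx subn0.
  have : (b * (slots - 1) + b = b * slots)%N by rewrite -mulnSr subn1 prednK.
  by lia.
rewrite [vout _ _ _ _]/= !mulrDr; congr (_ + _); last by ring.
rewrite !big_distrr; apply: eq_bigr => N _ /=.
have NJ := ltn_ord N; rewrite (_ : (N == J.+1 :> nat) = false); last by lia.
have := @draw_value c ct ps x D N Cont hr _ DM; rewrite /rcont => ->; first by rewrite -/P; ring.
  by [].
have := HC N (ltnW NJ); rewrite /idle_rank (_ : (N == J.+1 :> nat) = false); last by lia.
by rewrite addnAC.
Qed.

Notation PQm := (PQ p pdst rank_max).
Notation PVm := (PV p pdst).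

Section Run.
Hypothesis PQ_Ys : forall c x ct ps, Inv c (Idle x) ct ps ->
  (PQm Ys c).[1] = KK Ys (Dst None ct ps).

Lemma PV_vout k c s ct ps : Inv c s ct ps -> ~~ isIdle s -> (rank s ct ps < k)%N ->
  (PVm k c Y (PQm Ys)).[1] = vout Y Ys s (Dst (fresh s) ct ps).
Proof.
elim: k c s ct ps => [|k IH] c s ct ps // hI ni rk.
rewrite PV_value (pdistE hI).
apply: (@step_value c s ct ps (fun a => if is_halt a.2 then (PQm Ys (nxt a c)).[1]
   else (PVm k (nxt a c) Y (PQm Ys)).[1]) hI ni).
move=> a s' ct' ps' hI' hh hr; rewrite hh.
case: (boolP (isIdle s')) => [is1|is0].
  by case: s' is1 hI' {hh hr} => // x _ hI'; exact: PQ_Ys hI'.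
by apply: IH => //; have hb0 := b_gt0; rewrite is0 /= mul1n in hr; lia.
Qed.

Lemma PQ_cons_value c x ct ps : Inv c (Idle x) ct ps ->
  (PQm (Y :: Ys) c).[1] = KK (Y :: Ys) (Dst None ct ps).
Proof.
move=> hI.
change (PQm (Y :: Ys) c) with (PVm rank_max.-1.+1 c Y (PQm Ys)).
rewrite PV_value (pdistE hI).
apply: (@idle_value c x ct ps (fun a => if is_halt a.2 then (PQm Ys (nxt a c)).[1]
   else (PVm rank_max.-1 (nxt a c) Y (PQm Ys)).[1]) hI).
move=> N NJ a s' ct' ps' hI' hh hr; rewrite hh.
case: (boolP (isIdle s')) => [is1|is0].
  by case: s' is1 hI' {hh hr} => // x' _ hI'; exact: PQ_Ys hI'.
apply: PV_vout => //; have hb0 := b_gt0; rewrite is0 /= mul1n in hr.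
by have := idle_rank_max hI NJ; move: rank_max => rm; lia.
Qed.

End Run.
End Value.

Lemma PQ_value Ys c x ct ps : Inv c (Idle x) ct ps ->
  (PQ p pdst rank_max Ys c).[1] = KK Ys (Dst None ct ps).
Proof.
elim: Ys c x ct ps => [|Y Ys IH] c x ct ps hI; last first.
  by apply: PQ_cons_value hI => c' x' ct' ps' hI'; exact: IH hI'.
rewrite /= hornerC /Dst; case: eqP => _; first by rewrite big_nil.
by rewrite tree_law_nil.
Qed.

(** For an i.i.d. stream with passing probability [m] per sample, the counts [N <= J] give
    [expR (- (rt - rt * m))] times the Poisson mass of rate [rt * m] up to [J], and the lumped event
    gives exactly the missing tail. Hence the cut-off [J] disappears from the law. *)
Lemma KK_prod Ys : KK Ys (fun gs => \prod_(g <- gs) meanT g) =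
  \prod_(Y <- Ys) (hvm Y * (hvd 0 Y * expR (- (rt - sgr 0 Y)))).
Proof.
elim: Ys => [|Y Ys IH]; first by rewrite /= !big_nil.
rewrite [LHS]/= big_cons -IH -!mulrA; congr (_ * (_ * _)).
have s0 : slots%:R != 0 :> R by rewrite pnatr_eq0 -lt0n.
have rt0 : 0 < rt by rewrite mulr_gt0 // ltr0n.
set KT := KK Ys _; set m := meanT (gY Y).
have mE : rt * m = sgr 0 Y.
  rewrite /rate /m /meanT /sgr big_mkord -big_distrr /=.
  by rewrite mulrACA mulfV // mul1r.
rewrite (eq_bigr (fun N : 'I_J.+1 => expR (- (rt - sgr 0 Y)) * pois (sgr 0 Y) N * KT)).
  rewrite -big_distrl /= -big_distrr /= /sval /scan_value subn0 -/rt.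
  have t0 : tail J.+1 rt != 0 by rewrite gt_eqF // tail_gt0.
  have -> : \sum_(i < J.+1) pois (sgr 0 Y) i = 1 - tail J.+1 (sgr 0 Y) by rewrite /tail; ring.
  by field.
move=> N _; rewrite (@eq_KK Ys _ (fun gs => m ^+ N * \prod_(g <- gs) meanT g)); last first.
  by move=> gs; rewrite /sh big_cat big_nseq iter_mulr_1.
rewrite KK_scale -/KT mulrA; congr (_ * _); rewrite /pois opprB -mE [(rt * m) ^+ _]exprMn !expRD !expRN.
have e0 : expR (rt * m) != 0 by rewrite gt_eqF // expR_gt0.
have e1 : expR rt != 0 by rewrite gt_eqF // expR_gt0.
have e2 : N`!%:R != 0 :> R by rewrite pnatr_eq0 -lt0n fact_gt0.
move: e0 e1 e2; move: (expR (rt * m)) (expR rt) (N`!%:R : R) (rt ^+ N) (m ^+ N) => E0 E1 F a c e0 e1 e2.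
by field; rewrite ?e0 ?e1 ?e2.
Qed.

(** Heavy blocks, the price of the expected number of samples, and a scan of the whole table
    weighted by the probability of the lumped event. *)
Definition unitc : R := hb%:R + wN%:R * rt / b%:R + slots%:R * tail J.+1 rt.

(** * Amortized expected cost of a query *)

Section Cost.
Variables (q : nat) (bd : R).
Notation PQq := (PQ p pdst rank_max (nseq q [set: S])).
Hypothesis PQ_q : forall c x ct ps, Inv c (Idle x) ct ps ->
  (PQq c)^`().[1] <= (rank (Idle x) ct ps)%:R / b%:R + bd.

Lemma leaf_cost k c rk : (forall c s ct ps, Inv c s ct ps -> ~~ isIdle s ->
    (rank s ct ps < k)%N ->
    (PV p pdst k c [set: S] PQq)^`().[1] <= (rank s ct ps)%:R / b%:R + bd) ->
  (rk <= k)%N -> forall a, leaf c rk a ->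
  (if is_halt a.2 then (PQq (nxt a c))^`().[1] else
     1 + (PV p pdst k (nxt a c) [set: S] PQq)^`().[1]) <= rk%:R / b%:R + bd.
Proof.
move=> H rkk a [s [ct [ps [hI hh hr]]]]; rewrite hh.
have b0 : 0 < b%:R :> R by rewrite ltr0n.
case: (boolP (isIdle s)) => [is1|is0].
  case: s is1 hI hr {hh} => // x _ hI hr; apply: le_trans (PQ_q hI) _.
  by rewrite lerD2r ler_pM2r ?invr_gt0 // ler_nat; move: hr; rewrite /= mul0n addn0.
rewrite is0 mul1n in hr; have hb0 := b_gt0.
apply: le_trans (_ : 1 + ((rank s ct ps)%:R / b%:R + bd) <= _).
  by rewrite lerD2l; apply: H => //; lia.
have -> : 1 + ((rank s ct ps)%:R / b%:R + bd) = (rank s ct ps + b)%:R / b%:R + bd.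
  by rewrite natrD; field; exact: lt0r_neq0.
by rewrite lerD2r ler_pM2r ?invr_gt0 // ler_nat.
Qed.

Lemma PV_cost_le k c s ct ps : Inv c s ct ps -> ~~ isIdle s -> (rank s ct ps < k)%N ->
  (PV p pdst k c [set: S] PQq)^`().[1] <= (rank s ct ps)%:R / b%:R + bd.
Proof.
elim: k c s ct ps => [|k IH] c s ct ps // hI ni rk.
rewrite (@PV_cost _ _ _ _ _ _ p pdst InvP RdP rank_max _ RdP_InvP InvP_step RdP_stops); first last.
- exact: stops_rank hI ni rk.
- by exists s, ct, ps.
- exact: valid_pdist.
rewrite (pdistE hI).
have v : fd_valid (stp (vu c) hb kq s) by exact: valid_step.
rewrite -[leRHS](E_cst _ v); apply: (le_E_on v) => a ha.
by apply: leaf_cost => //; exact: (step_leaf hI ni ha).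
Qed.

Lemma PQ_cost_step c x ct ps : Inv c (Idle x) ct ps ->
  (PQ p pdst rank_max (nseq q.+1 [set: S]) c)^`().[1] <=
  (rank (Idle x) ct ps)%:R / b%:R + (bd + unitc).
Proof.
move=> hI; have b0 : 0 < b%:R :> R by rewrite ltr0n.
have rt0 : 0 <= rt by rewrite mulr_ge0 // ltW.
change (PQ p pdst rank_max (nseq q.+1 [set: S]) c) with
  (PV p pdst rank_max.-1.+1 c [set: S] PQq).
rewrite (@PV_cost _ _ _ _ _ _ p pdst InvP RdP rank_max _ RdP_InvP InvP_step RdP_stops); first last.
- by apply: (@RdP_stops c); exists x, ct, ps.
- by exists (Idle x), ct, ps.
- exact: valid_pdist.
rewrite (pdistE hI) /step E_bind.
set F := fun a : act => _.
have vs : fd_valid (subs [seq (hq (vu c) a, a) | a <- iota hbase hm]).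
  by apply: valid_subs_map; exact: hq01.
rewrite -[leRHS](E_cst _ vs); apply: (le_E_on vs) => S0 _ /=.
rewrite E_bind checkedE; last exact: valid_count_dist.
rewrite E_count_dist.
set A : R := (Phi ps + Pend ct + wgt L * x + b * hb)%:R / b%:R + bd.
have HN N : (N <= J.+1)%N ->
    E (if N == J.+1 then ret R (mk hb kq S0.2 keep (FScan 0 J.+1 x) (rdT 0))
       else drw (vu c) hb kq S0.2 N x) F <=
    A + (if N == J.+1 then b * slots else wN * N)%:R / b%:R.
  move=> NJ.
  have v : fd_valid (if N == J.+1 then ret R (mk hb kq S0.2 keep (FScan 0 J.+1 x) (rdT 0))
       else drw (vu c) hb kq S0.2 N x).
    by case: ifP => _; [exact: valid_ret | exact: valid_draw].
  rewrite -[leRHS](E_cst _ v); apply: (le_E_on v) => a ha.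
  rewrite /A addrAC -mulrDl -natrD -/(idle_rank x ct ps N).
  apply: leaf_cost; first exact: PV_cost_le.
    by have := idle_rank_max hI NJ; move: rank_max => rm; lia.
  exact: (idle_leaf hI NJ ha).
apply: le_trans (_ : \sum_(N < J.+1) pois rt N * (A + wN%:R / b%:R * N%:R) +
  tail J.+1 rt * (A + slots%:R) <= _).
  apply: lerD.
    apply: ler_sum => N _; apply: ler_wpM2l; first exact: pois_ge0.
    have NJ := ltn_ord N; apply: le_trans (HN N (ltnW NJ)) _.
    rewrite (_ : (N == J.+1 :> nat) = false); last by lia.
    by rewrite natrM mulrAC.
  apply: ler_wpM2l; first exact: tail_ge0.
  apply: le_trans (HN _ (leqnn _)) _; rewrite eqxx natrM mulrAC mulfV ?mul1r //.
  exact: lt0r_neq0.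
have -> : \sum_(N < J.+1) pois rt N * (A + wN%:R / b%:R * N%:R) =
   (\sum_(N < J.+1) pois rt N) * A + wN%:R / b%:R * \sum_(N < J.+1) pois rt N * N%:R.
  by rewrite big_distrl big_distrr -big_split; apply: eq_bigr => N _ /=; ring.
have -> : \sum_(N < J.+1) pois rt N = 1 - tail J.+1 rt by rewrite /tail; ring.
have hm1 : wN%:R / b%:R * (\sum_(N < J.+1) pois rt N * N%:R) <= wN%:R / b%:R * rt.
  by apply: ler_wpM2l; [rewrite divr_ge0 | exact: pois_mean_le].
have -> : rank (Idle x) ct ps = (Phi ps + Pend ct + wgt L * x)%N by rewrite /rank subn0.
have AE : A = (Phi ps + Pend ct + wgt L * x)%:R / b%:R + hb%:R + bd.
  by rewrite /A natrD mulrDl natrM [b%:R * _ / _]mulrAC mulfV ?mul1r // lt0r_neq0.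
rewrite /unitc; move: AE hm1; set Z := _ / b%:R; set X := \sum_(N < J.+1) _.
set w1 := wN%:R / b%:R; have -> : wN%:R * rt / b%:R = w1 * rt by rewrite /w1 mulrAC.
move=> -> h; apply: le_trans (_ : (Z + hb%:R + bd) + w1 * X + slots%:R * tail J.+1 rt <= _).
  by rewrite le_eqVlt; apply/orP; left; apply/eqP; ring.
by lra.
Qed.

End Cost.

Lemma PQ_cost q c x ct ps : Inv c (Idle x) ct ps ->
  (PQ p pdst rank_max (nseq q [set: S]) c)^`().[1] <=
  (rank (Idle x) ct ps)%:R / b%:R + q%:R * unitc.
Proof.
elim: q c x ct ps => [|q IH] c x ct ps hI.
  by rewrite [PQ _ _ _ _ _]/= derivC horner0 mul0r addr0 divr_ge0.
rewrite -natr1 mulrDl mul1r; exact: PQ_cost_step hI.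
Qed.

(** * The initial configuration *)

Lemma sum_weights (T : finType) (d : fd R T) F :
  \sum_c (\sum_(x <- d) x.1 * (x.2 == c)%:R) * F c = E d F.
Proof.
rewrite (eq_bigr (fun c => \sum_(x <- d) x.1 * (x.2 == c)%:R * F c)); last first.
  by move=> c _; rewrite big_distrl.
rewrite exchange_big; apply: eq_bigr => x _ /=.
rewrite (bigD1 x.2) //= eqxx mulr1 big1 ?addr0 // => c /negPf ne.
by rewrite eq_sym ne mulr0 mul0r.
Qed.

Lemma weight_neq0 (T : finType) (d : fd R T) c :
  \sum_(x <- d) x.1 * (x.2 == c)%:R != 0 -> exists x, List.In x d /\ x.2 = c.
Proof.
elim: d => [|x d IH]; first by rewrite big_nil eqxx.
rewrite big_cons; case: (x.2 =P c) => [e _|_]; first by exists x; split; [left|].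
by rewrite mulr0 add0r => /IH[y [yd e]]; exists y; split; [right|].
Qed.

Lemma weights_distribution (T : finType) (d : fd R T) : fd_valid d ->
  is_distribution (fun c => \sum_(x <- d) x.1 * (x.2 == c)%:R).
Proof.
move=> [d0 d1]; split=> [c|]; last first.
  have := sum_weights d (fun=> 1); rewrite /E.
  rewrite (eq_bigr _ (fun c _ => mulr1 _)) => ->.
  by rewrite -[RHS]d1; apply: eq_bigr => x _; rewrite mulr1.
elim: d d0 {d1} => [|x d IH] d0; first by rewrite big_nil.
rewrite big_cons addr_ge0 //; first by rewrite mulr_ge0 // d0 //; left.
by apply: IH => y yd; apply: d0; right.
Qed.

Notation fillsT := (@fills R wordT f f0 L b Tw).

Lemma support_fills ns ct : on_support (fillsT ns ct) (fun ct' => forall l i,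
  if (l, i) \in ns then exists2 ys, ct' l i = map Tw ys & size ys = (fan l * b)%N
  else ct' l i = ct l i).
Proof.
elim: ns ct => [|n ns IH] ct; first by apply/support_ret.
apply: support_bind => ys hys; rewrite -/fills.
have sz : size ys.2 = (fan n.1 * b)%N.
  by have [//|] := @support_iid R _ _ _ predT _ _ hys.
move=> x hx l i; have := IH _ x hx l i; rewrite inE.
case: (boolP ((l, i) \in ns)) => _; first by rewrite orbT.
rewrite orbF => ->; rewrite /upd2.
case: n sz {hys hx} => l0 i0 /= sz; rewrite xpair_eqE.
case: (boolP ((l == l0) && (i == i0))) => [hh|//]; exists ys.2 => //.
by rewrite sz; have /andP[/eqP-> _] := hh.
Qed.

(** Sorted by decreasing level, the top-down order required by [E_fills]. *)
Definition node_list : seq (nat * nat) :=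
  sort (fun n n' => n'.1 <= n.1)%N
    (undup [seq (l, i) | l <- iota 1 L, i <- iota 0 (cnt l)]).

Lemma mem_node_list l i : ((l, i) \in node_list) = node l i.
Proof.
rewrite mem_sort mem_undup; apply/allpairsPdep/and3P => [[l' [i' [hl hi [-> ->]]]]|[h1 h2 h3]].
  by move: hl hi; rewrite !mem_iota => hl hi; split; lia.
by exists l, i; rewrite !mem_iota; split=> //; lia.
Qed.

Definition init_mem (ct : nat -> nat -> seq wordT) : mem :=
  [ffun x : 'I_M => if x == 0 :> nat then inr (wd (code hb kq (Idle 0)))
    else if (hbase <= x < pb)%N then hw (x - hbase)
    else if (pb <= x < cb)%N then nth nullw (ct L 0%N) (x - pb)
    else inr (wd 0)].

(** The [pick] inverts the address map [addrA]. Truncating by [minn j b.-1] repeats the last useful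
    word, so that for [b = 1] the single cell hit through [zmap] gets a definite value. *)
Definition init_disk (ct : nat -> nat -> seq wordT) : dsk :=
  [ffun be : 'I_K => [ffun j : 'I_B =>
    if (be < tb)%N then Tw (be * b + minn j b.-1)
    else if (be < tb + hmax)%N then hw (hm + (be - tb) * b + minn j b.-1)
    else if [pick z : 'I_L.+1 * 'I_K |
        [&& (z.1 < L)%N, (z.2 < cnt z.1)%N & be == bk (addrA z.1 z.2)]] is Some z then
      if (j < b)%N then nth nullw (ct z.1.+1 (z.2 %/ f)%N) ((z.2 %% f) * b + j)
      else inr (wd 0)
    else inr (wd 0)]].

Definition init_cfg ct : cfg := (init_mem ct, init_disk ct).

Lemma mget_init ct a : (a < M)%N -> mget (init_mem ct) a =
  if a == 0%N then inr (wd (code hb kq (Idle 0)))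
  else if (hbase <= a < pb)%N then hw (a - hbase)
  else if (pb <= a < cb)%N then nth nullw (ct L 0%N) (a - pb) else inr (wd 0).
Proof. by move=> aM; rewrite /mget ffunE /cl inordK. Qed.

Lemma init_P ct j : (j < f * b)%N -> mget (init_mem ct) (pb + j) = nth nullw (ct L 0%N) j.
Proof.
move=> jf; have hM := mem_fits; rewrite /cb /pb /hbase in hM *.
rewrite mget_init; last by lia.
rewrite (_ : (zt.+2 + hm + j == 0)%N = false); last by lia.
rewrite /cb /pb /hbase (_ : (_ <= _ < zt.+2 + hm)%N = false); last by lia.
by rewrite ifT; [congr nth; lia | lia].
Qed.

Lemma init_C ct d : (d < f)%N -> mget (init_mem ct) (cb + d) = inr (wd 0).
Proof.
move=> df; have hM := mem_fits; rewrite /cb /pb /hbase in hM *.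
rewrite mget_init; last by lia.
rewrite (_ : (zt.+2 + hm + f * b + d == 0)%N = false); last by lia.
rewrite /cb /pb /hbase (_ : (_ <= _ < zt.+2 + hm)%N = false); last by lia.
by rewrite ifF //; lia.
Qed.

Lemma init_H ct t : (t < hm)%N -> mget (init_mem ct) (hbase + t) = hw t.
Proof.
move=> tm; have hM := mem_fits; rewrite /cb /pb /hbase in hM *.
rewrite mget_init; last by lia.
rewrite (_ : (zt.+2 + t == 0)%N = false); last by lia.
by rewrite /pb /hbase ifT; [congr hw; lia | lia].
Qed.

Lemma disk_init ct l i (j : 'I_B) : (l < L)%N -> (i < cnt l)%N ->
  init_disk ct (bk (addrA l i)) j =
  if (j < b)%N then nth nullw (ct l.+1 (i %/ f)%N) ((i %% f) * b + j) else inr (wd 0).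
Proof.
move=> lL ic; have aK := addrA_lt lL ic.
rewrite !ffunE {1 2}/bk inordK //.
rewrite (_ : (addrA l i < tb)%N = false); last by rewrite /addrA; lia.
rewrite (_ : (addrA l i < tb + hmax)%N = false); last by rewrite /addrA; lia.
case: pickP => [z /and3P[z1 z2 /eqP ze]|/(_ (inord l, inord i))].
  by have [<- <-] := addrA_inj lL ic z1 z2 ze.
have iK : (i < K)%N by move: aK; rewrite /addrA; lia.
by rewrite /= !inordK // ?lL ?ic ?eqxx //; lia.
Qed.

Lemma init_inv ct : (forall l i, node l i ->
    exists2 ys, ct l i = map Tw ys & size ys = (fan l * b)%N) ->
  Inv (init_cfg ct) (Idle 0) ct (fun _ _ => 0%N).
Proof.
move=> hct; have kf := disk_fits; have hl := hb_le.
split=> //.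
- by rewrite mget_init.
- split; last first.
    move=> l i d nl df /=; case: (eqVneq (Some (L, 0%N)) (Some (l, i))) => [[<- <-]|ne].
      have hd : (d < f)%N by apply: leq_trans df (fanle _).
      split=> [t tb0|]; last by rewrite init_C.
      by rewrite -addnA init_P //; exact: leq_div_add_mul.
    have hd : (d < f)%N by apply: leq_trans df (fanle _).
    have [l0 lL _] := and3P nl; have [_ bB] := zt_b (node_pos nl).
    have hc := cnt_child nl df.
    have l1L : (l.-1 < L)%N by lia.
    split=> [t tb0|]; rewrite /= disk_init //; last by rewrite inordK ?ltnn.
    rewrite inordK; last by lia.
    by rewrite tb0 prednK // node_child_parent // modnMDl modn_small.
  split=> [t tm|be j hbe|j j' hj] /=.
  + exact: init_H.
  + rewrite !ffunE /bk inordK; last by lia.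
    by rewrite hbe.
  rewrite !ffunE /bk inordK; last by lia.
  rewrite ifF; last by lia.
  rewrite ifT; last by lia.
  by rewrite addKn.
split=> //.
- by move=> l i nl; have [ys -> sz] := hct _ _ nl; rewrite size_map sz.
move=> l i nl; have [ys -> sz] := hct _ _ nl.
rewrite isanc_low; last by case/and3P: nl; lia.
by rewrite /nolab all_map; apply/allP => s _ /=; rewrite Tw_nolab // fanle.
Qed.

(** No label is pending and nothing has been consumed, so the first queries need no advance
    payment. *)
Lemma init_rank ct : (forall l i, node l i ->
    exists2 ys, ct l i = map Tw ys & size ys = (fan l * b)%N) ->
  rank (Idle 0) ct (fun _ _ => 0%N) = 0%N.
Proof.
move=> hct; have n0 : nodeSum (fun _ _ => 0%N) = 0%N.
  by apply: big1 => l _; apply: big1 => i _; case: ifP.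
have hP : (Phi (fun _ _ => 0) <= nodeSum (fun _ _ => 0))%N.
  apply: leq_nodeSum => l i nl.
  by case: ifP => // _; rewrite /own muln0 mod0n.
have hE : (Pend ct <= nodeSum (fun _ _ => 0))%N.
  apply: leq_nodeSum => l i nl.
  have [ys -> _] := hct _ _ nl; rewrite /pend leqn0; apply/eqP/big1 => d _.
  rewrite (_ : lcount _ _ _ = 0%N); first by rewrite /pend1 /= !muln0.
  rewrite /lcount /lmask !count_map; apply/eqP.
  rewrite -leqn0 leqNgt -has_count; apply/negP => /hasP[s _] /=.
  by rewrite Tw_nolab // fanle.
by rewrite n0 in hP hE; rewrite /rank muln0 subn0 addn0; lia.
Qed.

Definition init_fd : fd R cfg := fmap init_cfg (fillsT node_list (fun _ _ => [::])).

Lemma valid_init : fd_valid init_fd.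
Proof. by apply: valid_fmap; exact: valid_fills. Qed.

Lemma support_init (P : (nat -> nat -> seq wordT) -> Prop) :
  (forall ct, (forall l i, node l i ->
     exists2 ys, ct l i = map Tw ys & size ys = (fan l * b)%N) -> P ct) ->
  on_support (fillsT node_list (fun _ _ => [::])) P.
Proof.
move=> H x hx; apply: H => l i nl.
by have := support_fills hx l i; rewrite mem_node_list nl.
Qed.

Lemma E_init Ys : E init_fd (fun c => (PQ p pdst rank_max Ys c).[1]) =
  \prod_(Y <- Ys) (hvm Y * (hvd 0 Y * expR (- (rt - sgr 0 Y)))).
Proof.
rewrite E_fmap_fun (@eq_E_on _ _ _ _ (fun ct => KK Ys (Dst None ct (fun _ _ => 0%N)))); last first.
  by apply: support_init => ct hct; apply: PQ_value; exact: init_inv hct.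
rewrite E_KK -KK_prod; apply: eq_KK => gs; rewrite /Dst.
case: eqP => [_|/eqP fn0]; first by rewrite E_cst //; exact: valid_fills.
have f0p : (0 < f0)%N by lia.
have L0 : (0 < L)%N by rewrite f0_L.
have f1 := f_gt0 L0.
rewrite (@eq_E _ _ _ _ (fun ct => tree_law f f0 L b (@lab_of W S) Tw ct L 0 gs)); last first.
  by move=> ct; apply: eq_tree_law => l i; rewrite /cells /= drop0.
rewrite E_fills //.
- rewrite tree_law_empty //; apply: eq_bigr => g _; rewrite root_meanE // /meanT.
  rewrite /slots tb_cnt // /cnt ifF; last by lia.
  by rewrite subn0 -mulnA.
- by rewrite sort_uniq undup_uniq.
- by apply: sort_sorted => n n'; exact: leq_total.
- move=> [l i]; rewrite mem_node_list => nl; have [l0 lL _] := and3P nl.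
  by split=> //; exact: node_small.
by move=> l s; apply: Tw_nolab; exact: fanle.
Qed.

Theorem machine_main (bound : R) :
  (forall Y, hvm Y * (hvd 0 Y * expR (- (rt - sgr 0 Y))) =
     \prod_(v in ~: Y) (1 - p v)) ->
  unitc <= bound ->
  exists init : cfg -> R, [/\ is_distribution init,
    answers_subset_sampling (prog_of pdst) p init &
    amortized_expected_cost (prog_of pdst) p init bound].
Proof.
move=> HY Hb; exists (fun c => \sum_(x <- init_fd) x.1 * (x.2 == c)%:R).
have Rd0 c : \sum_(x <- init_fd) x.1 * (x.2 == c)%:R != 0 -> RdP c.
  move=> /weight_neq0[x [hx <-]]; have [y [<- hy]] := In_map hx.
  exists 0%N, y.2, (fun _ _ => 0%N); apply: init_inv => l i nl.
  by have := support_fills hy l i; rewrite mem_node_list nl.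
split.
- exact: weights_distribution valid_init.
- apply: (@answers_of_value _ _ _ _ _ _ p pdst InvP RdP rank_max RdP_InvP InvP_step RdP_stops _ Rd0) => Ys.
  by rewrite sum_weights E_init; apply: eq_bigr => Y _; exact: HY.
apply: (@cost_of_deriv _ _ _ _ _ _ p pdst InvP RdP rank_max RdP_InvP InvP_step RdP_stops _ Rd0) => q.
rewrite sum_weights E_fmap_fun.
have v := @valid_fills R wordT f f0 L b Tw node_list (fun _ _ => [::]).
rewrite -[leRHS](E_cst _ v); apply: (le_E_on v); apply: support_init => ct hct.
apply: le_trans (PQ_cost q (init_inv hct)) _.
by rewrite init_rank // mul0r add0r ler_wpM2l.
Qed.

(** Table and heavy area are padded with [nullw], whose contribution is neutral. *)
Lemma big_nth_pad (idx : R) (op : Monoid.law idx) (F : wordT -> R) xs n :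
  F nullw = idx -> (size xs <= n)%N ->
  \big[op/idx]_(t < n) F (nth nullw xs t) = \big[op/idx]_(w <- xs) F w.
Proof.
move=> F0 sz; rewrite (big_nth nullw) -(big_mkord xpredT (fun t => F (nth nullw xs t))).
rewrite (@big_cat_nat _ _ _ (size xs)) //= [X in op _ X]big_nat_cond [X in op _ X]big1 ?Monoid.mulm1 //.
by move=> t /andP[/andP[ht _] _]; rewrite nth_default.
Qed.

Lemma prod_ord_mul (F : nat -> R) m k :
  \prod_(s < m * k) F s = \prod_(0 <= d < m) \prod_(t < k) F (d * k + t)%N.
Proof.
elim: m => [|m IH]; first by rewrite mul0n big_ord0 big_geq.
by rewrite mulSn addnC big_split_ord IH big_nat_recr.
Qed.

Lemma heavy_total Y : hvm Y * hvd 0 Y = \prod_(t < hm + hb * b) hY Y (hw t).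
Proof.
rewrite big_split_ord; congr (_ * _).
rewrite [RHS](prod_ord_mul (fun t => hY Y (hw (hm + t)))) /hvd.
by apply: eq_bigr => j _; apply: eq_bigr => t _; rewrite addnA.
Qed.

Lemma light_total Y : rt - sgr 0 Y =
  \sum_(s < slots) thq * (aqw (Tw s) * (1 - (safe Y (Tw s))%:R)).
Proof.
rewrite /sgr big_mkord /rate mulr_natl -[X in _ *+ X]card_ord -sumr_const -sumrB.
by apply: eq_bigr => s _; rewrite /gY; ring.
Qed.

Section Instance.
Variables hvs lts : seq S.
Hypothesis p01 : forall v, 0 <= p v <= 1.
Hypothesis hvsE : hvs = [seq v <- enum S | 2^-1 < p v].
Hypothesis ltsE : lts = [seq v <- enum S | ~~ (2^-1 < p v)].
Definition table : seq S := flatten [seq nseq (nslot thq (p v)) v | v <- lts].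
Hypothesis hwE : forall t, hw t = nth nullw (map inl hvs) t.
Hypothesis TwE : forall s, Tw s = nth nullw (map inl table) s.
Hypothesis hvs_fit : (size hvs <= hm + hb * b)%N.
Hypothesis table_fit : (size table <= slots)%N.

Lemma light_half v : v \in lts -> 0 <= p v <= 2^-1.
Proof.
by rewrite ltsE mem_filter -leNgt => /andP[-> _]; rewrite andbT; case/andP: (p01 v).
Qed.

Lemma lam_ge0 (x : R) : 0 <= x <= 2^-1 -> 0 <= lam x.
Proof. by move=> /andP[x0 x1]; rewrite /lam oppr_ge0; apply: ln_le0; lra. Qed.

(** Since [nslot] exceeds [lam x / thq], [accept] is a genuine probability and [clamp] does nothing;
    the accepted rates of all slots then add up to [lam x] for any [thq]. *)
Lemma accept_rate x : 0 <= x <= 2^-1 ->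
  (nslot thq x)%:R * (thq * clamp (accept thq x)) = lam x.
Proof.
move=> hx; have l0 := lam_ge0 hx.
have n0 : 0 < (nslot thq x)%:R :> R by rewrite ltr0n.
have tn : 0 < thq * (nslot thq x)%:R by rewrite mulr_gt0.
rewrite clampE /accept; last first.
  apply/andP; split; first by rewrite divr_ge0 // ltW.
  rewrite ler_pdivrMr // mul1r mulrC -ler_pdivrMr //.
  by apply: ltW; exact: truncnS_gt.
by field; rewrite ?(gt_eqF n0) ?(gt_eqF thq_gt0).
Qed.

(** A light record stays out of the answer with probability [expR (- lam x) = 1 - x], a heavy one
    with [1 - x] directly, and the two classes partition [S]. *)
Lemma product_law Y : hvm Y * (hvd 0 Y * expR (- (rt - sgr 0 Y))) =
  \prod_(v in ~: Y) (1 - p v).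
Proof.
have sfE v : (1 - (safe Y (inl v))%:R) = (v \notin Y)%:R :> R.
  by rewrite /=; case: (v \in Y); rewrite ?subrr ?subr0.
rewrite mulrA heavy_total light_total.
rewrite [\prod_(t < hm + hb * b) _](eq_bigr (fun t => hY Y (nth nullw (map inl hvs) (nat_of_ord t))));
  last by move=> t _; rewrite hwE.
rewrite (@big_nth_pad 1 _ (hY Y)) ?size_map //; last by rewrite /hY /= mul0r subr0.
rewrite [\sum_(s < slots) _](_ : _ = \sum_(v <- lts) lam (p v) * (v \notin Y)%:R); last first.
  rewrite (eq_bigr (fun s => (fun w => thq * (aqw w * (1 - (safe Y w)%:R)))
    (nth nullw (map inl table) (nat_of_ord s)))); last by move=> s _; rewrite TwE.
  rewrite (@big_nth_pad 0 _ (fun w => thq * (aqw w * (1 - (safe Y w)%:R)))) ?size_map //;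
    last by rewrite /= mul0r mulr0.
  rewrite big_map /table big_flatten big_map big_seq [RHS]big_seq; apply: eq_bigr => v vl.
  rewrite big_nseq iter_addr_0 sfE -(accept_rate (light_half vl)) -mulr_natl /aqw; ring.
rewrite -sumrN (big_morph _ (@expRD R) (@expR0 R)) big_map hvsE ltsE !big_filter.
rewrite (eq_bigr (fun v => if v \notin Y then 1 - p v else 1)); last first.
  move=> v _; rewrite /hY sfE /hqw clampE //.
  by case: (v \in Y); rewrite /= ?mulr0 ?subr0 ?mulr1.
rewrite [X in _ * X](eq_bigr (fun v => if v \notin Y then 1 - p v else 1)); last first.
  move=> v; rewrite -leNgt => hv; case: (v \in Y); rewrite /= ?mulr0 ?oppr0 ?expR0 //.
  by rewrite mulr1 /lam opprK lnK // posrE; lra.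
rewrite -(bigID (fun v => 2^-1 < p v) xpredT) /= big_enum -big_mkcond.
by apply: eq_bigl => v; rewrite inE.
Qed.

Theorem machine_samples (bound : R) : unitc <= bound ->
  exists init : cfg -> R, [/\ is_distribution init,
    answers_subset_sampling (prog_of pdst) p init &
    amortized_expected_cost (prog_of pdst) p init bound].
Proof. exact: machine_main product_law. Qed.

End Instance.
End Machine.

(** * Instances that fit in memory *)

Section InMemory.
Variables (R : realType) (M' B W' : nat).
Notation M := M'.+1.
Notation W := W'.+1.
Notation act := (action M B 0 W).

Definition mem_act (D : seq nat) : act :=
  ([set x : 'I_M | (x : nat) \in D], [ffun x => inl x], Halt _ _ _).

Definition mem_dist (u : view R M W) : fd R act :=
  fmap mem_act (subs [seq (hq u a, a) | a <- iota 0 M]).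

Lemma valid_mem_dist u : fd_valid (mem_dist u).
Proof. by apply: valid_fmap; apply: valid_subs_map; exact: hq01. Qed.

Variables (S : finType) (p : S -> R).
Hypothesis p01 : forall v, 0 <= p v <= 1.
Hypothesis S_fits : (#|S| <= M)%N.
Notation cfg := (config M B 0 W S).

Definition nullM : S + 'I_W := inr ord_max.

Definition mem_cfg : cfg :=
  ([ffun x : 'I_M => nth nullM (map inl (enum S)) x], [ffun=> [ffun=> inr ord_max]]).

Lemma mem_next D : next_config (mem_act D) mem_cfg = mem_cfg.
Proof.
rewrite /next_config /=; congr (_, _); apply/ffunP => x; by rewrite !ffunE.
Qed.

Definition mem_safe (Y : {set S}) (a : nat) : bool :=
  if nth nullM (map inl (enum S)) a is inl v then v \in Y else true.

Lemma mem_reported D (Y : {set S}) : all (fun a => a < M)%N D ->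
  (reported (mem_act D) mem_cfg.1 \subset Y)%:R = \prod_(a <- D) (mem_safe Y a)%:R :> R.
Proof.
move=> hD; have -> : \prod_(a <- D) (mem_safe Y a)%:R = (all (mem_safe Y) D)%:R :> R.
  elim: D {hD} => [|a D IH]; first by rewrite big_nil.
  by rewrite big_cons IH /=; case: (mem_safe Y a); rewrite ?mul1r ?mul0r.
congr (_%:R); congr nat_of_bool; apply/fintype.subsetP/allP => [h a aD|h v].
  rewrite /mem_safe; case e : (nth _ _ a) => [v|//]; apply: h; rewrite inE.
  have aM : (a < M)%N by exact: (allP hD).
  by apply/existsP; exists (Ordinal aM); rewrite inE /= aD ffunE /= e eqxx.
rewrite inE => /existsP[x /andP[]]; rewrite inE /= ffunE => xD /eqP e.
by have := h _ xD; rewrite /mem_safe e.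
Qed.

Lemma hq_mem a : (a < M)%N -> hq (view_of p mem_cfg.1) a =
  if nth nullM (map inl (enum S)) a is inl v then p v else 0 :> R.
Proof.
move=> aM; rewrite /hq /vget !ffunE /cl inordK //.
by case: nth => [v|//]; rewrite clampE.
Qed.

Lemma mem_value (Y : {set S}) :
  E (mem_dist (view_of p mem_cfg.1)) (fun a => (reported a mem_cfg.1 \subset Y)%:R) =
  \prod_(v in ~: Y) (1 - p v).
Proof.
rewrite E_fmap (@eq_E_on _ _ _ _ (fun D => \prod_(a <- D) (mem_safe Y a)%:R)); last first.
  move=> D hD; apply: mem_reported.
  apply: (@support_subs R _ (fun a => a < M)%N _ _ hD) => x xl.
  by have [a [<- /In_mem]] := In_map xl; rewrite mem_iota.
rewrite E_subs big_map big_seq.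
rewrite (eq_bigr (fun a => (fun w : S + 'I_W => if w is inl v then
    (if v \in ~: Y then 1 - p v else 1) else 1) (nth nullM (map inl (enum S)) a))); last first.
  move=> a; rewrite mem_iota => aM; rewrite /= hq_mem // /mem_safe.
  case: nth => [v|i]; last by rewrite mul0r subr0.
  by rewrite inE; case: (v \in Y); rewrite ?subrr ?mulr0 ?subr0 ?mulr1.
rewrite -big_seq -{1}(subn0 M) -/(index_iota 0 M) (@big_cat_nat _ _ _ #|S|) //=.
rewrite [X in _ * X]big_nat_cond [X in _ * X]big1 ?mulr1; last first.
  by move=> a /andP[/andP[ha _] _]; rewrite nth_default // size_map -cardE.
transitivity (\prod_(w <- map (inl : S -> S + 'I_W) (enum S))
    (if w is inl v then (if v \in ~: Y then 1 - p v else 1) else 1)).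
  by rewrite (big_nth nullM) size_map -cardE.
by rewrite big_map big_enum -big_mkcond.
Qed.

Theorem mem_samples (bound : R) : 0 <= bound ->
  exists init : cfg -> R, [/\ is_distribution init,
    answers_subset_sampling (prog_of mem_dist) p init &
    amortized_expected_cost (prog_of mem_dist) p init bound].
Proof.
move=> b0; pose Rd (c : cfg) := c = mem_cfg.
exists (fun c => (mem_cfg == c)%:R).
have sumE (F : cfg -> R) : \sum_c (mem_cfg == c)%:R * F c = F mem_cfg.
  rewrite (bigD1 mem_cfg) //= eqxx mul1r big1 ?addr0 // => c /negPf ne.
  by rewrite eq_sym ne mul0r.
have hact c : Rd c -> on_support (mem_dist (view_of p c.1))
    (fun a => is_halt a.2 /\ next_config a c = mem_cfg).
  by move=> ->; apply: support_fmap; apply: support_all => D; split=> //; exact: mem_next.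
have Rd_step c : Rd c -> on_support (mem_dist (view_of p c.1))
    (fun a => if is_halt a.2 then Rd (next_config a c) else Rd (next_config a c)).
  by move=> /hact h x /h[-> e].
have Rd_stops c : Rd c -> stops_within p mem_dist 1 c.
  by move=> /hact h x /h[-> _]; left.
have Rd0 c : (mem_cfg == c)%:R != 0 :> R -> Rd c.
  by case: (mem_cfg =P c) => [e _|]; rewrite ?eqxx // /Rd e.
have PQE Ys : (PQ p mem_dist 1 Ys mem_cfg).[1] = \prod_(Y <- Ys) \prod_(v in ~: Y) (1 - p v).
  elim: Ys => [|Y Ys IH]; first by rewrite big_nil /= hornerC.
  have -> : PQ p mem_dist 1 (Y :: Ys) mem_cfg =
    PV p mem_dist 1 mem_cfg Y (PQ p mem_dist 1 Ys) by [].
  rewrite (@PV_value _ _ _ _ _ _ p mem_dist 0) big_cons -IH -mem_value -E_scaler.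
  apply: eq_E_on => a ha; have [h1 h2] := hact mem_cfg erefl a ha.
  by rewrite h1 h2.
have PQD q : (PQ p mem_dist 1 (nseq q [set: S]) mem_cfg)^`().[1] = 0.
  elim: q => [|q IH]; first by rewrite /= derivC horner0.
  have -> : PQ p mem_dist 1 (nseq q.+1 [set: S]) mem_cfg =
    PV p mem_dist 1 mem_cfg [set: S] (PQ p mem_dist 1 (nseq q [set: S])) by [].
  rewrite (@PV_deriv _ _ _ _ _ _ p mem_dist 0) (@eq_E_on _ _ _ _ (fun=> 0)).
    by rewrite E_cst //; exact: valid_mem_dist.
  by move=> a ha; have [h1 h2] := hact mem_cfg erefl a ha; rewrite h1 h2.
split.
- by split=> [c|]; [exact: ler0n | have := sumE (fun=> 1); under eq_bigr do rewrite mulr1].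
- apply: (@answers_of_value _ _ _ _ _ _ p mem_dist Rd Rd 1 (fun c h => h) Rd_step Rd_stops _ Rd0) => Ys.
  by rewrite sumE PQE.
apply: (@cost_of_deriv _ _ _ _ _ _ p mem_dist Rd Rd 1 (fun c h => h) Rd_step Rd_stops _ Rd0) => q.
by rewrite sumE PQD mulr_ge0.
Qed.

End InMemory.

(** * Choice of the parameters *)

Section Choices.
Variable R : realType.

(** [- ln (1 - x) = ln (1 + x / (1 - x)) <= x / (1 - x)], and [1 - x >= 1 / 2]. *)
Lemma lam_le (x : R) : 0 <= x <= 2^-1 -> 0 <= lam x <= 2 * x.
Proof.
move=> /andP[x0 x1]; have x2 : 0 < 1 - x by lra.
apply/andP; split; first by rewrite /lam oppr_ge0 ln_le0 //; lra.
have -> : lam x = ln (1 + x / (1 - x)).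
  rewrite /lam -lnV ?posrE //; congr ln; field; exact: lt0r_neq0.
apply: le_trans (le_ln1Dx _) _.
  by apply: lt_le_trans (_ : 0 <= _); [lra | rewrite divr_ge0 // ltW].
by rewrite ler_pdivrMr //; nra.
Qed.

Lemma size_table (dl : R) (S : finType) (p : S -> R) kq (s : seq S) :
  0 < th dl kq -> (forall v, v \in s -> 0 <= lam (p v)) ->
  (size (table dl p kq s))%:R <= (\sum_(v <- s) lam (p v)) / th dl kq + (size s)%:R.
Proof.
move=> t0; elim: s => [|v s IH] hs; first by rewrite big_nil mul0r add0r.
have lv : 0 <= lam (p v) by apply: hs; rewrite inE eqxx.
have IHs : (size (table dl p kq s))%:R <=
    (\sum_(v <- s) lam (p v)) / th dl kq + (size s)%:R.
  by apply: IH => w ws; apply: hs; rewrite inE ws orbT.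
have hq0 : 0 <= lam (p v) / th dl kq by rewrite divr_ge0 // ltW.
have hn : (Num.truncn (lam (p v) / th dl kq))%:R <= lam (p v) / th dl kq.
  by case/andP: (truncn_itv hq0).
have -> : size (table dl p kq (v :: s)) =
    (nslot (th dl kq) (p v) + size (table dl p kq s))%N.
  by rewrite /table /= size_cat size_nseq.
rewrite big_cons mulrDl natrD /nslot [size (v :: s)]/= -!natr1.
by lra.
Qed.

Lemma pow_bounds n : (0 < n)%N ->
  [/\ (27 <= n.+2 ^ 3)%N, (243 * n.+2 ^ 3 <= n.+2 ^ 8)%N & (n <= n.+2 ^ 3)%N].
Proof.
move=> n0; split.
- by rewrite -[27%N]/(3 ^ 3)%N leq_exp2r.
- by rewrite (expnD _ 5 3) leq_mul2r -[243%N]/(3 ^ 5)%N leq_exp2r // orbC n0.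
by apply: leq_trans (_ : n.+2 ^ 1 <= _)%N; [rewrite expn1; lia | rewrite leq_exp2l].
Qed.

(** The [b.-1] heavy records allowed for in memory absorb the rounding up to whole blocks:
    [hb * b <= h]. So the heavy scan costs at most [2 * mu / b], with no additive I/O, which the
    bound could not afford. *)
Lemma heavy_blocks h hm b n hmax : (0 < b)%N -> (b.-1 <= hm)%N -> (h <= n)%N ->
  ((n + b.-1) %/ b <= hmax)%N -> let hb := ((h - hm + b.-1) %/ b)%N in
  [/\ (hb * b <= h)%N, (h <= hm + hb * b)%N, (hb <= hmax)%N & (hb <= n)%N].
Proof.
move=> b0 bh hn hx; have h3 : ((h - hm + b.-1) %/ b <= hmax)%N.
  by apply: leq_trans hx; apply: leq_div2r; rewrite leq_add2r; apply: leq_trans hn; exact: leq_subr.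
move: (divn_eq (h - hm + b.-1) b) (ltn_pmod (h - hm + b.-1) b0) h3 {hx} => /=.
move: (_ %/ _)%N (_ %% _)%N => q r qE rb h3.
have qb : (q * b <= h)%N.
  have [le_hm|lt_hm] := leqP hm h; first by lia.
  by case: q qE {h3} => [|q] qE; rewrite ?mul0n // mulSn in qE *; lia.
split=> //; first by lia.
by apply: leq_trans hn; apply: leq_trans qb; rewrite leq_pmulr.
Qed.

(** * Rate and table for a given tree shape *)

Section Shape.
Variables (n M' B' K' W' b zt hm f f0 L tb hmax : nat).
Hypothesis n_gt0 : (0 < n)%N.
Hypotheses (b_gt0 : (0 < b)%N) (b_leB : (b <= B'.+1)%N)
  (zt_cases : zt = b /\ (b < B'.+1)%N \/ [/\ zt = 0%N, b = 1%N & f0 = 0%N])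
  (f0_le : (f0 <= f)%N) (f0_L : (0 < L)%N = (0 < f0)%N)
  (mem_fits : (cb b zt hm f + f <= M'.+1)%N)
  (disk_fits : (tb + hmax + off f f0 L L <= K'.+1)%N)
  (tb_cnt : (0 < f0)%N -> tb = cnt f f0 L 0)
  (f_ge2 : (0 < L)%N -> (1 < f)%N) (small_b : f0 = 0%N -> b = 1%N).
Hypotheses (slots_ge : (2 * n <= slots b tb)%N) (slots_le : (slots b tb <= 4 * n)%N)
  (f_le : (f <= n)%N) (fb_le : (f * b <= n)%N) (L_le : (L <= 2 * n)%N)
  (b_hm : (b.-1 <= hm)%N) (hmax_ge : ((n + b.-1) %/ b <= hmax)%N).

Definition shape_dist : view R M'.+1 W'.+1 -> fd R (action M'.+1 B'.+1 K'.+1 W'.+1) :=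
  @pdist R M' B' K' W' (n.+2 ^ 8) (36 * n.+2 ^ 3) (n.+2 ^ 3)%:R^-1 b zt hm f f0 L tb hmax.

Lemma shape_samples (S : finType) (p : S -> R) (bound : R) :
  (n.+2 ^ 64 <= W'.+1)%N -> #|S| = n -> (forall v, 0 <= p v <= 1) ->
  (2 * mu p + (wN f0 L)%:R * (8 * mu p + 4 / n.+2%:R ^+ 2)) / b%:R + n%:R^-1 <= bound ->
  exists init : config M'.+1 B'.+1 K'.+1 W'.+1 S -> R, [/\ is_distribution init,
    answers_subset_sampling (prog_of shape_dist) p init &
    amortized_expected_cost (prog_of shape_dist) p init bound].
Proof.
move=> W_ge Sn p01 Hb; have [T27 TQ nT] := pow_bounds n_gt0.
have m2 : ((n.+2 ^ 8) ^ 8 <= W'.+1)%N by rewrite -expnM; exact: W_ge.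
have xT : (n.+2 ^ 3)%:R = (n%:R + 2) ^+ 3 :> R by rewrite natrX -addn2 natrD.
rewrite /shape_dist; move: m2 xT T27 TQ nT {W_ge}.
move: (n.+2 ^ 3)%N (n.+2 ^ 8)%N => T Q m2 xT T27 TQ nT.
have QW : (Q <= W'.+1)%N.
  by apply: leq_trans m2; rewrite -{1}(expn1 Q) leq_pexp2l //; lia.
move: m2.
pose hvs := [seq v <- enum S | 2^-1 < p v].
pose lts := [seq v <- enum S | ~~ (2^-1 < p v)].
pose La := \sum_(v <- lts) lam (p v).
have n0 : 0 < n%:R :> R by rewrite ltr0n.
have ltsP v : v \in lts -> 0 <= p v <= 2^-1.
  by rewrite mem_filter -leNgt => /andP[-> _]; rewrite andbT; case/andP: (p01 v).
have La0 : 0 <= La.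
  by rewrite /La big_seq; apply: sumr_ge0 => v /ltsP/lam_le/andP[].
have muE : mu p = \sum_(v <- enum S) p v by rewrite /mu big_enum.
have mu_n : mu p <= n%:R.
  rewrite -Sn /mu -[leRHS]mulr1 mulr_natl -sumr_const; apply: ler_sum => v _.
  by case/andP: (p01 v).
have mu0 : 0 <= mu p by apply: sumr_ge0 => v _; case/andP: (p01 v).
have La_mu : La <= 2 * mu p.
  rewrite /La muE big_distrr /= /lts big_filter big_mkcond; apply: ler_sum => v _.
  case: ifP => [|_]; last by have /andP[h _] := p01 v; rewrite mulr_ge0.
  by rewrite -leNgt => h; have /andP[h1 _] := p01 v; have /andP[] := lam_le (introT andP (conj h1 h)).
have h_mu : (size hvs)%:R <= 2 * mu p.
  have -> : (size hvs)%:R = \sum_(v <- hvs) 1 :> R.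
    by rewrite big_const_seq count_predT iter_addr_0.
  rewrite muE big_distrr /= /hvs big_filter big_mkcond; apply: ler_sum => v _.
  by have /andP[h1 _] := p01 v; case: ifP => h; lra.
have h_n : (size hvs <= n)%N by rewrite -Sn cardE size_filter count_size.
have l_n : (size lts <= n)%N by rewrite -Sn cardE size_filter count_size.
have [hb_h hvs_fit hb_max hb_n] := heavy_blocks b_gt0 b_hm h_n hmax_ge.
move: ((size hvs - hm + b.-1) %/ b)%N hb_h hvs_fit hb_max hb_n => hb hb_h hvs_fit hb_max hb_n.
pose dl : R := T%:R^-1.
have T0 : 0 < T%:R :> R by rewrite ltr0n; lia.
have dl0 : 0 < dl by rewrite invr_gt0.
(* [kq * dl] is the first multiple of [dl] above [La / n]. Then the table needs at most [2 * n]
   slots, one [n] for the rates and one for rounding up [nslot], and the total rate is at most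
   [4 * (La + n * dl)]. *)
pose y := La / (n%:R * dl).
have y0 : 0 <= y by rewrite divr_ge0 // mulr_ge0 // ltW.
pose kq := (Num.truncn y).+1.
have yk : y < kq%:R by exact: truncnS_gt.
have ky : kq%:R <= y + 1.
  by rewrite -natr1 lerD2r; case/andP: (truncn_itv y0).
pose t := th dl kq.
have tE : t = kq%:R * dl by [].
have t_lo : La < n%:R * t.
  move: yk; rewrite /y ltr_pdivrMr ?mulr_gt0 // tE => h.
  by apply: lt_le_trans h _; rewrite le_eqVlt; apply/orP; left; apply/eqP; ring.
have t_hi : n%:R * t <= La + n%:R * dl.
  have -> : La + n%:R * dl = n%:R * ((y + 1) * dl).
    by rewrite /y; field; rewrite ?(gt_eqF n0) ?(gt_eqF dl0).
  by rewrite tE ler_pM2l // ler_pM2r.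
have t0 : 0 < t by rewrite tE mulr_gt0 // ltr0n.
have table_fit : (size (table dl p kq lts) <= slots b tb)%N.
  apply: leq_trans slots_ge; rewrite -(ler_nat R).
  apply: le_trans (size_table t0 _) _ => [v /ltsP/lam_le/andP[] //|].
  rewrite -/La -/t mul2n -addnn natrD; apply: lerD; last by rewrite ler_nat.
  by rewrite ler_pdivrMr // ltW.
have kq_T : (kq <= 2 * T + 1)%N.
  rewrite -(ler_nat R) natrD natrM; apply: le_trans ky _; rewrite lerD2r.
  rewrite /y ler_pdivrMr ?mulr_gt0 // /dl.
  have -> : 2 * T%:R * (n%:R * T%:R^-1) = 2 * n%:R :> R by field; exact: lt0r_neq0.
  by apply: le_trans La_mu _; rewrite ler_pM2l.
set rt := rate dl b tb kq.
have rtE : rt = (slots b tb)%:R * t by [].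
have s0 : (0 < slots b tb)%N by apply: leq_trans slots_ge; rewrite muln_gt0.
have rt0 : 0 < rt by rewrite rtE mulr_gt0 // ltr0n.
have x1 : 1 <= n%:R :> R by rewrite ler1n.
have N2 : n.+2%:R = n%:R + 2 :> R by rewrite -addn2 natrD.
have z0 : 0 < n%:R + 2 :> R by lra.
(* The cube in [dl] makes the rounding of the rate so small that it survives multiplication by the
   depth [L <= 2 * n] hidden in [wN]. *)
have ndl : n%:R * dl <= 1 / n.+2%:R ^+ 2.
  rewrite /dl xT N2 [leRHS](_ : _ = (n%:R + 2) / (n%:R + 2) ^+ 3); last first.
    by field; exact: lt0r_neq0.
  by rewrite ler_pM2r ?invr_gt0 ?exprn_gt0 //; lra.
have q1 : 1 / n.+2%:R ^+ 2 <= 1 / 9 :> R.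
  by rewrite N2 ler_pdivrMr ?exprn_gt0 //; nra.
have rt_hi : rt <= 8 * mu p + 4 / n.+2%:R ^+ 2.
  apply: le_trans (_ : 4 * (n%:R * t) <= _).
    by rewrite rtE mulrA ler_pM2r // -natrM ler_nat.
  move: ndl t_hi La_mu; rewrite mul1r; move: (_ ^+ 2)^-1 => v.
  by move: (n%:R * dl) (n%:R * t) => a c; lra.
have rt_n : rt <= 8 * n%:R + 1.
  by move: rt_hi q1 mu_n; rewrite mul1r; move: (_ ^+ 2)^-1 => v; lra.
(* By Markov this is at most [4 * n * (8 * n + 1) / (36 * (n + 2) ^ 3 + 1)]; the 36 dominates
   [32 * n ^ 3 + 4 * n ^ 2], so a scan of the table costs at most [1 / n] on average. *)
have tl : (slots b tb)%:R * tail (36 * T).+1 rt <= n%:R^-1.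
  have tm := @tail_markov R (36 * T).+1 rt (ltW rt0).
  have J0 : 0 < (36 * T).+1%:R :> R by rewrite ltr0n.
  have tg : 0 <= tail (36 * T).+1 rt by apply: tail_ge0; exact: ltW.
  apply: le_trans (_ : 4 * n%:R * ((8 * n%:R + 1) / (36 * T).+1%:R) <= _).
    apply: ler_pM => //; first by rewrite -natrM ler_nat.
    by rewrite ler_pdivlMr // mulrC; apply: le_trans tm _.
  rewrite -[leRHS]mul1r ler_pdivlMr // mulrA mulrAC ler_pdivrMr // mul1r.
  have -> : (36 * T).+1%:R = 36 * (n%:R + 2) ^+ 3 + 1 :> R by rewrite -natr1 natrM xT.
  have := mulr_ge0 (ltW n0) (ltW n0); have := mulr_ge0 (ltW n0) (mulr_ge0 (ltW n0) (ltW n0)).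
  by move: (n%:R) x1 => x x1 h1 h2; lra.
have fW : (f < W'.+1)%N by apply: leq_trans QW; clear - TQ T27 nT f_le; lia.
have m1 fa s : (fa <= f)%N ->
    lab_of fa (nth (nullw W' S) (map inl (table dl p kq lts)) s) = None.
  move=> fa_f; case: (ltnP s (size (table dl p kq lts))) => hs.
    case ex : (table dl p kq lts) hs => [|v s'] // hs.
    by rewrite (nth_map v).
  rewrite nth_default ?size_map // /nullw /= ifF //.
  by apply/negbTE; rewrite -leqNgt; apply: leq_trans fa_f _.
have Q_big : [/\ (10 < Q)%N, ((36 * T).+1 < Q)%N, (slots b tb < Q)%N, (L < Q)%N & (f < Q)%N /\ (f * b < Q)%N].
  clear - TQ T27 nT slots_le L_le f_le fb_le n_gt0.
  by split; [lia|lia|lia|lia|split; lia].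
have hbQ : (hb < Q)%N by clear - TQ T27 nT hb_n; lia.
have kqQ : (kq < Q)%N by clear - TQ T27 kq_T; lia.
move=> W_all.
apply: (@machine_samples R M' B' K' W' Q (36 * T) dl b zt hm f f0 L tb hmax S p
  b_gt0 b_leB zt_cases f0_le f0_L mem_fits disk_fits tb_cnt hb kq
  (fun t => nth (nullw W' S) (map inl hvs) t)
  (fun s => nth (nullw W' S) (map inl (table dl p kq lts)) s)
  hb_max m1 Q_big W_all hbQ kqQ s0 f_ge2 small_b t0 hvs lts p01 erefl erefl
  (fun=> erefl) (fun=> erefl) hvs_fit table_fit).
apply: le_trans Hb; rewrite /unitc -/rt; apply: lerD => //.
have b0 : 0 < b%:R :> R by rewrite ltr0n.
rewrite mulrDl; apply: lerD.
  rewrite ler_pdivlMr // -natrM; apply: le_trans h_mu.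
  by rewrite ler_nat.
by rewrite ler_pM2r ?invr_gt0 // ler_wpM2l.
Qed.

End Shape.

(** [n > B] forces at least one iteration of the logarithm, so the first term is at least [1 / B];
    [n > M] makes the logarithmic factor at least 1. *)
Lemma query_bound_ge (n M B : nat) (m : R) : (0 < B)%N -> (2 * B <= M)%N ->
  (M < n)%N -> 0 <= m ->
  1 <= ln (n%:R / B%:R) / ln (M%:R / B%:R) :> R /\
  B%:R^-1 + m / B%:R * (ln (n%:R / B%:R) / ln (M%:R / B%:R)) <= query_bound M B n m.
Proof.
move=> B0 BM Mn m0; have B0r : 0 < B%:R :> R by rewrite ltr0n.
have MB : 2 <= M%:R / B%:R :> R by rewrite ler_pdivlMr // -natrM ler_nat.
have l0 : 0 < ln (M%:R / B%:R) :> R by apply: ln_gt0; lra.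
have l1 : 1 <= ln (n%:R / B%:R) / ln (M%:R / B%:R) :> R.
  have h : M%:R / B%:R <= n%:R / B%:R :> R by rewrite ler_pM2r ?invr_gt0 // ler_nat ltnW.
  by rewrite ler_pdivlMr // mul1r ler_ln ?posrE //; lra.
split=> //; rewrite /query_bound; apply: lerD.
  rewrite -[leLHS]mul1r ler_pM2r ?invr_gt0 // ler1n /log_star.
  by case: ex_minnP => [[|t]] //=; rewrite ler_nat => h; lia.
by rewrite ler_wpM2l ?divr_ge0 // le_max lexx orbT.
Qed.

Lemma query_bound_ge0 (n M B : nat) (m : R) : 0 <= m -> 0 <= query_bound M B n m.
Proof.
move=> m0; rewrite addr_ge0 ?divr_ge0 // mulr_ge0 ?divr_ge0 //.
by rewrite le_max lexx.
Qed.

(** Take the least depth [l.+1] reaching [2 * n] slots, then the least root fan-out. As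
    [b * f ^ l < 2 * n], rounding the fan-out up at most doubles the table; a root narrower than [f]
    keeps the space linear. *)
Lemma tree_shape n b f : (0 < b)%N -> (b < 2 * n)%N -> (1 < f)%N ->
  exists l f0, [/\ (b * f ^ l < 2 * n)%N, (0 < f0 <= f)%N,
    (2 * n <= f0 * f ^ l * b)%N & (f0 * f ^ l * b < 4 * n)%N].
Proof.
move=> b0 bn f1.
have exL : exists k, (2 * n <= b * f ^ k)%N.
  exists (2 * n)%N; apply: leq_trans (ltnW (ltn_expl (2 * n) f1)) _.
  by rewrite leq_pmull.
case: (ex_minnP exL) => [[|l]] hl lmin; first by rewrite expn0 muln1 in hl; lia.
have hD : (b * f ^ l < 2 * n)%N by rewrite ltnNge; apply/negP => /lmin; rewrite ltnn.
have hD0 := hD; set D := (b * f ^ l)%N in hD.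
have D0 : (0 < D)%N by rewrite muln_gt0 b0 expn_gt0; lia.
have hl' : (2 * n <= D * f)%N by rewrite /D -mulnA -expnSr.
exists l, ((2 * n + D.-1) %/ D)%N.
move: (divn_eq (2 * n + D.-1) D) (ltn_pmod (2 * n + D.-1) D0).
move: (_ %/ _)%N (_ %% _)%N => f0 r fE fr.
have -> : (f0 * f ^ l * b = f0 * D)%N by rewrite /D -mulnA [(f ^ l * b)%N]mulnC.
clear exL lmin hl; clearbody D.
split; [exact: hD0 | | lia | lia].
apply/andP; split; first by rewrite lt0n; apply/eqP => e; rewrite e mul0n in fE; lia.
by rewrite -ltnS -(ltn_pmul2r D0) mulSn; lia.
Qed.

(** Level sizes shrink at least by half going up, a geometric series. *)
Lemma off_le f f0 l : (1 < f)%N -> (off f f0 l.+1 l.+1 <= 2 * (f0 * f ^ l))%N.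
Proof.
move=> f1.
have H k : (k <= l)%N -> (off f f0 l.+1 k.+1 + f0 * f ^ (l - k) <= 2 * (f0 * f ^ l))%N.
  elim: k => [|k IH] kl.
    by rewrite /off big_ord_recr big_ord0 /= /cnt /= !subn0; lia.
  have := IH (ltnW kl); rewrite /off [in X in _ -> X]big_ord_recr /= /cnt.
  rewrite ifF; last by lia.
  rewrite /= -(subnSK kl) expnS.
  have : (2 * (f0 * f ^ (l - k.+1)) <= f0 * (f * f ^ (l - k.+1)))%N.
    by rewrite mulnCA; apply: leq_mul => //; apply: leq_mul.
  by lia.
by apply: leq_trans (H l (leqnn _)); exact: leq_addr.
Qed.

(** Rounding loses [M / B <= f ^ 2] and [B <= 16 * b]. With [x = ln (M / B)] and [y = ln (n / B)]
    this gives [l * x <= 2 * (5 * x + y)], hence [(l + 1) * x <= 11 * x + 2 * y <= 13 * y] as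
    [x <= y]. *)
Lemma depth_le (n M B l : nat) : (8 <= B)%N -> (2 * B <= M)%N -> (M < n)%N ->
  (B %/ 8 * (M %/ B) ^ l < 2 * n)%N ->
  l.+1%:R <= 13 * (ln (n%:R / B%:R) / ln (M%:R / B%:R)) :> R.
Proof.
move=> B8 BM Mn hl; have B0 : (0 < B)%N by lia.
have B0r : 0 < B%:R :> R by rewrite ltr0n.
have [l1 _] := @query_bound_ge n M B 0 B0 BM Mn (lexx _).
have MB : 2 <= M%:R / B%:R :> R by rewrite ler_pdivlMr // -natrM ler_nat.
have lM0 : 0 < ln (M%:R / B%:R) :> R by apply: ln_gt0; lra.
have f2 : (2 <= M %/ B)%N by rewrite leq_divRL.
have hB : (B <= 16 * (B %/ 8))%N by clear - B8; lia.
have hM : (M < (M %/ B).+1 * B)%N by exact: ltn_ceil.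
move: (M %/ B)%N (B %/ 8)%N hl f2 hB hM => f b hl f2 hB hM.
have f0r : 0 < f%:R :> R by rewrite ltr0n; lia.
have lM : ln (M%:R / B%:R) <= 2 * ln f%:R :> R.
  rewrite [2 * _]mulr_natl -lnXn // ler_ln ?posrE ?exprn_gt0 //; last by lra.
  rewrite ler_pdivrMr // -natrX -natrM ler_nat.
  apply: leq_trans (ltnW hM) _.
  by rewrite leq_mul2r; apply/orP; right; rewrite -mulnn; nia.
have lf : l%:R * ln f%:R <= ln (32 * (n%:R / B%:R)) :> R.
  rewrite [l%:R * _]mulr_natl -lnXn // ler_ln ?posrE ?exprn_gt0 //; last first.
    by rewrite mulr_gt0 // divr_gt0 // ltr0n; lia.
  rewrite mulrA ler_pdivlMr // -natrX -!natrM ler_nat.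
  apply: leq_trans (_ : f ^ l * (16 * b) <= _)%N; first by rewrite leq_mul2l hB orbT.
  by move: hl; rewrite [(b * _)%N]mulnC; lia.
have l32 : ln (32 * (n%:R / B%:R)) <= 5 * ln (M%:R / B%:R) + ln (n%:R / B%:R) :> R.
  rewrite lnM ?posrE //; last by rewrite divr_gt0 // ltr0n; lia.
  rewrite lerD2r (_ : 32 = 2 ^+ 5 :> R); last by rewrite -natrX.
  rewrite lnXn // (_ : ln 2 *+ 5 = 5 * ln 2); last by rewrite mulr_natl.
  by rewrite ler_pM2l // ler_ln ?posrE //; lra.
have l0 : 0 <= l%:R :> R by [].
rewrite mulrA ler_pdivlMr // -natr1.
move: l1; rewrite ler_pdivlMr // mul1r => l1.
have : l%:R * ln (M%:R / B%:R) <= l%:R * (2 * ln f%:R) :> R by apply: ler_wpM2l.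
by lra.
Qed.

End Choices.

(* Folded, because arithmetic tactics try to evaluate the power. *)
Definition word_bound (n W : nat) : Prop := (n.+2 ^ 64 <= W)%N.

Lemma ceil_div_ge n B : (0 < B)%N -> (n <= B * ceil_div n B)%N.
Proof.
move=> B0; rewrite /ceil_div mulnC.
have := divn_eq (n + B.-1) B; have := ltn_pmod (n + B.-1) B0.
by move: (_ %/ _)%N (_ %% _)%N => q r; lia.
Qed.

Lemma block_count b B n cd tb : (0 < b)%N -> (B <= 16 * b)%N -> (n <= B * cd)%N ->
  (tb * b < 4 * n)%N -> (tb <= 64 * cd)%N /\ ((n + b.-1) %/ b <= 16 * cd + 1)%N.
Proof.
move=> b0 hB ncd tbn; have n_bcd : (n <= 16 * cd * b)%N.
  by apply: leq_trans ncd _; rewrite mulnAC leq_mul2r hB orbT.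
split; first by rewrite -(leq_pmul2r b0) -mulnA; rewrite -mulnA in n_bcd; lia.
by rewrite -ltnS ltn_divLR // mulSn mulnDl mul1n; lia.
Qed.

(** * Small and large blocks when [n] exceeds [M] *)

Section Cases.
Variables (R : realType) (n M' B' W' : nat).
Notation M := M'.+1.
Notation B := B'.+1.
Notation W := W'.+1.
Hypotheses (BM : (2 * B <= M)%N) (Mn : (M < n)%N) (W_ge : word_bound n W).

Definition solves (C K : nat) : Prop :=
  exists2 prog : program R M B K W, randomized_program prog &
  forall (S : finType) (p : S -> R), #|S| = n -> (forall v, 0 <= p v <= 1) ->
  exists init : config M B K W S -> R, [/\ is_distribution init,
    answers_subset_sampling prog p init &
    amortized_expected_cost prog p init (C%:R * query_bound M B n (mu p))].

Lemma mu_ge0 (S : finType) (p : S -> R) : (forall v, 0 <= p v <= 1) -> 0 <= mu p.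
Proof. by move=> p01; apply: sumr_ge0 => v _; case/andP: (p01 v). Qed.

Lemma inv_n_le : n%:R^-1 <= B%:R^-1 :> R.
Proof. by rewrite lef_pV2 ?posrE ?ltr0n // ?ler_nat; lia. Qed.

Lemma four_le : 4 / n.+2%:R ^+ 2 <= 1 :> R.
Proof.
have h : 3 <= n.+2%:R :> R by rewrite ler_nat; lia.
by rewrite ler_pdivrMr ?exprn_gt0 ?ltr0n // mul1r; nra.
Qed.

(** For [B < 8] one I/O is at most [7 / B], so each sample may cost a whole I/O and no tree is used:
    [2 * n] table blocks and [n] heavy blocks of one record each. *)
Lemma solves_small : (B < 8)%N -> solves (200 * 100) (3 * n).+1.
Proof.
move=> B8; have n0 : (0 < n)%N by lia.
exists (prog_of (@shape_dist R n M' B' (3 * n) W' 1 0 0 0 0 0 (2 * n) n)).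
  by apply: prog_of_randomized => u; exact: valid_pdist.
move=> S p Sn p01; have m0 := mu_ge0 p01.
have [l1 ql] := @query_bound_ge R n M B (mu p) (ltn0Sn _) BM Mn m0.
apply: shape_samples => //.
- by right.
- by rewrite /cb /pb /hbase; lia.
- by rewrite /off big_ord0; lia.
- by rewrite /slots muln1.
- by rewrite /slots muln1; lia.
- by rewrite /= addn0 divn1.
have f4 := four_le; have iB := inv_n_le.
set l := ln _ / ln _ in l1 ql; set N2 := 4 / _ in f4 *.
have B0 : 0 < B%:R^-1 :> R by rewrite invr_gt0 ltr0n.
have B1 : 1 <= 7 * B%:R^-1 :> R by rewrite ler_pdivlMr ?ltr0n // mul1r ler_nat.
have qm : mu p / B%:R <= mu p / B%:R * l by rewrite ler_peMr // divr_ge0.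
have := ler_wpM2l m0 B1; rewrite mulr1 mulrCA => qs.
rewrite (_ : (wN 0 0)%:R = 1 :> R) // divr1 mul1r natrM.
move: m0 qm qs ql iB B1 B0 f4; rewrite -/(mu p / B%:R).
clearbody N2 l.
move: (mu p) (n%:R^-1) (B%:R^-1) (query_bound M B n (mu p)) (mu p / B%:R) (mu p / B%:R * l).
by move=> m inn ib z x y; lra.
Qed.

(** With [b = B %/ 8] and [f = M %/ B], the P zone and the counters take at most [M / 8] cells each,
    which leaves room for the Z zone and for [b] heavy records. *)
Lemma solves_big : (8 <= B)%N ->
  exists2 K, (K <= 300 * ceil_div n B)%N & solves (200 * 100) K.
Proof.
move=> B8; have n0 : (0 < n)%N by lia.
have b0 : (0 < B %/ 8)%N by rewrite divn_gt0.
have hB : (B <= 16 * (B %/ 8))%N by clear - B8; lia.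
have hb : (8 * (B %/ 8) <= B)%N by clear - B8; lia.
have f2 : (1 < M %/ B)%N by rewrite leq_divRL.
have fM : (M %/ B * B <= M)%N by exact: leq_trunc_div.
have [l [f0 [hl /andP[f00 f0f] s1 s2]]] :=
  @tree_shape n (B %/ 8) (M %/ B) b0 (ltac:(lia)) f2.
have dl := @depth_le R n M B l B8 BM Mn hl.
have ncd := ceil_div_ge n (ltn0Sn B').
move: (ceil_div n B) ncd => cd ncd.
have cd0 : (0 < cd)%N by rewrite lt0n; apply/eqP => e; rewrite e muln0 in ncd; lia.
have [tcd hcd] := block_count b0 hB ncd s2.
have oL := @off_le (M %/ B) f0 l f2.
have ll : (l < 2 * n)%N.
  apply: leq_trans (_ : (M %/ B) ^ l <= _)%N; first exact: ltn_expl.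
  by apply: leq_trans (ltnW hl); rewrite leq_pmull.
have fb : (8 * (M %/ B * (B %/ 8)) <= M)%N.
  by apply: leq_trans fM; rewrite mulnCA leq_mul2l hb orbT.
have f8 : (8 * (M %/ B) <= M)%N by apply: leq_trans fM; rewrite mulnC leq_mul2l B8 orbT.
have bB : (B %/ 8 < B)%N by lia.
have [hmax [hx1 hx2]] : exists hmax, ((n + (B %/ 8).-1) %/ (B %/ 8) <= hmax)%N /\
    (hmax <= 16 * cd + 1)%N by exists ((n + (B %/ 8).-1) %/ (B %/ 8))%N.
have [tb tbE] : exists tb, tb = (f0 * (M %/ B) ^ l)%N by exists (f0 * (M %/ B) ^ l)%N.
rewrite -!tbE in s1 s2 oL tcd.
have tbC : (0 < f0)%N -> tb = cnt (M %/ B) f0 l.+1 0 by rewrite /cnt /= subn0.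
move: (M %/ B)%N (B %/ 8)%N f2 b0 hB hb f0f s1 s2 hl oL ll fb f8 bB hx1 tbC {fM tbE hcd} =>
  f b f2 b0 hB hb f0f s1 s2 hl oL ll fb f8 bB hx1 tbC.
exists (tb + hmax + off f f0 l.+1 l.+1).+1; first by clear - oL tcd hx2 cd0; lia.
exists (prog_of (@shape_dist R n M' B' (tb + hmax + off f f0 l.+1 l.+1) W' b b b f f0 l.+1 tb hmax)).
  by apply: prog_of_randomized => u; exact: valid_pdist.
move=> S p Sn p01; have m0 := mu_ge0 p01.
have [l1 ql] := @query_bound_ge R n M B (mu p) (ltn0Sn _) BM Mn m0.
apply: shape_samples => //.
- exact: ltnW.
- by left.
- by rewrite /cb /pb /hbase; clear - fb f8 BM B8 hb; lia.
- by move=> e; rewrite e in f00.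
- exact: ltnW.
- by clear - f8 Mn; lia.
- by clear - fb Mn; lia.
- exact: leq_pred.
have f4 := four_le; have iB := inv_n_le.
set le := ln _ / ln _ in dl l1 ql; set N2 := 4 / _ in f4 *.
have B0 : 0 < B%:R :> R by rewrite ltr0n.
have b0r : 0 < b%:R :> R by rewrite ltr0n.
have bi : b%:R^-1 <= 16 * B%:R^-1 :> R.
  rewrite ler_pdivlMr // mulrC ler_pdivrMr // -natrM ler_nat.
  by [].
have LN : l.+1%:R * N2 <= 8 :> R.
  rewrite /N2 mulrA ler_pdivrMr ?exprn_gt0 ?ltr0n //.
  apply: le_trans (_ : 8 * n%:R <= _).
    by rewrite -!natrM ler_nat; clear - ll; lia.
  by rewrite ler_pM2l // -natrX ler_nat -mulnn mulSn; clear; lia.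
have wE : (wN f0 l.+1)%:R = 10 * l.+1%:R :> R.
  by rewrite /wN ifF ?natrM //; clear - f00; lia.
have Lm : l.+1%:R * mu p <= 13 * le * mu p by rewrite ler_wpM2r.
have mm : mu p <= mu p * le by rewrite ler_peMr.
rewrite wE natrM; clearbody le N2; set X := 2 * mu p + _.
(* [1042 = 2 + 10 * 8 * 13], from the price 10 per level, the rate [8 * mu] and the 13 of
   [depth_le]; [80 = 10 * 8] comes from [LN]. *)
have X1 : X <= 1042 * (mu p * le) + 80.
  by rewrite /X; move: Lm mm LN; move: (l.+1%:R : R) (mu p) => x m; lra.
have X0 : 0 <= 1042 * (mu p * le) + 80 by lra.
apply: le_trans (_ : (1042 * (mu p * le) + 80) * (16 * B%:R^-1) + B%:R^-1 <= _).
  apply: lerD => //; apply: le_trans (_ : (1042 * (mu p * le) + 80) * b%:R^-1 <= _).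
    by rewrite ler_pM2r ?invr_gt0.
  by rewrite ler_wpM2l.
have Bi : 0 < B%:R^-1 :> R by rewrite invr_gt0.
apply: le_trans (_ : 200%:R * 100%:R * (B%:R^-1 + mu p / B%:R * le) <= _); last first.
  by rewrite ler_pM2l // mulr_gt0.
have h0 : 0 <= mu p / B%:R * le by rewrite mulr_ge0 ?divr_ge0 //; lra.
have -> : (1042 * (mu p * le) + 80) * (16 * B%:R^-1) =
  16 * 1042 * (mu p / B%:R * le) + 16 * 80 * B%:R^-1 by ring.
by move: h0 Bi; move: (mu p / B%:R * le) (B%:R^-1) => u v; lra.
Qed.

End Cases.

Theorem theorem2 (R : realType) :
  exists C w : nat, forall n M B : nat,
    (0 < B)%N -> (2 * B <= M)%N ->
    exists2 K : nat, (K <= C * ceil_div n B)%N &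
    exists2 prog : program R M B K (n.+2 ^ w)%N, randomized_program prog &
    forall (S : finType) (p : S -> R),
      #|S| = n -> (forall v, 0 <= p v <= 1) ->
      exists init : config M B K (n.+2 ^ w)%N S -> R,
        [/\ is_distribution init,
            answers_subset_sampling prog p init &
            amortized_expected_cost prog p init
              (C%:R * query_bound M B n (mu p))].
Proof.
(* [200 * 100] exceeds [16 * 1042] and [16 * 80 + 1] of the large-block case. The exponent is
   [8 * 8]: eight digits in base [(n + 2) ^ 8]. *)
exists (200 * 100)%N, 64%N => n [|M'] [|B'] // _ BM.
have [W' WE] : exists W', (n.+2 ^ 64 = W'.+1)%N.
  by exists (n.+2 ^ 64).-1; rewrite prednK // expn_gt0.
have W_ge : word_bound n W'.+1 by rewrite /word_bound WE.
rewrite WE {WE}.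
(* When all records fit in memory, a query is a single round of free computation and the disk is
   empty. *)
have [nM|Mn] := leqP n M'.+1.
  exists 0%N => //; exists (prog_of (@mem_dist R M' B'.+1 W')).
    by apply: prog_of_randomized => u; exact: valid_mem_dist.
  move=> S p Sn p01; apply: mem_samples => //; first by rewrite Sn.
  by rewrite mulr_ge0 // query_bound_ge0 //; exact: mu_ge0.
have big : forall c : nat, (300 * c <= 200 * 100 * c)%N by move=> c; rewrite leq_mul2r orbT.
have [B8|B8] := leqP 8 B'.+1.
  have [K hK HK] := solves_big R BM Mn W_ge B8.
  by exists K => //; exact: leq_trans (big _).
exists (3 * n).+1; last exact: solves_small.
apply: leq_trans (big _).
have ncd := ceil_div_ge n (ltn0Sn B').
have : (B'.+1 * ceil_div n B'.+1 <= 7 * ceil_div n B'.+1)%N by rewrite leq_mul2r; apply/orP; right.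
by move: (ceil_div n B'.+1) ncd => cd ncd; clear - ncd Mn; lia.
Qed.
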